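(* Let $n\ge2$ be an integer. There exists a $1$-parameter family of singular gradient steady Ricci solitons $(M^{n+1},g,\nabla\phi)$, i.e. $\mathrm{Ric}(g)+\nabla\nabla\phi=0$, with $M^{n+1}=(0,+\infty)\times\mathbb{S}^n$, $g=dx^2+\psi^2(x)g_{\mathbb{S}^n}$, $\phi=\phi(x)$, $\omega=\dot\phi$, and with asymptotic profile $$\psi(x)\sim a\,x^{\frac1{\sqrt n}}\ (a>0),\qquad \omega(x)\sim\frac{\sqrt n-1}{x},\qquad \text{as }x\to0^+.$$ These solitons correspond to the trajectories $(X,Y)$ of the system $$X'=X^3-X+\tfrac{Y^2}{\sqrt n},\qquad Y'=Y\big(X^2-\tfrac{X}{\sqrt n}\big)$$ emanating (as $y\to-\infty$) from the equilibrium point $(1,0)$ and lying in the open first quadrant of the $XY$-plane inside the unit disc $X^2+Y^2<1$. Further, the asymptotic behaviour of the solitons at $x=+\infty$ matches that of the Bryant soliton: there are constants $c,C>0$ such that for all large $x$ $$c\,x^{\frac12}\le\psi\le C\,x^{\frac12},\qquad c\,x^{-\frac12}\le\dot\psi\le C\,x^{-\frac12},\qquad -C\,x^{-\frac32}\le\ddot\psi\le -c\,x^{-\frac32}.$$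
   Context: $g_{\mathbb{S}^n}$ is the canonical metric of the unit $n$-sphere; $\psi>0$ is smooth; $\dot{}=\frac{d}{dx}$, $'=\frac{d}{dy}$. The symbol $\sim$ means that the ratio of the two sides tends to $1$. Correspondence between metrics and trajectories (steady case $\lambda=0$): $W=\frac{1}{-\omega+n\dot\psi/\psi}$, $X=\sqrt n\,W\frac{\dot\psi}{\psi}$, $Y=\frac{\sqrt{n(n-1)}\,W}{\psi}$, $dy=\frac{dx}{W}$, with $x\to0^+$ as $y\to-\infty$; here $W>0$ satisfies $W'=WX^2$ and so is determined by the trajectory up to a positive multiplicative constant (a scaling of the metric). Conversely $x(y)=\int_{-\infty}^yW\,dy$, $\psi=\sqrt{n(n-1)}\,W/Y$, $\omega=(\sqrt nX-1)/W$. The Bryant soliton corresponds to the unique trajectory of the $(X,Y)$-system emanating from $\big(\frac1{\sqrt n},\sqrt{1-\frac1n}\big)$ and converging to $(0,0)$ as $y\to+\infty$. *)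

(* Defs.v *)
From HB Require Import structures.
From mathcomp Require Import all_boot all_order all_algebra.
From mathcomp Require Import all_classical all_reals all_analysis.
Set Implicit Arguments.
Unset Strict Implicit.
Unset Printing Implicit Defensive.
Import Order.TTheory GRing.Theory Num.Theory.
Import numFieldNormedType.Exports.
Local Open Scope classical_set_scope.
Local Open Scope ring_scope.

(** * Riemannian geometry in a coordinate chart of dimension [m] *)

Definition partial (R : realType) (m : nat) (i : 'I_m) (f : 'rV[R]_m -> R)
    (p : 'rV[R]_m) : R :=
  'D_(delta_mx 0 i) f p.

Definition christoffel (R : realType) (m : nat) (g : 'rV[R]_m -> 'M[R]_m)
    (k i j : 'I_m) (p : 'rV[R]_m) : R :=
  2^-1 * \sum_(l < m) invmx (g p) k l *
    (partial i (fun q => g q j l) p + partial j (fun q => g q i l) p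
     - partial l (fun q => g q i j) p).

(* Sign convention: the Ricci tensor of the round sphere is positive. *)
Definition ricci (R : realType) (m : nat) (g : 'rV[R]_m -> 'M[R]_m)
    (i j : 'I_m) (p : 'rV[R]_m) : R :=
  \sum_(k < m) (partial k (christoffel g k i j) p
                - partial j (christoffel g k i k) p)
  + \sum_(k < m) \sum_(l < m)
      (christoffel g k k l p * christoffel g l i j p
       - christoffel g k j l p * christoffel g l i k p).

Definition hessian (R : realType) (m : nat) (g : 'rV[R]_m -> 'M[R]_m)
    (f : 'rV[R]_m -> R) (i j : 'I_m) (p : 'rV[R]_m) : R :=
  partial i (partial j f) p
  - \sum_(k < m) christoffel g k i j p * partial k f p.

(** * The warped product [dx^2 + psi(x)^2 g_{S^n}] *)

(* Inverse stereographic projection onto the unit sphere of R^(n+1), from the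
   north pole if [b] is true and from the south pole otherwise; the images of
   these two charts cover S^n. *)
Definition inv_stereo (R : realType) (n : nat) (b : bool) (u : 'rV[R]_n) :
    'rV[R]_(n + 1) :=
  let N := \sum_(i < n) u 0 i ^+ 2 in
  (1 + N)^-1 *:
    row_mx (2 *: u) (const_mx ((if b then 1 else -1) * (N - 1))).

(* The metric induced on S^n by the Euclidean metric of R^(n+1). *)
Definition sphere_metric (R : realType) (n : nat) (b : bool) (u : 'rV[R]_n) :
    'M[R]_n :=
  \matrix_(i, j) \sum_(k < n + 1)
    partial i (fun v => inv_stereo b v 0 k) u
    * partial j (fun v => inv_stereo b v 0 k) u.

(* A point of (0,+oo) x S^n has coordinates [row_mx x u], with [x] the radial
   coordinate and [u] a stereographic coordinate on S^n. *)
Definition radial (R : realType) (n : nat) (p : 'rV[R]_(1 + n)) : R :=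
  lsubmx p 0 0.

Definition warped_metric (R : realType) (n : nat) (b : bool) (psi : R -> R)
    (p : 'rV[R]_(1 + n)) : 'M[R]_(1 + n) :=
  block_mx 1%:M 0 0 (psi (radial p) ^+ 2 *: sphere_metric b (rsubmx p)).

Definition smooth_on_pos (R : realType) (f : R -> R) : Prop :=
  forall (k : nat) (x : R), 0 < x -> derivable (derive1n k f) x 1.

Definition steady_soliton (R : realType) (n : nat) (psi phi : R -> R) : Prop :=
  [/\ smooth_on_pos psi,
      smooth_on_pos phi,
      (forall x, 0 < x -> 0 < psi x) &
      forall (b : bool) (p : 'rV[R]_(1 + n)), 0 < radial p ->
        forall i j : 'I_(1 + n),
          ricci (warped_metric b psi) i j p
          + hessian (warped_metric b psi) (fun q => phi (radial q)) i j p = 0].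

(** * Asymptotics *)

Definition equiv_at_0 (R : realType) (f g : R -> R) : Prop :=
  f x / g x @[x --> 0^'+] --> (1 : R).

Definition singular_profile (R : realType) (n : nat) (psi phi : R -> R) :
    Prop :=
  (exists2 a : R, 0 < a &
     equiv_at_0 psi (fun x => a * x `^ (Num.sqrt n%:R)^-1))
  /\ equiv_at_0 (derive1 phi) (fun x => (Num.sqrt n%:R - 1) / x).

Definition bryant_asymptotics (R : realType) (psi : R -> R) : Prop :=
  exists c C : R, [/\ 0 < c, 0 < C &
    \forall x \near +oo,
      [/\ c * x `^ (1 / 2) <= psi x <= C * x `^ (1 / 2),
          c * x `^ (- (1 / 2)) <= derive1 psi x <= C * x `^ (- (1 / 2)) &
          - C * x `^ (- (3 / 2)) <= derive1n 2 psi x <= - c * x `^ (- (3 / 2))]].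

(** * The (X,Y)-system and its relation to metrics *)

Definition solves_XY (R : realType) (n : nat) (X Y : R -> R) : Prop :=
  forall y : R,
    is_derive y 1 X (X y ^+ 3 - X y + Y y ^+ 2 / Num.sqrt n%:R)
    /\ is_derive y 1 Y (Y y * (X y ^+ 2 - X y / Num.sqrt n%:R)).

(* The solutions are taken on the whole line: the maximal solution through a
   point of the (bounded, forward invariant) region below that emanates from an
   equilibrium as y -> -oo is defined for all y. *)
Definition singular_trajectory (R : realType) (n : nat) (X Y : R -> R) : Prop :=
  [/\ solves_XY n X Y,
      X y @[y --> -oo] --> (1 : R),
      Y y @[y --> -oo] --> (0 : R) &
      forall y, [/\ 0 < X y, 0 < Y y & X y ^+ 2 + Y y ^+ 2 < 1]].

Definition bryant_trajectory (R : realType) (n : nat) (X Y : R -> R) : Prop :=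
  [/\ solves_XY n X Y,
      X y @[y --> -oo] --> (Num.sqrt n%:R)^-1 /\
      Y y @[y --> -oo] --> Num.sqrt (1 - n%:R^-1) &
      X y @[y --> +oo] --> (0 : R) /\ Y y @[y --> +oo] --> (0 : R)].

Definition W_of (R : realType) (n : nat) (psi phi : R -> R) (x : R) : R :=
  (- derive1 phi x + n%:R * (derive1 psi x / psi x))^-1.

(* [xi] is the change of variable y |-> x, so that dx = W dy; it is onto
   (0,+oo), and increasing because W > 0. *)
Definition corresponds (R : realType) (n : nat) (psi phi X Y : R -> R) : Prop :=
  exists xi : R -> R,
    [/\ (forall y, 0 < xi y),
        (forall x, 0 < x -> exists y, xi y = x),
        xi y @[y --> -oo] --> (0 : R) &
        forall y,
          let x := xi y in
          let W := W_of n psi phi x in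
          [/\ 0 < W,
              is_derive y 1 xi W,
              X y = Num.sqrt n%:R * W * (derive1 psi x / psi x) &
              Y y = Num.sqrt (n%:R * (n%:R - 1)) * W / psi x]].

(* Main.v *)
Require Import Defs.
From HB Require Import structures.
From mathcomp Require Import all_boot all_order all_algebra.
From mathcomp Require Import all_classical all_reals all_analysis.
From mathcomp Require Import ring lra.
Set Implicit Arguments.
Unset Strict Implicit.
Unset Printing Implicit Defensive.
Import Order.TTheory GRing.Theory Num.Theory.
Import numFieldNormedType.Exports.
Local Open Scope classical_set_scope.
Local Open Scope ring_scope.

(** Scale the metric so that W^2 = 1 - X^2 - Y^2; this is possible because W^2 and
    E = 1 - X^2 - Y^2 both satisfy f' = 2 X^2 f. A singular soliton is then the same
    thing as a trajectory of the planar system, up to a translation of y.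

    The slope v = X/Y satisfies v' = ((X^2 + Y^2) / sqrt n - X) / Y, and inside the
    disc this is at most - v / 5 as soon as v >= 19/10. So each point of the ray
    X = 2Y inside the disc flows, backwards in time, to the equilibrium (1,0)
    ([slope_backward], [ray_defect], [ray_singular]), and each singular trajectory
    crosses this ray exactly once ([singular_crosses], [singular_crosses_once]). The
    height of the crossing, a number between 0 and 1/sqrt 5, is the parameter of the
    family; no invariant manifold of (1,0) is involved. The flow is global because
    the sign of E is preserved ([flow_in_disc]), and it depends continuously on the
    height. The profile psi and omega are functions of X, Y and W at y = eta(x), with
    eta the inverse of the clock xi(y), the integral of W from -oo to y. Their joint
    continuity thus reduces to that of xi, whose tails at -oo are exponentially small
    ([clock_continuous_param], [inverse_clock_continuous]).

    The warped metric is diagonal in stereographic coordinates, where the Ricci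
    tensor and the Hessian can be computed ([ricci_rr], [ricci_aa], [hess_aa]). The
    soliton equation becomes one radial and one spherical equation
    ([steady_soliton_warped]); for psi and omega built from a trajectory these are
    identities ([soliton_radial], [soliton_spherical]).

    As y tends to -oo, 1 - X^2 is exponentially small. As W' = X^2 xi', this gives
    W / xi -> 1, hence the asymptotics of omega, and a convergent integral for
    the logarithm of psi / x^(1/sqrt n) ([ray_singular_profile]).

    Forwards in time, H = sqrt n X - (X^2 + Y^2) stays positive, because
    H' = - H + X^2 (H + E), and this forces the trajectory into the origin
    ([ray_radius_lt], [ray_cvgy]). Trajectories that enter the origin, the Bryant
    trajectory included, follow the curve X = Y^2 / sqrt n to second order, because
    X / Y^2 and its correction divided by Y^2 solve linear equations z' = b - a z
    with a -> 1 ([relaxation], [centre_second_order]). The first order makes Y^-2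
    grow linearly in y; the second order gives the sign and size of psi''.
    As W converges, x and y are comparable ([bryant_of_corresponds]). *)

(** * Differentiation and monotonicity *)

Section Derivation_rules.
Context {R : realType} {V : normedModType R}.
Implicit Types (f g : V -> R) (x v : V).

Lemma isd_cst x v (c : R) : is_derive x v (fun=> c) 0.
Proof. exact: is_derive_cst. Qed.

Lemma isd_add f g x v a b : is_derive x v f a -> is_derive x v g b ->
  is_derive x v (fun y => f y + g y) (a + b).
Proof. by move=> hf hg; exact: is_deriveD. Qed.

Lemma isd_opp f x v a : is_derive x v f a ->
  is_derive x v (fun y => - f y) (- a).
Proof. by move=> hf; exact: is_deriveN. Qed.

Lemma isd_mul f g x v a b : is_derive x v f a -> is_derive x v g b ->
  is_derive x v (fun y => f y * g y) (a * g x + f x * b).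
Proof.
move=> hf hg; have h := @is_deriveM _ _ f g x v a b hf hg.
rewrite (_ : (fun y => _) = f * g); last exact/funext.
apply: (is_derive_eq h).
by rewrite /GRing.scale /=; ring.
Qed.

Lemma isd_exp f x v a k : is_derive x v f a ->
  is_derive x v (fun y => f y ^+ k) (k%:R * f x ^+ k.-1 * a).
Proof.
move=> hf; elim: k => [|k IH].
  by rewrite !mul0r; exact: (isd_cst _ _ 1).
rewrite (_ : (fun y => _) = fun y => f y * f y ^+ k); last first.
  by apply/funext => y; rewrite exprS.
apply: (is_derive_eq (isd_mul hf IH)).
case: k {IH} => [|k]; first by rewrite !expr0; ring.
by rewrite /= !exprS [in RHS]mulrS; ring.
Qed.

Lemma isd_inv f x v a : f x != 0 -> is_derive x v f a ->
  is_derive x v (fun y => (f y)^-1) (- (f x) ^- 2 * a).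
Proof.
move=> fx hf; have [df <-] := hf.
have := @deriveV R V f x v fx df; rewrite /GRing.scale /= => <-.
by apply: DeriveDef => //; exact: derivableV.
Qed.

End Derivation_rules.

Section Derivation_rules_one_variable.
Context {R : realType}.
Implicit Types (f g : R -> R) (x : R).

Lemma isd_id x : is_derive x 1 (fun y : R => y) 1.
Proof. exact: is_derive_id. Qed.

Lemma isd_comp f g x a b : is_derive (g x) 1 f a -> is_derive x 1 g b ->
  is_derive x 1 (fun y => f (g y)) (a * b).
Proof. by move=> hf hg; exact: is_derive1_comp. Qed.

Lemma isd_expR f x a : is_derive x 1 f a ->
  is_derive x 1 (fun y => expR (f y)) (expR (f x) * a).
Proof. by apply: isd_comp; exact: is_derive_expR. Qed.

Lemma isd_ln f x a : 0 < f x -> is_derive x 1 f a ->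
  is_derive x 1 (fun y => ln (f y)) ((f x)^-1 * a).
Proof. by move=> fx; apply: isd_comp; exact: is_derive1_ln. Qed.

Lemma isd_sqrt f x a : 0 < f x -> is_derive x 1 f a ->
  is_derive x 1 (fun y => Num.sqrt (f y)) ((2 * Num.sqrt (f x))^-1 * a).
Proof. by move=> fx; apply: isd_comp; exact: is_derive1_sqrt. Qed.

Lemma isd_continuous f x a : is_derive x 1 f a -> {for x, continuous f}.
Proof.
by move=> [df _]; apply/differentiable_continuous/derivable1_diffP.
Qed.

End Derivation_rules_one_variable.

(* Differentiates an explicit expression of one variable, taking the derivatives
   of its ingredients from the context. *)
Ltac der1 := first
  [ eassumption
  | match goal with H : forall _, is_derive _ _ _ _ |- _ => eapply H end
  | match goal with H : forall _, _ -> is_derive _ _ _ _ |- _ =>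
      eapply H; eassumption end
  | eapply isd_cst | eapply isd_id
  | eapply isd_add | eapply isd_opp | eapply isd_mul | eapply isd_exp
  | eapply isd_expR ].
Ltac der := repeat der1.
Ltac derive_by := eapply is_derive_eq; [der | cbv beta; rewrite /=].

Section Monotonicity.
Context {R : realType}.
Implicit Types (f : R -> R) (a b : R).

Lemma deriv_ge0_le f f' a b : a <= b ->
  (forall x, a <= x <= b -> is_derive x 1 f (f' x)) ->
  (forall x, a < x < b -> 0 <= f' x) -> f a <= f b.
Proof.
move=> ab df f'0.
have [-> //|neq] := eqVneq a b.
have {neq}ltab : a < b by rewrite lt_neqAle neq.
have [||c] := @MVT R f f' a b ltab.
- by move=> x; rewrite in_itv /= => /andP[h1 h2]; apply: df; rewrite !ltW.
- apply: derivable_within_continuous => x; rewrite in_itv /= => /df.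
  by move=> [].
rewrite in_itv /= => /f'0 h e.
by rewrite -subr_ge0 e mulr_ge0 // subr_ge0.
Qed.

Lemma deriv_le0_ge f f' a b : a <= b ->
  (forall x, a <= x <= b -> is_derive x 1 f (f' x)) ->
  (forall x, a < x < b -> f' x <= 0) -> f b <= f a.
Proof.
move=> ab df f'0; rewrite -lerN2.
apply: (@deriv_ge0_le (fun x => - f x) (fun x => - f' x)) => //.
  by move=> x /df h; exact: isd_opp.
by move=> x /f'0; rewrite oppr_ge0.
Qed.

Lemma deriv_gt0_lt f f' a b : a < b ->
  (forall x, a <= x <= b -> is_derive x 1 f (f' x)) ->
  (forall x, a < x < b -> 0 < f' x) -> f a < f b.
Proof.
move=> ab df f'0.
have [||c] := @MVT R f f' a b ab.
- by move=> x; rewrite in_itv /= => /andP[h1 h2]; apply: df; rewrite !ltW.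
- apply: derivable_within_continuous => x; rewrite in_itv /= => /df.
  by move=> [].
rewrite in_itv /= => /f'0 h e.
by rewrite -subr_gt0 e mulr_gt0 // subr_gt0.
Qed.

Lemma isd_reflect f (f' : R -> R) : (forall x : R, is_derive x 1 f (f' x)) ->
  forall x : R, is_derive x 1 (fun y => f (- y)) (- f' (- x)).
Proof.
move=> df x; rewrite -mulrN1.
by apply: (@isd_comp _ f (fun y => - y)) => //; exact/isd_opp/isd_id.
Qed.

(** Otherwise consider the infimum of the times where f <= 0. By hypothesis f is
    positive there, hence also shortly afterwards by continuity. *)
Lemma stays_pos f : continuous f -> 0 < f 0 ->
  (forall b, 0 <= b -> (forall x, 0 <= x < b -> 0 < f x) -> 0 < f b) ->
  forall x, 0 <= x -> 0 < f x.
Proof.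
move=> cf f0 step x x0; apply: contrapT => /negP; rewrite -leNgt => fx.
pose S := [set y | 0 <= y /\ f y <= 0].
have infS : has_inf S.
  by split; [exists x | exists 0 => y [] ].
have z0 : 0 <= inf S by apply: lb_le_inf; [exists x | move=> y [] ].
have fz : 0 < f (inf S).
  apply: step => // y /andP[y0 yz]; rewrite ltNge; apply/negP => fy.
  have : inf S <= y by apply: ge_inf; [exact: infS.2 | split].
  by rewrite leNgt yz.
have [e /= e0 he] : \forall y \near inf S, 0 < f y.
  exact: (cf (inf S) _ (lt_nbhsr fz)).
have [y [y0 fy] yz] : exists2 y, S y & y < inf S + e.
  by apply: inf_adherent.
have zy : inf S <= y by apply: ge_inf; [exact: infS.2 | split].
have h : `|inf S - y| < e by rewrite distrC ger0_norm ?subr_ge0// ltrBlDl.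
by have := he y h; rewrite /= ltNge fy.
Qed.

End Monotonicity.

(** * Exponential bounds and antiderivatives *)

Section Exponential_bounds.
Context {R : realType}.
Implicit Types (f : R -> R).

Lemma exp_bound_integral f (f' : R -> R) (C K : R) : 0 < K -> 0 <= C ->
  (forall x : R, is_derive x 1 f (f' x)) ->
  (forall x, `|f' x| <= C * expR (K * `|x|)) ->
  forall x, `|f x - f 0| <= C / K * expR (K * `|x|).
Proof.
move=> K0 C0.
suff half g (g' : R -> R) : (forall x : R, is_derive x 1 g (g' x)) ->
    (forall x, `|g' x| <= C * expR (K * `|x|)) ->
    forall x, 0 <= x -> `|g x - g 0| <= C / K * expR (K * `|x|).
  move=> df bf x; have [x0|x0] := leP 0 x; first exact: half df bf _ x0.
  have := @half (fun y => f (- y)) (fun y => - f' (- y)) (isd_reflect df).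
  move=> /(_ _ (- x)); rewrite !normrN opprK oppr0 oppr_ge0 (ltW x0).
  by apply => // y; rewrite normrN -[`|y|]normrN.
move=> dg bg x x0.
have dE (y : R) : is_derive y 1 (fun z => C / K * expR (K * z))
    (C * expR (K * y)).
  by derive_by; rewrite !mul0r add0r mulr1; field; rewrite gt_eqF.
have CK : 0 <= C / K by rewrite divr_ge0 // ltW.
have h1 : C / K * expR (K * 0) - g 0 <= C / K * expR (K * x) - g x.
  apply: (@deriv_ge0_le _ (fun y => C / K * expR (K * y) - g y)
     (fun y => C * expR (K * y) - g' y)) => [//|y /andP[y0 _]].
 rewrite subr_ge0.
  by have := bg y; rewrite (gtr0_norm y0) ler_norml => /andP[].
have h2 : C / K * expR (K * 0) + g 0 <= C / K * expR (K * x) + g x.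
  apply: (@deriv_ge0_le _ (fun y => C / K * expR (K * y) + g y)
     (fun y => C * expR (K * y) + g' y)) => [//|y /andP[y0 _]].
 have := bg y; rewrite (gtr0_norm y0) ler_norml.
  by move=> /andP[h _]; rewrite -lerBlDl sub0r.
rewrite (ger0_norm x0); move: h1 h2; rewrite mulr0 expR0 mulr1 => h1 h2.
by rewrite ler_norml; lra.
Qed.

(** Gronwall inequality, in both directions of time. *)
Lemma exp_growth f (f' : R -> R) (K : R) :
  (forall x : R, is_derive x 1 f (f' x)) -> (forall x, `|f' x| <= K * f x) ->
  forall x, f x <= f 0 * expR (K * `|x|).
Proof.
suff half g (g' : R -> R) : (forall x : R, is_derive x 1 g (g' x)) ->
    (forall x, `|g' x| <= K * g x) ->
    forall x, 0 <= x -> g x <= g 0 * expR (K * `|x|).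
  move=> df bf x; have [x0|x0] := leP 0 x; first exact: half df bf _ x0.
  have := @half (fun y => f (- y)) (fun y => - f' (- y)) (isd_reflect df).
  move=> /(_ _ (- x)); rewrite !normrN opprK oppr0 oppr_ge0 (ltW x0).
  by apply => // y; rewrite normrN.
move=> dg bg x x0; rewrite (ger0_norm x0).
have : g x * expR (- K * x) <= g 0 * expR (- K * 0).
  apply: (@deriv_le0_ge _ (fun y => g y * expR (- K * y))
    (fun y => (g' y - K * g y) * expR (- K * y))) => [//|y _|y _]; first by derive_by; ring.
  rewrite pmulr_lle0 ?expR_gt0 // subr_le0.
  by apply: le_trans (bg y); exact: ler_norm.
rewrite mulr0 expR0 mulr1 => h.
have e : expR (- K * x) * expR (K * x) = 1.
  by rewrite -expRD mulNr addNr expR0.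
by rewrite -[g x]mulr1 -e mulrA ler_pM2r ?expR_gt0.
Qed.

(** A function whose logarithmic derivative is bounded cannot reach zero. *)
Lemma linear_pos f (a : R -> R) (A : R) :
  (forall x : R, is_derive x 1 f (a x * f x)) -> (forall x, `|a x| <= A) ->
  0 < f 0 -> forall x, 0 < f x.
Proof.
suff half g (b : R -> R) : (forall x : R, is_derive x 1 g (b x * g x)) ->
    (forall x, `|b x| <= A) -> 0 < g 0 -> forall x, 0 <= x -> 0 < g x.
  move=> df ba f0 x; have [x0|x0] := leP 0 x; first exact: half df ba f0 _ x0.
  have := @half (fun y => f (- y)) (fun y => - a (- y)).
  move=> /(_ _ _ _ (- x)); rewrite opprK oppr0 oppr_ge0 (ltW x0); apply => //.
    by move=> y; rewrite mulNr; exact: (isd_reflect df).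
  by move=> y; rewrite normrN.
move=> dg bA g0; apply: stays_pos => //.
  by move=> x; apply: isd_continuous; exact: dg.
move=> c c0 gpos.
have : g 0 * expR (A * 0) <= g c * expR (A * c).
  apply: (@deriv_ge0_le _ (fun y => g y * expR (A * y))
    (fun y => (b y + A) * (g y * expR (A * y)))) => [//|y _|y /andP[y0 yc]]; first by derive_by; ring.
  rewrite mulr_ge0 //.
    by have := bA y; rewrite ler_norml => /andP[h _]; rewrite -lerBlDr sub0r.
  by rewrite mulr_ge0 ?expR_ge0 // ltW // gpos // (ltW y0).
rewrite mulr0 expR0 mulr1 => h; have := lt_le_trans g0 h.
by rewrite pmulr_lgt0 ?expR_gt0.
Qed.

End Exponential_bounds.

Section Antiderivative.
Context {R : realType}.
Notation mu := (@lebesgue_measure R).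

Let G (f : R -> R) (a x : R) : R := (\int[mu]_(t in `[a, x]) f t)%R.

Let dG (f : R -> R) (a x : R) : continuous f -> a < x -> is_derive x 1 (G f a) (f x).
Proof.
move=> cf ax.
have x1 : x < x + 1 by rewrite ltrDl.
have intf : mu.-integrable `[a, x + 1] (EFin \o f).
  apply: continuous_compact_integrable; first exact: segment_compact.
  exact: continuous_subspaceT.
have [d e] := continuous_FTC1_closed x1 intf ax (cf x).
by apply: (DeriveDef d); rewrite -derive1E; exact: e.
Qed.

(** The integral from a is differentiable on the right of a only; on the whole
    line the starting point has to recede with x. *)
Lemma antiderivative (f : R -> R) : continuous f ->
  exists F : R -> R, F 0 = 0 /\ forall x : R, is_derive x 1 F (f x).
Proof.
move=> cf; pose a x : R := Num.min x 0 - 1.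
have aP x : a x < x /\ a x < 0.
  by rewrite /a; case: (leP x 0) => h; lra.
pose F x := G f (a x) x - G f (a x) 0.
have FE (b x : R) : b < x -> b < 0 -> F x = G f b x - G f b 0.
  move=> bx b0; have [ax a0] := aP x.
  pose D t := G f (a x) t - G f b t.
  have dD (t : R) : a x < t -> b < t -> is_derive t 1 D 0.
    move=> at_ bt; apply: (is_derive_eq (isd_add (dG cf at_) (isd_opp (dG cf bt)))).
    by rewrite subrr.
  suff : D x = D 0 by rewrite /D /F; lra.
  pose c := Num.min x 0; pose d := Num.max x 0.
  have cst s t : c <= s -> s <= t -> D s = D t.
    move=> cs st; apply/eqP; rewrite eq_le.
    have dd (u : R) : s <= u <= t -> is_derive u 1 D 0.
      move=> /andP[su _]; have cu := le_trans cs su.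
      by apply: dD; apply: lt_le_trans cu; rewrite /c lt_min ?ax ?bx.
    apply/andP; split; first exact: (@deriv_ge0_le _ D (fun=> 0)).
    exact: (@deriv_le0_ge _ D (fun=> 0)).
  have [x0|/ltW x0] := leP x 0; first by apply: cst => //; rewrite /c ge_min lexx.
  by rewrite (cst 0 x) // /c ge_min lexx orbT.
exists F; split=> [|x]; first by rewrite /F subrr.
have [ax a0] := aP x.
have d1 : is_derive x 1 (fun y => G f (a x) y - G f (a x) 0) (f x).
  apply: (is_derive_eq (isd_add (dG cf ax) (isd_cst _ _ _))).
  by rewrite addr0.
apply: near_eq_is_derive d1.
by near=> y; rewrite (FE (a x) y) //; near: y; exact: lt_nbhsr.
Unshelve. all: by end_near. Qed.

End Antiderivative.

(** * Global solutions of Lipschitz systems *)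

Section Picard.
Context {R : realType} {d : nat}.
Implicit Types (f : ('I_d -> R) -> 'I_d -> R) (P : R -> 'I_d -> R).

(** Lipschitz for the sup norm, phrased without naming the norm. *)
Definition sup_lipschitz f (L : R) := forall u v e,
  (forall i, `|u i - v i| <= e) -> forall i, `|f u i - f v i| <= L * e.

Definition solves f P :=
  forall (y : R) i, is_derive y 1 (fun t => P t i) (f (P y) i).

Lemma dist_three (a b c e r : R) : `|a - b| <= r / 3 ->
  `|a - c| <= r / 3 -> `|b - e| <= r / 3 -> `|c - e| <= r.
Proof. by rewrite !ler_norml => /andP[? ?] /andP[? ?] /andP[? ?]; lra. Qed.

Lemma dist_two (a b c r : R) : `|a - b| <= r / 2 -> `|a - c| <= r / 2 ->
  `|c - b| <= r.
Proof. by rewrite !ler_norml => /andP[? ?] /andP[? ?]; lra. Qed.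

Lemma geometric_small (D e : R) : 0 < e -> exists k : nat, D / 2 ^+ k < e.
Proof.
move=> e0; have [k hk] : exists k : nat, D / e < k%:R.
  by exists (Num.truncn (D / e)).+1; exact: truncnS_gt.
exists k; rewrite ltr_pdivrMr ?exprn_gt0 // mulrC -ltr_pdivrMr //.
apply: lt_trans hk _; rewrite -natrX ltr_nat; exact: ltn_expl.
Qed.

(** The sequences u_k -/+ 2C/2^k are monotone and enclose the limit. *)
Lemma geometric_limit (u : nat -> R) (C : R) :
  (forall k, `|u k.+1 - u k| <= C / 2 ^+ k) ->
  exists l, forall k, `|u k - l| <= 2 * C / 2 ^+ k.
Proof.
move=> hu; pose a k := u k - 2 * C / 2 ^+ k; pose b k := u k + 2 * C / 2 ^+ k.
have half k : 2 * C / 2 ^+ k.+1 = C / 2 ^+ k.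
  by rewrite exprS; field; rewrite expf_neq0.
have step k : 2 * C / 2 ^+ k = 2 * (C / 2 ^+ k) by rewrite mulrA.
have aS : {homo a : k m / (k <= m)%N >-> k <= m}.
  apply: homo_leq => [//|? ? ?|k]; first exact: le_trans.
  by have := hu k; rewrite /a half step ler_norml; lra.
have bS : {homo b : k m / (k <= m)%N >-> m <= k}.
  apply: homo_leq => [//|y x z h1 h2|k]; first exact: le_trans h2 h1.
  by have := hu k; rewrite /b half step ler_norml; lra.
have C0 k : 0 <= C / 2 ^+ k by apply: le_trans (hu k).
have ab k m : a k <= b m.
  have abm j : a j <= b j by have := C0 j; rewrite /a /b step; lra.
  have [km|/ltnW mk] := leqP k m; first exact: le_trans (aS _ _ km) (abm m).
  exact: le_trans (abm k) (bS _ _ mk).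
exists (sup (range a)) => k.
have : a k <= sup (range a).
  apply: ub_le_sup; last by exists k.
  by exists (b 0) => _ [j _ <-].
have : sup (range a) <= b k.
  by apply: ge_sup; [exists (a 0); exists 0 | move=> _ [j _ <-] ].
by rewrite /a /b ler_norml; lra.
Qed.

Lemma sup_lipschitz_continuous f L P : 0 < L -> sup_lipschitz f L ->
  (forall i, continuous (fun t => P t i)) ->
  forall i, continuous (fun t => f (P t) i).
Proof.
move=> L0 Lf cP i /= t; apply/cvgrPdist_le => e e0.
have near_j j : \forall s \near t, `|P t j - P s j| <= e / L.
  by have /cvgrPdist_le/(_ (e / L)) := cP j t; apply; rewrite divr_gt0.
have near_all := filter_forall _ near_j.
near=> s; have h j : `|P t j - P s j| <= e / L by move: j; near: s; exact: near_all.
apply: le_trans (Lf _ _ _ h i) _.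
by rewrite mulrC divfK ?gt_eqF.
Unshelve. all: by end_near. Qed.

(** Picard iteration from the constant function: in the weight exp (2L|y|) each
    step halves the distance, so the iterates converge on the whole line. *)
Theorem picard f (L M : R) (u : 'I_d -> R) : 0 < L -> sup_lipschitz f L ->
  (forall v i, `|f v i| <= M) -> exists P, (forall i, P 0 i = u i) /\ solves f P.
Proof.
move=> L0 Lf Mf.
have : forall g : R -> R, exists F : R -> R, F 0 = 0 /\
    (continuous g -> forall x : R, is_derive x 1 F (g x)).
  move=> g; have [cg|ncg] := pselect (continuous g).
    by have [F [F0 dF]] := antiderivative cg; exists F.
  by exists (fun=> 0).
move=> /choice[A hA].
pose Phi P : R -> 'I_d -> R := fun y i => u i + A (fun t => f (P t) i) y.
pose p k := iter k Phi (fun _ => u).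
have Phi0 P i : Phi P 0 i = u i by rewrite /Phi (hA _).1 addr0.
have dPhi P : (forall i, continuous (fun t => P t i)) ->
    forall (y : R) i, is_derive y 1 (fun t => Phi P t i) (f (P y) i).
  move=> cP y i; have cf := sup_lipschitz_continuous L0 Lf cP (i := i).
  have := isd_add (isd_cst y 1 (u i)) ((hA (fun t => f (P t) i)).2 cf y).
  by rewrite add0r.
have cp k i : continuous (fun t => p k t i).
  elim: k i => [|k IH] i t; first exact: cst_continuous.
  by apply: isd_continuous; exact: dPhi.
have dp k (y : R) i : is_derive y 1 (fun t => p k.+1 t i) (f (p k y) i).
  exact: dPhi.
have p0 k i : p k 0 i = u i by case: k => [//|k]; exact: Phi0.
have M0 (i : 'I_d) : 0 <= M by apply: le_trans (Mf u i).
pose K := 2 * L; have K0 : 0 < K by rewrite mulr_gt0.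
pose C := M / K.
have diff (a b : nat) c : 0 <= c -> (forall y i, `|p a y i - p b y i| <= c * expR (K * `|y|)) ->
    forall y i, `|p a.+1 y i - p b.+1 y i| <= c / 2 * expR (K * `|y|).
  move=> c0 hc y i.
  have := @exp_bound_integral R (fun t => p a.+1 t i - p b.+1 t i)
    (fun t => f (p a t) i - f (p b t) i) (L * c) K K0.
  cbv beta; rewrite !p0 subrr.
  rewrite (_ : L * c / K = c / 2); last first.
    by rewrite /K; field; rewrite gt_eqF.
  move=> /(_ _ _ _ y); rewrite subr0; apply.
  - by rewrite mulr_ge0 // ltW.
  - by move=> t; rewrite -mulrA; apply: Lf => j; exact: hc.
have step k y i : `|p k.+1 y i - p k y i| <= C / 2 ^+ k * expR (K * `|y|).
  elim: k y i => [|k IH] y i.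
    rewrite expr0 divr1.
    have := @exp_bound_integral R (fun t => p 1%N t i) (fun t => f u i) M K K0.
    cbv beta; rewrite p0; apply; [exact: M0|move=> t].
    apply: le_trans (Mf _ _) _; rewrite ler_peMr ?M0 //.
    by rewrite -expR0 ler_expR mulr_ge0 // ltW.
  rewrite exprS invfM mulrCA [2^-1 * _]mulrC; apply: diff => //.
  by rewrite !mulr_ge0 ?invr_ge0 ?exprn_ge0 // ?(M0 i) // ltW.
have lim y i : exists l, forall k,
    `|p k y i - l| <= 2 * (C * expR (K * `|y|)) / 2 ^+ k.
  by apply: geometric_limit => k; rewrite mulrAC; exact: step.
have {lim}[P hP] : exists P : R -> 'I_d -> R, forall y i k,
    `|p k y i - P y i| <= 2 * C / 2 ^+ k * expR (K * `|y|).
  have /choice[P hP] : forall yi : R * 'I_d, exists l, forall k,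
      `|p k yi.1 yi.2 - l| <= 2 * (C * expR (K * `|yi.1|)) / 2 ^+ k.
    by move=> yi; exact: lim.
  exists (fun y i => P (y, i)) => y i k; apply: le_trans (hP (y, i) k) _ => /=.
  by rewrite le_eqVlt; apply/orP; left; apply/eqP; ring.
have cP i : continuous (fun t => P t i).
  move=> t; apply/cvgrPdist_le => e e0.
  pose D := 2 * C * expR (K * (`|t| + 1)).
  have [k hk] := @geometric_small D (e / 3) ltac:(by rewrite divr_gt0).
  have near_p : \forall s \near t, `|p k t i - p k s i| <= e / 3.
    by have /cvgrPdist_le/(_ (e / 3)) := cp k i t; apply; rewrite divr_gt0.
  have bound s : `|s| <= `|t| + 1 -> `|p k s i - P s i| <= e / 3.
    move=> hs; apply: le_trans (hP s i k) _; apply: le_trans (ltW hk).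
    rewrite /D mulrAC ler_pM2r ?invr_gt0 ?exprn_gt0 // ler_wpM2l //.
      by rewrite !mulr_ge0 ?invr_ge0 ?exprn_ge0 // ?(M0 i) // ltW.
    by rewrite ler_expR ler_pM2l.
  near=> s.
  have h1 : `|p k t i - p k s i| <= e / 3 by near: s.
  have h2 : `|p k t i - P t i| <= e / 3 by apply: bound; rewrite lerDl.
  have h3 : `|p k s i - P s i| <= e / 3.
    apply: bound; rewrite -lerBlDl; apply: le_trans (lerB_dist _ _) _.
    rewrite distrC; near: s; apply: cvgr_dist_le => //; exact: cvg_id.
  exact: dist_three h1 h2 h3.
exists P; split=> [i|y i].
  have := hP 0 i; move=> h; apply/eqP; rewrite eq_sym -subr_eq0 -normr_le0.
  apply/ler_addgt0Pr => e e0; rewrite add0r.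
  have [k hk] := @geometric_small (2 * C) e e0.
  have := h k; rewrite p0 normr0 mulr0 expR0 mulr1 => /le_trans; apply.
  exact: ltW.
have -> : (fun t => P t i) = (fun t => Phi P t i); last exact: dPhi.
apply/funext => t; apply/eqP; rewrite -subr_eq0 -normr_le0.
apply/ler_addgt0Pr => e e0; rewrite add0r.
pose D := 2 * C * expR (K * `|t|).
have [k hk] := @geometric_small D (e / 2) ltac:(by rewrite divr_gt0).
have C0 : 0 <= 2 * C / 2 ^+ k.
  by rewrite !mulr_ge0 ?invr_ge0 ?exprn_ge0 // ?(M0 i) // ltW.
have h1 : `|p k.+1 t i - Phi P t i| <= e / 2.
  have := @exp_bound_integral R (fun t => p k.+1 t i - Phi P t i)
    (fun t => f (p k t) i - f (P t) i) (L * (2 * C / 2 ^+ k)) K K0.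
  cbv beta; rewrite p0 Phi0 subrr => /(_ _ _ _ t); rewrite subr0 => h.
  apply: le_trans (h _ _ _) _.
  - by rewrite mulr_ge0 // ltW.
  - by move=> s; exact: (isd_add (dp k s i) (isd_opp (dPhi _ cP s i))).
  - by move=> s; rewrite -mulrA; apply: Lf => j; exact: hP.
  apply: le_trans (ltW hk).
  rewrite (_ : L * (2 * C / 2 ^+ k) / K = (2 * C / 2 ^+ k) / 2); last first.
    by rewrite /K; field; rewrite expf_neq0 // gt_eqF.
  rewrite /D [leRHS]mulrAC ler_pM2r ?expR_gt0 // ler_pdivrMr //.
  by rewrite ler_peMr // ler1n.
have h2 : `|p k.+1 t i - P t i| <= e / 2.
  apply: le_trans (hP t i k.+1) _; apply: le_trans (ltW hk).
  rewrite /D [leRHS]mulrAC ler_pM2r ?expR_gt0 // exprS invfM mulrCA.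
  by rewrite ler_piMl // invf_le1 // ler1n.
exact: dist_two h1 h2.
Unshelve. all: by end_near. Qed.

(** The sum of the squared differences has a bounded logarithmic derivative; this
    gives both uniqueness and continuous dependence on the initial value. *)
Lemma solution_dependence f (L : R) P Q : 0 <= L -> sup_lipschitz f L ->
  solves f P -> solves f Q -> forall y,
  \sum_(i < d) (P y i - Q y i) ^+ 2 <=
  \sum_(i < d) (P 0 i - Q 0 i) ^+ 2 * expR (2 * d%:R * L * `|y|).
Proof.
move=> L0 Lf dP dQ y; rewrite -mulr_suml.
pose S t := \sum_(i < d) (P t i - Q t i) ^+ 2.
pose S' t := \sum_(i < d) 2 * (P t i - Q t i) * (f (P t) i - f (Q t) i).
have sq t i : (P t i - Q t i) ^+ 2 <= S t.
  by rewrite /S (bigD1 i) //= lerDl sumr_ge0 // => j _; rewrite sqr_ge0.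
have S0 t : 0 <= S t by apply: sumr_ge0 => j _; rewrite sqr_ge0.
have leS t i : `|P t i - Q t i| <= Num.sqrt (S t).
  by rewrite -sqrtr_sqr ler_wsqrtr.
apply: (@exp_growth R S S' (2 * d%:R * L)) => t.
  rewrite (_ : S = \sum_(i < d) (fun t => (P t i - Q t i) ^+ 2)); last first.
    by apply/funext => s; rewrite /S fct_sumE.
  apply: is_derive_sum => i.
  apply: (is_derive_eq (isd_exp 2 (isd_add (dP t i) (isd_opp (dQ t i))))).
  by rewrite expr1.
apply: le_trans (ler_norm_sum _ _ _) _.
rewrite (_ : 2 * d%:R * L * S t = \sum_(i < d) 2 * L * S t); last first.
  by rewrite sumr_const card_ord -mulr_natl; ring.
apply: ler_sum => i _; rewrite !normrM ger0_norm // -!mulrA ler_pM2l //.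
rewrite -[S t]sqr_sqrtr // expr2 mulrCA; apply: ler_pM => //.
exact: Lf (leS t) i.
Qed.

End Picard.

(** * The flow of the (X,Y)-system in the unit disc *)

Section Flow.
Context {R : realType} {n : nat}.
Hypothesis hn : (2 <= n)%N.
Notation q := (Num.sqrt (n%:R : R)).

Lemma sqr_q : q ^+ 2 = n%:R.
Proof. by rewrite sqr_sqrtr. Qed.

Lemma sqr_q_ge2 : 2 <= q ^+ 2.
Proof. by rewrite sqr_q ler_nat. Qed.

Lemma q_gt1 : 1 < q.
Proof.
by rewrite -(@ltr_pXn2r _ 2) ?nnegrE ?sqrtr_ge0 // expr1n;
  have := sqr_q_ge2; lra.
Qed.

Lemma q_gt0 : 0 < q. Proof. exact: lt_trans ltr01 q_gt1. Qed.
Lemma q_neq0 : q != 0. Proof. by rewrite gt_eqF // q_gt0. Qed.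

Lemma q_inv_le1 : 0 < q^-1 <= 1.
Proof. by rewrite invr_gt0 q_gt0 invf_le1 ?q_gt0 // ltW // q_gt1. Qed.

Let clamp (x : R) := Num.max (-1) (Num.min 1 x).

Let clamp_id x : -1 <= x -> x <= 1 -> clamp x = x.
Proof. by move=> h1 h2; rewrite /clamp min_r // max_r. Qed.

Let clamp_bd x : -1 <= clamp x <= 1.
Proof.
rewrite /clamp le_max lexx /= ge_max (_ : -1 <= 1) /=; last by lra.
by rewrite ge_min lexx.
Qed.

Let clampE x : [\/ clamp x = -1 /\ x <= -1, clamp x = 1 /\ 1 <= x |
  clamp x = x /\ -1 <= x <= 1].
Proof.
have [x1|/ltW x1] := leP x (-1).
  by apply: Or31; rewrite /clamp min_r ?max_l //; lra.
have [x2|/ltW x2] := leP 1 x.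
  by apply: Or32; rewrite /clamp min_l ?max_r //; lra.
by apply: Or33; rewrite clamp_id // x1.
Qed.

Let clamp_lip x y e : `|x - y| <= e -> `|clamp x - clamp y| <= e.
Proof.
rewrite !ler_norml => /andP[h1 h2].
by case: (clampE x) => -[-> ?]; case: (clampE y) => -[-> ?]; lra.
Qed.

(* The vector field is made globally Lipschitz by clamping its arguments to
   [-1,1]; inside the unit disc nothing is changed. *)
Let field (u : 'I_2 -> R) (i : 'I_2) : R :=
  let x := clamp (u ord0) in let y := clamp (u ord_max) in
  if i == ord0 then x ^+ 3 - x + y ^+ 2 / q else y * (x ^+ 2 - x / q).

Let prod_le (a b e k : R) : 0 <= k -> `|a| <= e -> `|b| <= k ->
  `|a * b| <= k * e.
Proof. by move=> k0 h1 h2; rewrite normrM [leRHS]mulrC ler_pM. Qed.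

Let field_lip : sup_lipschitz field 6.
Proof.
move=> u v e huv i; rewrite /field.
have := clamp_lip (huv ord0); have := clamp_lip (huv ord_max).
have := clamp_bd (u ord0); have := clamp_bd (v ord0).
have := clamp_bd (u ord_max); have := clamp_bd (v ord_max).
move: (clamp (u ord0)) (clamp (v ord0)) (clamp (u ord_max)) (clamp (v ord_max)).
move=> a b c d; have := q_inv_le1; move: (q^-1) => r.
move=> /andP[r0 r1] /andP[d1 d2] /andP[c1 c2] /andP[b1 b2] /andP[a1 a2] hcd hab.
case: ifP => _.
  have -> : a ^+ 3 - a + c ^+ 2 * r - (b ^+ 3 - b + d ^+ 2 * r) =
    (a - b) * (a ^+ 2 + a * b + b ^+ 2 - 1) + (c - d) * ((c + d) * r) by ring.
  apply: le_trans (ler_normD _ _) _; rewrite (_ : 6 * e = 4 * e + 2 * e); last by ring.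
  by apply: lerD; apply: prod_le => //; rewrite ler_norml; nra.
have -> : c * (a ^+ 2 - a * r) - d * (b ^+ 2 - b * r) =
  (c - d) * (a ^+ 2 - a * r) + (a - b) * (d * (a + b - r)) by ring.
apply: le_trans (ler_normD _ _) _; rewrite (_ : 6 * e = 2 * e + 4 * e); last by ring.
by apply: lerD; apply: prod_le => //; rewrite ler_norml; nra.
Qed.

Let field_bd u i : `|field u i| <= 6.
Proof.
rewrite /field; have := clamp_bd (u ord0); have := clamp_bd (u ord_max).
move: (clamp _) (clamp _) => c a; have := q_inv_le1; move: (q^-1) => r.
move=> /andP[r0 r1] /andP[c1 c2] /andP[a1 a2].
have a21 : a ^+ 2 <= 1 by nra.
have c21 : 0 <= c ^+ 2 * r <= 1 by have := sqr_ge0 c; nra.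
have ar : -1 <= a * r <= 1 by nra.
have := sqr_ge0 a.
by case: ifP => _ ?; rewrite ler_norml ?exprSr; nra.
Qed.

Let E (X Y : R -> R) y := 1 - X y ^+ 2 - Y y ^+ 2.

Let disc_bd (x y : R) : 0 < 1 - x ^+ 2 - y ^+ 2 ->
  [/\ -1 <= x, x <= 1, -1 <= y & y <= 1].
Proof. by move=> h; split; nra. Qed.

Let field_disc (X Y : R -> R) : solves_XY n X Y -> (forall y, 0 < E X Y y) ->
  solves field (fun y i => if i == ord0 then X y else Y y).
Proof.
move=> hXY hE y i; have [dX dY] := hXY y; rewrite /field /=.
have [x1 x2 y1 y2] := disc_bd (hE y).
by rewrite !clamp_id //; case: (i == ord0).
Qed.

Lemma disc_dependence (X Y X1 Y1 : R -> R) :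
  solves_XY n X Y -> solves_XY n X1 Y1 ->
  (forall y, X y ^+ 2 + Y y ^+ 2 < 1) ->
  (forall y, X1 y ^+ 2 + Y1 y ^+ 2 < 1) -> forall y,
  (X y - X1 y) ^+ 2 + (Y y - Y1 y) ^+ 2 <=
  ((X 0 - X1 0) ^+ 2 + (Y 0 - Y1 0) ^+ 2) * expR (24 * `|y|).
Proof.
move=> h h1 dd dd1 y.
have hE X2 Y2 : (forall y, X2 y ^+ 2 + Y2 y ^+ 2 < 1 :> R) ->
  forall y, 0 < E X2 Y2 y by move=> hd z; have := hd z; rewrite /E; lra.
have := solution_dependence (ler0n _ 6) field_lip (field_disc h (hE _ _ dd))
  (field_disc h1 (hE _ _ dd1)) y.
rewrite !big_ord_recl !big_ord0 /= !addr0.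
rewrite (_ : 2 * 2%:R * 6%:R = 24%:R :> R); last by ring.
by rewrite -mulrDl.
Qed.

(** The function 1 - X^2 - Y^2 satisfies E' = 2 X^2 E, so its sign is preserved
    and the clamped system cannot leave the disc. *)
Lemma flow_in_disc (x0 y0 : R) : x0 ^+ 2 + y0 ^+ 2 < 1 ->
  exists X Y : R -> R, [/\ X 0 = x0, Y 0 = y0, solves_XY n X Y &
    forall y, X y ^+ 2 + Y y ^+ 2 < 1].
Proof.
move=> h0.
have [P [P0 dP]] := @picard R 2 field 6 6 (fun i => if i == ord0 then x0 else y0)
  (ltr0n _ 6) field_lip field_bd.
pose X y := P y ord0; pose Y y := P y ord_max.
have dX (y : R) : is_derive y 1 X (field (P y) ord0) by exact: dP.
have dY (y : R) : is_derive y 1 Y (field (P y) ord_max) by exact: dP.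
have E0 : 0 < E X Y 0 by rewrite /E /X /Y !P0 /=; lra.
pose E' y := - (2 * X y * field (P y) ord0) - 2 * Y y * field (P y) ord_max.
have dE (y : R) : is_derive y 1 (E X Y) (E' y).
  by rewrite /E; derive_by; rewrite /E'; ring.
have E'E y : 0 < E X Y y -> E' y = 2 * X y ^+ 2 * E X Y y.
  move=> /disc_bd[x1 x2 y1 y2]; rewrite /E' /field /= !clamp_id // /E /X /Y.
  by field; exact: q_neq0.
have cE : continuous (E X Y) by move=> y; exact: isd_continuous (dE y).
have pos_fwd y : 0 <= y -> 0 < E X Y y.
  apply: stays_pos y => // b b0 hb; apply: lt_le_trans E0 _.
  apply: (@deriv_ge0_le _ (E X Y) E') => // y /andP[y_ge0 yb].
  have hy : 0 < E X Y y by apply: hb; rewrite ltW.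
  by rewrite E'E // mulr_ge0 ?(ltW hy) // mulr_ge0 // sqr_ge0.
have pos_bwd y : 0 <= y -> 0 < E X Y (- y).
  apply: (@stays_pos _ (fun y => E X Y (- y))) y => [y||b b0 hb].
  - by apply: isd_continuous; exact: isd_reflect.
  - by rewrite oppr0.
  have dEr := isd_reflect dE.
  have : E X Y (- 0) * expR (2 * 0) <= E X Y (- b) * expR (2 * b).
    apply: (@deriv_ge0_le _ (fun y => E X Y (- y) * expR (2 * y))
      (fun y => (2 * E X Y (- y) - E' (- y)) * expR (2 * y))) => // [y _|y yb].
      by derive_by; ring.
    have hy : 0 < E X Y (- y) by apply: hb; case/andP: yb => /ltW -> ->.
    rewrite E'E // mulr_ge0 ?expR_ge0 // subr_ge0 -mulrA ler_pM2l //.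
    by rewrite ler_piMl ?(ltW hy) //; have := disc_bd hy; case; nra.
  rewrite mulr0 expR0 mulr1 oppr0 => h.
  by have := lt_le_trans E0 h; rewrite pmulr_lgt0 // expR_gt0.
have pos y : 0 < E X Y y.
  have [/pos_fwd //|/ltW] := leP 0 y; rewrite -oppr_ge0 => /pos_bwd.
  by rewrite opprK.
exists X, Y; split => [|||y]; [by rewrite /X P0|by rewrite /Y P0| |].
- move=> y; have [x1 x2 y1 y2] := disc_bd (pos y).
  by split; [have := dX y|have := dY y]; rewrite /field /= !clamp_id.
- by have := pos y; rewrite /E; lra.
Qed.

End Flow.

(** * Trajectories through the ray X = 2Y *)

Section Limits_at_infinity.
Context {R : realType}.
Implicit Types (f : R -> R).

Lemma cvg_exp_decay f (l a C : R) : 0 < a ->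
  (forall y, y <= 0 -> `|f y - l| <= C * expR (a * y)) -> f y @[y --> -oo] --> l.
Proof.
move=> a0 hf; apply/cvgrPdist_le => /= e e0.
pose C1 := `|C| + 1; have C10 : 0 < C1 by rewrite ltr_pwDr.
near=> y; rewrite distrC; apply: le_trans (hf y _) _; first by near: y; exact: nbhs_ninfty_le.
apply: (@le_trans _ _ (C1 * expR (a * y))).
  by rewrite ler_wpM2r ?expR_ge0 // /C1; have := ler_norm C; lra.
rewrite mulrC -ler_pdivlMr // -[leRHS]lnK ?posrE ?divr_gt0 // ler_expR.
rewrite mulrC -ler_pdivlMr //; near: y; exact: nbhs_ninfty_le.
Unshelve. all: by end_near. Qed.

Lemma cvg_inv_decay f (l k : R) : 0 < k ->
  (forall y, 0 <= y -> (f y - l) ^+ 2 * (1 + k * y) <= 1) ->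
  f y @[y --> +oo] --> l.
Proof.
move=> k0 hf; apply/cvgrPdist_le => /= e e0.
near=> y; rewrite distrC.
have y0 : 0 <= y by near: y; exact: nbhs_pinfty_ge.
have h : e ^- 2 <= k * y.
  rewrite mulrC -ler_pdivrMr //; near: y; exact: nbhs_pinfty_ge.
rewrite -(@ler_pXn2r _ 2) ?nnegrE ?(ltW e0) // real_normK ?num_real //.
have := hf y y0; have e20 : 0 < e ^+ 2 by rewrite exprn_gt0.
have : 1 <= e ^+ 2 * (1 + k * y).
  by rewrite mulrC -ler_pdivrMr // mul1r ler_wpDl.
have : 0 < 1 + k * y by rewrite ltr_pwDl // mulr_ge0 // ltW.
move=> h1 h2 h3; rewrite -(ler_pM2r h1); exact: le_trans h2.
Unshelve. all: by end_near. Qed.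

End Limits_at_infinity.

Section Trajectory.
Context {R : realType} {n : nat}.
Hypothesis hn : (2 <= n)%N.
Notation q := (Num.sqrt (n%:R : R)).
Variables X Y : R -> R.
Hypothesis sXY : solves_XY n X Y.
Hypothesis disc : forall y, X y ^+ 2 + Y y ^+ 2 < 1.

Let q0 : q != 0. Proof. exact: (q_neq0 hn). Qed.
Let qpos : 0 < q. Proof. exact: (q_gt0 hn). Qed.

Let dX (y : R) : is_derive y 1 X (X y ^+ 3 - X y + Y y ^+ 2 / q).
Proof. by have [] := sXY y. Qed.
Let dY (y : R) : is_derive y 1 Y (Y y * (X y ^+ 2 - X y / q)).
Proof. by have [] := sXY y. Qed.

Lemma deriv_defect (y : R) : is_derive y 1 (fun y => 1 - X y ^+ 2 - Y y ^+ 2)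
  (2 * X y ^+ 2 * (1 - X y ^+ 2 - Y y ^+ 2)).
Proof. by derive_by; ring. Qed.

Lemma Y_pos : 0 < Y 0 -> forall y, 0 < Y y.
Proof.
apply: (@linear_pos _ Y (fun y => X y ^+ 2 - X y / q) 2) => y.
  by rewrite mulrC; exact: dY.
have := disc y; have := @q_inv_le1 R n hn; move: (q^-1) (X y) (Y y) => r x z.
move=> /andP[r0 r1] h; have x1 : -1 <= x <= 1 by nra.
have ar : -1 <= x * r <= 1 by nra.
by rewrite ler_norml; have := sqr_ge0 x; have := sqr_ge0 z; lra.
Qed.

Hypothesis Ypos : forall y, 0 < Y y.

Let Y_neq0 y : Y y != 0. Proof. by rewrite gt_eqF. Qed.

(* By n >= 2 it is enough that (x^2 + y^2)^2 <= x^2 + y^2 <= 1.28 x^2, which holds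
   from the slope 19/10 on. *)
Let slope_field (x y : R) : 0 < y -> 19 * y <= 10 * x -> x ^+ 2 + y ^+ 2 < 1 ->
  (x ^+ 2 + y ^+ 2) / q <= 4 / 5 * x.
Proof.
move=> y0 xy d; have x0 : 0 < x by lra.
rewrite ler_pdivrMr // -(@ler_pXn2r _ 2) ?nnegrE //; last 2 first.
  by have := sqr_ge0 x; have := sqr_ge0 y; lra.
  by rewrite !mulr_ge0 ?invr_ge0 // ltW.
have q2 := @sqr_q_ge2 R n hn.
have h1 : (x ^+ 2 + y ^+ 2) ^+ 2 <= x ^+ 2 + y ^+ 2.
  by have := sqr_ge0 x; have := sqr_ge0 y; nra.
have h2 : 361 * y ^+ 2 <= 100 * x ^+ 2 by nra.
rewrite !exprMn.
by have := sqr_ge0 x; nra.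
Qed.

Lemma deriv_slope (y : R) : is_derive y 1 (fun y => X y / Y y)
  (((X y ^+ 2 + Y y ^+ 2) / q - X y) / Y y).
Proof.
apply: (is_derive_eq (isd_mul (dX y) (isd_inv (Y_neq0 y) (dY y)))).
by field; rewrite q0 Y_neq0.
Qed.

(** Where X/Y >= 19/10 the slope decreases at a definite exponential rate. So,
    backwards in time from the ray X = 2Y, it blows up: every such trajectory
    comes from the X-axis. *)
Lemma slope_backward y0 : 2 * Y y0 <= X y0 -> forall y, y <= y0 ->
  2 * expR ((y0 - y) / 5) * Y y <= X y.
Proof.
move=> h0; pose v t := X (y0 - t) / Y (y0 - t).
have dv (t : R) : is_derive t 1 v
    ((X (y0 - t) - (X (y0 - t) ^+ 2 + Y (y0 - t) ^+ 2) / q) / Y (y0 - t)).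
  have dl : is_derive t 1 (fun t => y0 - t) (- 1) by derive_by; rewrite add0r.
  have h := @isd_comp _ (fun y => X y / Y y) (fun t => y0 - t) t _ _
    (deriv_slope (y0 - t)) dl.
  apply: (is_derive_eq h).
  by field; rewrite q0 Y_neq0.
have decay t : 19 < 10 * v t -> v t / 5 <=
    (X (y0 - t) - (X (y0 - t) ^+ 2 + Y (y0 - t) ^+ 2) / q) / Y (y0 - t).
  move=> ht; rewrite /v mulrAC ler_pM2r ?invr_gt0 //.
  have := @slope_field (X (y0 - t)) (Y (y0 - t)) (Ypos _) _ (disc _).
  have : 19 * Y (y0 - t) <= 10 * X (y0 - t).
    by rewrite -ler_pdivlMr // -mulrA ltW.
  by move=> h1 /(_ h1); lra.
have v0 : 2 <= v 0 by rewrite /v subr0 ler_pdivlMr.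
(* the gap between 19/10 and the initial slope 2 is what makes the condition open *)
have big t : 0 <= t -> 0 < 10 * v t - 19.
  apply: (@stays_pos _ (fun t => 10 * v t - 19)) t => [t||b b0 hb].
  - by apply: isd_continuous; derive_by.
  - by lra.
  have : v 0 <= v b; last by lra.
  apply: (@deriv_ge0_le _ v _ 0 b b0 (fun t _ => dv t)) => t /andP[t0 tb].
  have vt : 0 < 10 * v t - 19 by apply: hb; rewrite ltW.
  have := decay t; rewrite -subr_gt0 => /(_ vt); apply: le_trans.
  by rewrite divr_ge0 //; lra.
move=> y yy0; pose t := y0 - y; have t0 : 0 <= t by rewrite subr_ge0.
have yE : y = y0 - t by rewrite /t; ring.
have : v 0 * expR (- 5^-1 * 0) <= v t * expR (- 5^-1 * t).
  apply: (@deriv_ge0_le _ (fun t => v t * expR (- 5^-1 * t)) (fun t =>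
    ((X (y0 - t) - (X (y0 - t) ^+ 2 + Y (y0 - t) ^+ 2) / q) / Y (y0 - t)
     - v t / 5) * expR (- 5^-1 * t))) => // [s _|s /andP[s0 _]].
    by derive_by; ring.
  by rewrite mulr_ge0 ?expR_ge0 // subr_ge0 decay // -subr_gt0 big // ltW.
rewrite mulr0 expR0 mulr1 => h.
have e : expR (- 5^-1 * t) * expR (t / 5) = 1.
  by rewrite -expRD (_ : - 5^-1 * t + t / 5 = 0) ?expR0 //; ring.
have : 2 * expR (t / 5) <= v t.
  rewrite (_ : v t = v t * expR (- 5^-1 * t) * expR (t / 5)).
    by rewrite ler_pM2r ?expR_gt0 //; exact: le_trans h.
  by rewrite -mulrA e mulr1.
by rewrite /v -yE ler_pdivlMr.
Qed.

Hypothesis ray : X 0 = 2 * Y 0.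

Let X_ge y : y <= 0 -> 2 * expR (- (y / 5)) * Y y <= X y.
Proof.
move=> y0; have := @slope_backward 0 _ y y0; rewrite sub0r mulNr; apply.
by rewrite ray.
Qed.

Let X_ge2 y : y <= 0 -> 2 * Y y <= X y.
Proof.
move=> y0; apply: le_trans (X_ge y0); rewrite ler_wpM2r ?(ltW (Ypos _)) //.
by rewrite ler_peMr // -[leLHS]expR0 ler_expR oppr_ge0; lra.
Qed.

Let defect_pos y : 0 < 1 - X y ^+ 2 - Y y ^+ 2.
Proof. by have := disc y; lra. Qed.

Let defect_incr y z : y <= z ->
  1 - X y ^+ 2 - Y y ^+ 2 <= 1 - X z ^+ 2 - Y z ^+ 2.
Proof.
move=> yz; apply: (deriv_ge0_le yz (fun t _ => deriv_defect t)) => t _.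
by rewrite mulr_ge0 ?(ltW (defect_pos _)) // mulr_ge0 // sqr_ge0.
Qed.

Lemma ray_sqrX_ge y : y <= 0 -> X 0 ^+ 2 <= X y ^+ 2.
Proof.
move=> y0; have := defect_incr y0; have := X_ge2 y0; have := Ypos y.
by rewrite ray; nra.
Qed.

(** Since X^2 >= X(0)^2 on the past, the equation E' = 2 X^2 E makes
    E = 1 - X^2 - Y^2 decay exponentially backwards, and so does Y by the growth of
    the slope. *)
Lemma ray_defect y : y <= 0 -> 1 - X y ^+ 2 <= 2 * expR (X 0 ^+ 2 / 2 * y).
Proof.
move=> y0; set c := X 0 ^+ 2.
have c0 : 0 <= c by exact: sqr_ge0.
have c1 : c <= 4 / 5 by rewrite /c; have := disc 0; rewrite ray; lra.
have h1 : (1 - X y ^+ 2 - Y y ^+ 2) * expR (- (2 * c) * y) <=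
    (1 - X 0 ^+ 2 - Y 0 ^+ 2) * expR (- (2 * c) * 0).
  apply: (@deriv_ge0_le _
    (fun y => (1 - X y ^+ 2 - Y y ^+ 2) * expR (- (2 * c) * y))
    (fun y => 2 * (X y ^+ 2 - c) * ((1 - X y ^+ 2 - Y y ^+ 2)
       * expR (- (2 * c) * y)))) => // [z _|z /andP[_ z0]].
    have h : is_derive z 1 (fun y => expR (- (2 * c) * y))
        (expR (- (2 * c) * z) * (- (2 * c))) by derive_by; ring.
    by apply: (is_derive_eq (isd_mul (deriv_defect z) h)); ring.
  rewrite mulr_ge0 ?mulr_ge0 ?expR_ge0 ?(ltW (defect_pos _)) // subr_ge0.
  by apply: ray_sqrX_ge; exact: ltW.
have h2 : 1 - X y ^+ 2 - Y y ^+ 2 <= expR (c / 2 * y).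
  move: h1; rewrite mulr0 expR0 mulr1 => h1.
  have e : expR (- (2 * c) * y) * expR ((2 * c) * y) = 1.
    by rewrite -expRD mulNr addNr expR0.
  have h3 : expR (2 * c * y) <= expR (c / 2 * y) 
    by rewrite ler_expR; have := mulr_ge0_le0 c0 y0; lra.
  apply: le_trans h3; move: e h1 (expR_gt0 (2 * c * y)).
  have := sqr_ge0 (X 0); have := sqr_ge0 (Y 0); have := defect_pos y.
  move: (1 - X y ^+ 2 - _) (expR (- _ * y)) (expR (2 * c * y)).
  move=> w a b w0 h3 h4 ab h1 b0.
  have : w * a * b <= b by rewrite -[leRHS]mul1r ler_pM2r //; lra.
  by rewrite -mulrA ab mulr1.
have h3 : Y y ^+ 2 <= expR (c / 2 * y).
  have : Y y <= expR (y / 5).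
    have e : expR (- (y / 5)) * expR (y / 5) = 1.
      by rewrite -expRD addNr expR0.
    have := X_ge y0; have := Ypos y; have := disc y.
    have := expR_gt0 (y / 5); have := expR_gt0 (- (y / 5)).
    move: (expR (y / 5)) (expR (- (y / 5))) e => a b ab b0 a0 d Y0 hX.
    have X1 : X y < 1 by nra.
    have : b * Y y <= 1 by lra.
    have : Y y = a * (b * Y y) by rewrite mulrA (mulrC a) ab mul1r.
    by move=> hY h; rewrite hY ler_piMr // ltW.
  move=> h; apply: (@le_trans _ _ (expR (y / 5) ^+ 2)).
    by rewrite ler_pXn2r // nnegrE ?expR_ge0 // ltW.
  by rewrite -expRM_natl ler_expR; nra.
by have := h2; have := h3; lra.
Qed.

(** With E = 1 - X^2 - Y^2, the function H = sqrt n X - (X^2 + Y^2) satisfies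
    H' = - H + X^2 (H + E), so H exp y cannot decrease as long as H > 0. *)
Lemma ray_radius_lt y : 0 <= y -> X y ^+ 2 + Y y ^+ 2 < q * X y.
Proof.
move=> y0; rewrite -subr_gt0.
pose H y := q * X y - (X y ^+ 2 + Y y ^+ 2).
have dH (z : R) : is_derive z 1 H
    (- H z + X z ^+ 2 * (H z + (1 - X z ^+ 2 - Y z ^+ 2))).
  by rewrite /H; derive_by; field; rewrite q0.
have H0 : 0 < H 0.
  rewrite /H ray; have := disc 0; rewrite ray; have := Ypos 0.
  have := @sqr_q_ge2 R n hn; have := qpos.
  move: (Y 0) => y1; move: q => r r0 r2 y10 d.
  have : 5 * y1 < 2 * r.
    rewrite -(@ltr_pXn2r _ 2) ?nnegrE //; last 2 first.
      by rewrite mulr_ge0 // ltW.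
      by rewrite mulr_ge0 // ltW.
    by rewrite !exprMn; lra.
  by nra.
apply: (@stays_pos _ H) y0 => // [z|b b0 hb].
  by apply: isd_continuous; exact: dH.
have : H 0 * expR 0 <= H b * expR b.
  apply: (@deriv_ge0_le _ (fun y => H y * expR y) (fun y =>
    X y ^+ 2 * (H y + (1 - X y ^+ 2 - Y y ^+ 2)) * expR y)) => // [z _|z zb].
    have h : is_derive z 1 (fun y => expR y) (expR z) by derive_by; ring.
    by apply: (is_derive_eq (isd_mul (dH z) h)); ring.
  have Hz : 0 < H z by apply: hb; case/andP: zb => /ltW -> ->.
  rewrite mulr_ge0 ?expR_ge0 // mulr_ge0 ?sqr_ge0 //.
  by rewrite addr_ge0 ?(ltW Hz) ?(ltW (defect_pos _)).
rewrite expR0 mulr1 => h; have := lt_le_trans H0 h.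
by rewrite pmulr_lgt0 ?expR_gt0.
Qed.

Lemma ray_X_pos y : 0 < X y.
Proof.
have [y0|/ltW y0] := leP 0 y.
  have := ray_radius_lt y0; have := Ypos y; have := qpos.
  move: q (X y) (Y y) => r x z r0 z0 h; rewrite -(pmulr_rgt0 _ r0).
  by apply: le_lt_trans h; rewrite addr_ge0 // sqr_ge0.
by have := X_ge2 y0; have := Ypos y; lra.
Qed.

(** Where X^2 + Y^2 < sqrt n X, the squared radius m = X^2 + Y^2 satisfies
    m' = - 2 X^2 E <= - (2 E(0) / n) m^2, which drives the trajectory to the
    origin. *)
Lemma ray_decay y : 0 <= y -> (X y ^+ 2 + Y y ^+ 2) *
  (1 + 2 * (1 - X 0 ^+ 2 - Y 0 ^+ 2) / n%:R * y) <= 1.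
Proof.
move=> y0; set k := 2 * _ / _.
pose m y := X y ^+ 2 + Y y ^+ 2.
have m0 z : 0 < m z by rewrite /m ltr_wpDl ?sqr_ge0 ?exprn_gt0.
have dm (z : R) : is_derive z 1 m (- (2 * X z ^+ 2 * (1 - X z ^+ 2 - Y z ^+ 2))).
  by rewrite /m; derive_by; ring.
have : (m 0)^-1 - k * 0 <= (m y)^-1 - k * y.
  apply: (@deriv_ge0_le _ (fun y => (m y)^-1 - k * y) (fun y =>
    2 * X y ^+ 2 * (1 - X y ^+ 2 - Y y ^+ 2) / m y ^+ 2 - k)) => //.
    move=> z _; have h : is_derive z 1 (fun y => k * y) k by derive_by; ring.
    apply: (is_derive_eq (isd_add (isd_inv (lt0r_neq0 (m0 z)) (dm z)) (isd_opp h))).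
    by field; rewrite gt_eqF.
  move=> z /andP[z0 zy]; rewrite subr_ge0 ler_pdivlMr ?exprn_gt0 //.
  have h1 := defect_incr (ltW z0); have h2 := ray_radius_lt (ltW z0).
  have h3 : m z ^+ 2 <= n%:R * X z ^+ 2.
    rewrite -(@sqr_q R n) -exprMn ler_pXn2r ?nnegrE //.
    - exact: ltW.
    - exact: ltW (m0 z).
    - by rewrite mulr_ge0 // ltW // ray_X_pos.
  rewrite /k mulrAC ler_pdivrMr ?ltr0n ?(leq_trans _ hn) //.
  move: h1 h3 (defect_pos 0) (defect_pos z) (sqr_ge0 (X z)) (sqr_ge0 (m z)).
  move: (1 - X 0 ^+ 2 - Y 0 ^+ 2) (1 - X z ^+ 2 - Y z ^+ 2).
  move: (m z ^+ 2) (X z ^+ 2) (n%:R : R).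
  move=> c d e a b h1 h3 a0 b0 d0 c0; apply: (@le_trans _ _ (2 * a * (e * d))).
    by rewrite ler_wpM2l // mulr_ge0 // ltW.
  have ed0 : 0 <= e * d by exact: le_trans h3.
  by rewrite [leRHS](_ : _ = 2 * b * (e * d)) ?ler_wpM2r ?ler_pM2l //; ring.
rewrite mulr0 subr0 => h.
have m01 : 1 <= (m 0)^-1 by rewrite invf_ge1 // ltW // disc.
have hm : 1 + k * y <= (m y)^-1 by lra.
apply: (@le_trans _ _ (m y * (m y)^-1)).
  by rewrite (ler_pM2l (m0 y)).
by rewrite mulfV // gt_eqF.
Qed.

Lemma ray_cvgy : X y @[y --> +oo] --> (0 : R) /\ Y y @[y --> +oo] --> (0 : R).
Proof.
have n0 : (0 : R) < n%:R by rewrite ltr0n (leq_trans _ hn).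
have k0 : 0 < 2 * (1 - X 0 ^+ 2 - Y 0 ^+ 2) / n%:R.
  by rewrite divr_gt0 // mulr_gt0.
by split; apply: (cvg_inv_decay k0) => y y0; rewrite subr0;
  apply: le_trans (ray_decay y0); rewrite ler_wpM2r ?lerDl ?lerDr ?sqr_ge0 //;
  rewrite addr_ge0 // mulr_ge0 // ltW.
Qed.

Lemma ray_singular : singular_trajectory n X Y.
Proof.
have c0 : 0 < X 0 ^+ 2 by rewrite exprn_gt0 // ray_X_pos.
split=> //.
- apply: (@cvg_exp_decay _ _ _ (X 0 ^+ 2 / 2) 2); first by lra.
  move=> y y0; have := ray_defect y0; move: (expR _) => a h.
  have := ray_X_pos y; have := disc y; have := sqr_ge0 (Y y) => h1 h2 h3.
  by rewrite ler_norml; nra.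
- apply: (@cvg_exp_decay _ _ _ 5^-1 1); first by lra.
  move=> y y0; rewrite subr0 gtr0_norm // mul1r mulrC.
  have e : expR (- (y / 5)) * expR (y / 5) = 1 by rewrite -expRD addNr expR0.
  have := X_ge y0; have := Ypos y; have := disc y.
  have := expR_gt0 (y / 5); have := expR_gt0 (- (y / 5)).
  move: (expR (y / 5)) (expR (- (y / 5))) e => a b ab b0 a0 d Y0 hX.
  have X1 : X y < 1 by nra.
  have : b * Y y <= 1 by lra.
  have : Y y = a * (b * Y y) by rewrite mulrA (mulrC a) ab mul1r.
  by move=> hY h; rewrite hY ler_piMr // ltW.
- by move=> y; rewrite ray_X_pos.
Qed.

End Trajectory.

Section Singular_trajectories.
Context {R : realType} {n : nat}.
Hypothesis hn : (2 <= n)%N.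
Implicit Types X Y : R -> R.

Lemma solves_XY_shift X Y t : solves_XY n X Y ->
  solves_XY n (fun y => X (y + t)) (fun y => Y (y + t)).
Proof.
move=> h y; have dl : is_derive y 1 (fun y => y + t) 1.
  by derive_by; rewrite addr0.
have [dX dY] := h (y + t); rewrite -[X in is_derive _ _ _ X]mulr1.
split; first exact: (@isd_comp _ X (fun y => y + t) y _ _ dX dl).
by rewrite -[X in is_derive _ _ _ X]mulr1; exact: (@isd_comp _ Y (fun y => y + t) y _ _ dY dl).
Qed.

(** As long as the slope stays above 2 it decreases exponentially, so it cannot
    stay there forever. *)
Lemma singular_crosses X Y : singular_trajectory n X Y ->
  exists t, X t = 2 * Y t.
Proof.
move=> [sXY cX cY pos].
have dd y : X y ^+ 2 + Y y ^+ 2 < 1 by case: (pos y).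
have Y0 y : 0 < Y y by case: (pos y).
have dD (y : R) : is_derive y 1 (fun y => X y - 2 * Y y)
   (X y ^+ 3 - X y + Y y ^+ 2 / Num.sqrt n%:R -
    2 * (Y y * (X y ^+ 2 - X y / Num.sqrt n%:R))).
  by have [dX dY] := sXY y; derive_by; ring.
have [a ha] : exists a, 0 <= X a - 2 * Y a.
  have [a [h1 h2]] : exists a, 3 / 4 <= X a /\ Y a <= 1 / 4.
    near (-oo_R) => a; exists a; split.
      near: a; apply: (cvgr_ge 1) => //; lra.
    near: a; apply: (cvgr_le 0) => //; lra.
  by exists a; lra.
have [b hab hb] : exists2 b, a <= b & X b - 2 * Y b <= 0.
  apply: contrapT => hno.
  have big b : a <= b -> 2 * Y b <= X b.
    move=> hab; rewrite leNgt; apply/negP => h; apply: hno; exists b => //.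
    by lra.
  have key b : a <= b -> 2 * expR ((b - a) / 5) * Y a <= X a.
    by move=> hab; have := slope_backward hn sXY dd Y0 (big b hab) hab.
  have := key (a + 5 * (Y a)^-1) _; rewrite lerDl mulr_ge0 ?invr_ge0 ?(ltW (Y0 a)) //.
  rewrite (_ : (a + 5 * (Y a)^-1 - a) / 5 = (Y a)^-1); last first.
    by field; rewrite gt_eqF.
  move=> /(_ isT) h.
  have := expR_ge1Dx (Y a)^-1; have := dd a; have := Y0 a.
  move=> y0 d e; have : Y a * (1 + (Y a)^-1) <= Y a * expR (Y a)^-1.
    by rewrite ler_pM2l.
  by rewrite mulrDr mulr1 divff ?gt_eqF //; nra.
have cD : {within `[a, b], continuous (fun y => X y - 2 * Y y)}.
  apply: derivable_within_continuous => y _; exact: (@ex_derive _ _ _ _ _ _ _ (dD y)).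
have [|t _ ht] := @IVT R _ a b 0 hab cD.
  by rewrite ge_min le_max hb ha orbT.
by exists t; lra.
Unshelve. all: by end_near. Qed.

Lemma singular_crosses_once X Y : singular_trajectory n X Y ->
  forall t u, X t = 2 * Y t -> X u = 2 * Y u -> t = u.
Proof.
move=> [sXY _ _ pos].
have dd y : X y ^+ 2 + Y y ^+ 2 < 1 by case: (pos y).
have Y0 y : 0 < Y y by case: (pos y).
suff lt t u : X t = 2 * Y t -> X u = 2 * Y u -> ~ t < u.
  by move=> t u ht hu; apply/eqP; rewrite eq_le !leNgt; apply/andP; split;
     apply/negP; exact: lt.
move=> ht hu tu; have := slope_backward hn sXY dd Y0 _ (ltW tu).
rewrite hu lexx ht => /(_ isT).
by rewrite mulrAC ger_pMr ?mulr_gt0 // -[leRHS]expR0 ler_expR; lra.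
Qed.

End Singular_trajectories.

(** * The radial coordinate along a trajectory *)

Section Clock.
Context {R : realType} {n : nat}.
Hypothesis hn : (2 <= n)%N.

Definition speed (X Y : R -> R) (y : R) : R :=
  Num.sqrt (1 - X y ^+ 2 - Y y ^+ 2).

(** The radial coordinate along a trajectory, for the scaling of the metric in
    which the first integral W^2 / (1 - X^2 - Y^2) equals 1. *)
Definition clock (X Y xi : R -> R) : Prop :=
  [/\ (forall y : R, is_derive y 1 xi (speed X Y y)),
      (forall y, 0 < xi y),
      (forall x, 0 < x -> exists y, xi y = x) &
      xi y @[y --> -oo] --> (0 : R)].

Variables X Y : R -> R.
Hypothesis sXY : solves_XY n X Y.
Hypothesis disc : forall y, X y ^+ 2 + Y y ^+ 2 < 1.
Hypothesis Ypos : forall y, 0 < Y y.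
Hypothesis ray : X 0 = 2 * Y 0.

Let W := speed X Y.

Let defect_pos y : 0 < 1 - X y ^+ 2 - Y y ^+ 2.
Proof. by have := disc y; lra. Qed.

Lemma speed_gt0 y : 0 < W y.
Proof. by rewrite sqrtr_gt0. Qed.

Lemma sqr_speed y : W y ^+ 2 = 1 - X y ^+ 2 - Y y ^+ 2.
Proof. by rewrite sqr_sqrtr // ltW. Qed.

Lemma deriv_speed (y : R) : is_derive y 1 W (X y ^+ 2 * W y).
Proof.
have h := @isd_sqrt _ (fun y => 1 - X y ^+ 2 - Y y ^+ 2) y _ (defect_pos y)
  (deriv_defect sXY y).
apply: (is_derive_eq h); cbv beta; rewrite -/(speed X Y y) -/(W y) -sqr_speed.
by field; rewrite gt_eqF ?speed_gt0.
Qed.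

Let W_mono y z : y <= z -> W y <= W z.
Proof.
move=> yz; apply: (deriv_ge0_le yz (fun t _ => deriv_speed t)) => t _.
by rewrite mulr_ge0 ?sqr_ge0 // ltW ?speed_gt0.
Qed.

Let sqrX0_gt0 : 0 < X 0 ^+ 2.
Proof. by rewrite exprn_gt0 // ray mulr_gt0. Qed.

(** An antiderivative of W is bounded below because W' = X^2 W >= X(0)^2 W in the
    past, and unbounded above because W increases. *)
Lemma clock_exists : exists xi, clock X Y xi.
Proof.
have cW : continuous W by move=> y; exact: isd_continuous (deriv_speed y).
have [I [I0 dI]] := antiderivative cW.
have I_lt y z : y < z -> I y < I z.
  by move=> yz; apply: (deriv_gt0_lt yz (fun t _ => dI t)) => t _; exact: speed_gt0.
have I_le y z : y <= z -> I y <= I z.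
  by rewrite le_eqVlt => /predU1P[->//|/I_lt/ltW].
pose c := X 0 ^+ 2.
have I_lb y : - (W 0 / c) <= I y.
  have Wc : 0 <= W 0 / c by rewrite divr_ge0 // ltW // speed_gt0.
  have [y0|/ltW y0] := leP 0 y; first by have := I_le _ _ y0; lra.
  rewrite -mulNr ler_pdivrMr //.
  have : W y - c * I y <= W 0 - c * I 0.
    apply: (@deriv_ge0_le _ (fun y => W y - c * I y)
      (fun y => (X y ^+ 2 - c) * W y)) => // [t _|t /andP[_ /ltW t0]].
      have h : is_derive t 1 (fun y => c * I y) (c * W t) by derive_by; ring.
      by apply: (is_derive_eq (isd_add (deriv_speed t) (isd_opp h))); ring.
    rewrite mulr_ge0 ?(ltW (speed_gt0 _)) // subr_ge0.
    exact: (ray_sqrX_ge hn sXY disc Ypos ray).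
  by rewrite I0 mulr0; have := speed_gt0 y; lra.
have infI : has_inf (range I).
  split; first by exists (I 0); exists 0.
  by exists (- (W 0 / c)) => _ [y _ <-].
pose l := inf (range I).
have l_le y : l <= I y by apply: ge_inf; [exact: infI.2 | exists y].
have l_approx e : 0 < e -> exists y, I y < l + e.
  by move=> e0; have [_ [y _ <-] h] := inf_adherent e0 infI; exists y.
exists (fun y => I y - l); split.
- by move=> y; derive_by; rewrite addr0.
- by move=> y; rewrite subr_gt0; apply: le_lt_trans (l_le (y - 1)) (I_lt _ _ _); lra.
- move=> x x0; have [a ha] := l_approx x x0.
  pose b := x / W 0.
  have b0 : 0 <= b by rewrite divr_ge0 ?ltW ?speed_gt0.
  have hb : x <= I b - l.
    have : I 0 - W 0 * 0 <= I b - W 0 * b.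
      apply: (@deriv_ge0_le _ (fun y => I y - W 0 * y) (fun y => W y - W 0)) => //.
        by move=> t _; derive_by; ring.
      by move=> t /andP[/ltW t0 _]; rewrite subr_ge0 W_mono.
    rewrite /b mulr0 I0 subr0 mulrCA divff ?gt_eqF ?speed_gt0 // mulr1.
    by have := l_le 0; rewrite I0; lra.
  have ab : a <= b.
    by rewrite leNgt; apply/negP => /ltW/I_le; lra.
  have cI : {within `[a, b], continuous (fun y => I y - l)}.
    apply: derivable_within_continuous => y _.
    have h : is_derive y 1 (fun y => I y - l) (W y).
      by derive_by; rewrite addr0.
    exact: (@ex_derive _ _ _ _ _ _ _ h).
  have [|y _ hy] := @IVT R _ a b x ab cI; last by exists y.
  by rewrite ge_min le_max hb orbT andbT; apply/orP; left; lra.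
- apply/cvgrPdist_le => /= e e0; have [a ha] := l_approx e e0.
  near=> y; rewrite sub0r normrN ger0_norm ?subr_ge0 ?l_le //.
  have : I y <= I a by apply: I_le; near: y; apply: nbhs_ninfty_le; rewrite num_real.
  by lra.
Unshelve. all: by end_near. Qed.

Variable xi : R -> R.
Hypothesis hxi : clock X Y xi.

Let dxi (y : R) : is_derive y 1 xi (W y). Proof. by have [h] := hxi. Qed.

Lemma clock_lt y z : y < z -> xi y < xi z.
Proof.
by move=> yz; apply: (deriv_gt0_lt yz (fun t _ => dxi t)) => t _; exact: speed_gt0.
Qed.

Lemma clock_inj y z : xi y = xi z -> y = z.
Proof.
move=> e; apply/eqP; rewrite eq_le !leNgt; apply/andP; split; apply/negP;
  by move=> /clock_lt; rewrite e ltxx.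
Qed.

(** Both xi and W vanish at y = -oo, and W' = X^2 xi'. *)
Lemma clock_lower d y : 0 <= d -> (forall z, z <= y -> d <= X z ^+ 2) ->
  d * xi y <= W y.
Proof.
move=> d0 hd; rewrite -subr_ge0; apply/ler_addgt0Pr => e e0; rewrite -lerBlDr sub0r.
have [_ xi0 _ cxi] := hxi.
have [z [zy hz]] : exists z, z <= y /\ xi z <= e / (d + 1).
  near (-oo_R) => z; exists z; split; near: z; first by apply: nbhs_ninfty_le; rewrite num_real.
  by apply: (cvgr_le 0) => //; rewrite divr_gt0 // ltr_wpDl.
have h1 : d * xi z <= e.
  apply: (@le_trans _ _ ((d + 1) * (e / (d + 1)))).
    by apply: ler_pM => //; [exact: ltW | rewrite lerDl].
  by rewrite mulrC divfK // gt_eqF // ltr_wpDl.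
have h2 : W z - d * xi z <= W y - d * xi y.
  apply: (@deriv_ge0_le _ (fun y => W y - d * xi y)
    (fun y => (X y ^+ 2 - d) * W y)) => // [t _|t /andP[_ /ltW ty]].
    have h : is_derive t 1 (fun y => d * xi y) (d * W t) by derive_by; ring.
    by apply: (is_derive_eq (isd_add (deriv_speed t) (isd_opp h))); ring.
  by rewrite mulr_ge0 ?(ltW (speed_gt0 _)) // subr_ge0 hd.
by have := speed_gt0 z; lra.
Unshelve. all: by end_near. Qed.

Lemma clock_upper y : W y <= xi y.
Proof.
rewrite -subr_ge0; apply/ler_addgt0Pr => e e0; rewrite -lerBlDr sub0r.
have [_ xi0 _ _] := hxi.
have [z [zy hz]] : exists z, z <= y /\ W z <= e.
  have [_ cX cY _] := ray_singular hn sXY disc Ypos ray.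
  near (-oo_R) => z; exists z; split; first by near: z; apply: nbhs_ninfty_le; rewrite num_real.
  have hX : 1 - X z <= e ^+ 2 / 2.
    have : 1 - e ^+ 2 / 2 <= X z; last by lra.
    near: z; apply: (cvgr_ge 1) => //.
    by rewrite ltrBlDr ltrDl divr_gt0 ?exprn_gt0.
  rewrite -(@ler_pXn2r _ 2) ?nnegrE ?ltW ?speed_gt0 // sqr_speed.
  have := disc z; have := ray_X_pos hn sXY disc Ypos ray z.
  have := sqr_ge0 (Y z); nra.
have h2 : xi z - W z <= xi y - W y.
  apply: (@deriv_ge0_le _ (fun y => xi y - W y)
    (fun y => (1 - X y ^+ 2) * W y)) => // [t _|t _].
    by apply: (is_derive_eq (isd_add (dxi t) (isd_opp (deriv_speed t)))); ring.
  rewrite mulr_ge0 ?(ltW (speed_gt0 _)) // subr_ge0.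
  by have := disc t; have := sqr_ge0 (Y t); lra.
by have := xi0 z; lra.
Unshelve. all: by end_near. Qed.

(** An inverse of the clock is the change of variable from x to y. *)
Lemma clock_inverse (eta : R -> R) : (forall x, 0 < x -> xi (eta x) = x) ->
  forall x : R, 0 < x -> is_derive x 1 eta (W (eta x))^-1.
Proof.
move=> heta x x0; rewrite -{1}(heta x x0); apply: (@is_derive_inverse _ xi).
- by near=> y; apply: clock_inj; rewrite heta //; case: hxi.
- by near=> y; exact: isd_continuous (dxi y).
- exact: dxi.
- by rewrite gt_eqF // speed_gt0.
Unshelve. all: by end_near. Qed.

End Clock.

(** * From trajectories to metrics *)

Section Smoothness.
Context {R : realType}.
Implicit Types (f g : R -> R).

Lemma near_gt0 (x : R) : 0 < x -> \forall z \near x, 0 < z.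
Proof. by move=> x0; exact: lt_nbhsr. Qed.

Lemma derive1_eq_pos f g (x : R) : 0 < x -> (forall z, 0 < z -> f z = g z) ->
  derive1 f x = derive1 g x.
Proof.
move=> x0 e; rewrite !derive1E; apply: near_eq_derive.
by have := near_gt0 x0; apply: filterS => z /e.
Qed.

Lemma is_derive_eq_pos f g (x a : R) : 0 < x -> (forall z, 0 < z -> f z = g z) ->
  is_derive x 1 f a -> is_derive x 1 g a.
Proof.
move=> x0 e; apply: near_eq_is_derive.
by have := near_gt0 x0; apply: filterS => z /e.
Qed.

Lemma derive1_val f (x a : R) : is_derive x 1 f a -> derive1 f x = a.
Proof. by move=> [_ <-]; rewrite derive1E. Qed.

Lemma derive1n2 f : derive1n 2 f = derive1 (derive1 f).
Proof. by rewrite derive1nS derive1n1. Qed.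

(** A class of functions stable under differentiation on (0,+oo) consists of
    smooth functions. *)
Lemma smooth_of_stable_class (S : (R -> R) -> Prop) :
  (forall f, S f -> exists2 g, S g & forall x : R, 0 < x -> is_derive x 1 f (g x)) ->
  forall f, S f -> smooth_on_pos f.
Proof.
move=> stable f Sf k.
have [g Sg hg] : exists2 g, S g & forall x, 0 < x -> derive1n k f x = g x.
  elim: k => [|k [g Sg hg]]; first by exists f.
  have [g' Sg' dg] := stable g Sg; exists g' => // x x0.
  by rewrite derive1nS (derive1_eq_pos x0 hg); exact: derive1_val (dg x x0).
move=> x x0; have [g' Sg' dg] := stable g Sg.
have := @is_derive_eq_pos g (derive1n k f) x (g' x) x0.
by move=> /(_ (fun z z0 => esym (hg z z0)) (dg x x0)) [].
Qed.

Inductive generated (G : (R -> R) -> Prop) : (R -> R) -> Prop :=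
| gen_base f of G f : generated G f
| gen_cst c : generated G (fun=> c)
| gen_add f g of generated G f & generated G g :
    generated G (fun x => f x + g x)
| gen_mul f g of generated G f & generated G g :
    generated G (fun x => f x * g x).

Lemma generated_stable (G : (R -> R) -> Prop) :
  (forall f, G f -> exists2 g, generated G g &
     forall x : R, 0 < x -> is_derive x 1 f (g x)) ->
  forall f, generated G f -> exists2 g, generated G g &
    forall x : R, 0 < x -> is_derive x 1 f (g x).
Proof.
move=> base f; elim => {f} [f /base //|c|f g Gf [f' Gf' df] Gg [g' Gg' dg]
  |f g Gf [f' Gf' df] Gg [g' Gg' dg]].
- by exists (fun=> 0); [exact: gen_cst | move=> x _; exact: isd_cst].
- exists (fun x => f' x + g' x); first exact: gen_add.
  by move=> x x0; apply: isd_add; [exact: df | exact: dg].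
- exists (fun x => f' x * g x + f x * g' x).
    by apply: gen_add; exact: gen_mul.
  by move=> x x0; apply: isd_mul; [exact: df | exact: dg].
Qed.

Lemma gen_exp G f k : generated G f -> generated G (fun x => f x ^+ k).
Proof.
move=> Gf; elim: k => [|k IH]; first exact: (gen_cst _ 1).
rewrite (_ : (fun x => _) = fun x => f x * f x ^+ k); first exact: gen_mul.
by apply/funext => x; rewrite exprS.
Qed.

End Smoothness.

Section Metric_of_trajectory.
Context {R : realType} {n : nat}.
Hypothesis hn : (2 <= n)%N.
Notation q := (Num.sqrt (n%:R : R)).
Notation r := (Num.sqrt (n%:R - 1 : R)).

(** The functions psi and phi of the correspondence, with eta the inverse of the
    clock. As (ln (W/Y))' = X / sqrt n and omega W = sqrt n X - 1, the potential is
    n ln psi - y. *)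
Definition profile (X Y eta : R -> R) (x : R) : R :=
  Num.sqrt (n%:R * (n%:R - 1)) * speed X Y (eta x) / Y (eta x).

Definition potential (X Y eta : R -> R) (x : R) : R :=
  n%:R * ln (profile X Y eta x) - eta x.

Lemma r_gt0 : 0 < r.
Proof. by rewrite sqrtr_gt0 subr_gt0 ltr1n. Qed.

Lemma sqr_r : r ^+ 2 = n%:R - 1.
Proof. by rewrite sqr_sqrtr // subr_ge0 ler1n ltnW. Qed.

Lemma sqrt_nn1 : Num.sqrt (n%:R * (n%:R - 1)) = q * r.
Proof. by rewrite sqrtrM. Qed.

Variables X Y xi eta : R -> R.
Hypothesis sXY : solves_XY n X Y.
Hypothesis disc : forall y, X y ^+ 2 + Y y ^+ 2 < 1.
Hypothesis Ypos : forall y, 0 < Y y.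
Hypothesis ray : X 0 = 2 * Y 0.
Hypothesis hxi : clock X Y xi.
Hypothesis heta : forall x, 0 < x -> xi (eta x) = x.

Let W := speed X Y.
Let psi := profile X Y eta.
Let phi := potential X Y eta.

Let q0 : q != 0. Proof. exact: (q_neq0 hn). Qed.
Let nE : n%:R = q ^+ 2 :> R. Proof. by rewrite sqr_q. Qed.
Let rE : r ^+ 2 = q ^+ 2 - 1. Proof. by rewrite sqr_r sqr_q. Qed.
Let r0 : r != 0. Proof. by rewrite gt_eqF // r_gt0. Qed.
Let W0 y : W y != 0. Proof. by rewrite gt_eqF // (speed_gt0 disc). Qed.
Let Y0 y : Y y != 0. Proof. by rewrite gt_eqF. Qed.
Let dW (y : R) : is_derive y 1 W (X y ^+ 2 * W y).
Proof. exact: (deriv_speed sXY disc). Qed.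

Lemma profile_gt0 x : 0 < psi x.
Proof.
rewrite /psi /profile sqrt_nn1 divr_gt0 // mulr_gt0 ?(speed_gt0 disc) //.
by rewrite mulr_gt0 ?r_gt0 ?(q_gt0 hn).
Qed.

(* Pulling back to the variable x multiplies derivatives by 1/W. *)
Let pull (f : R -> R) (a x : R) : 0 < x -> is_derive (eta x) 1 f a ->
  is_derive x 1 (fun x => f (eta x)) (a / W (eta x)).
Proof.
move=> x0 df; apply: (@isd_comp _ f eta) => //.
exact: (clock_inverse disc hxi heta x0).
Qed.

Lemma deriv_profile (x : R) : 0 < x ->
  is_derive x 1 psi (r * X (eta x) / Y (eta x)).
Proof.
move=> x0; set y := eta x; have [dX dY] := sXY y.
have h := isd_mul (isd_mul (isd_cst y 1 (q * r)) (dW y)) (isd_inv (Y0 y) dY).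
have := pull x0 h; rewrite -/y /psi /profile sqrt_nn1 => h1.
apply: (is_derive_eq h1); cbv beta.
by field; rewrite q0 W0 Y0.
Qed.

Lemma derive1_profile x : 0 < x -> derive1 psi x = r * X (eta x) / Y (eta x).
Proof. by move=> x0; exact: derive1_val (deriv_profile x0). Qed.

Lemma deriv2_profile (x : R) : 0 < x ->
  is_derive x 1 (derive1 psi) (r / W (eta x) *
    (((X (eta x) ^+ 2 + Y (eta x) ^+ 2) / q - X (eta x)) / Y (eta x))).
Proof.
move=> x0; set y := eta x.
apply: (@is_derive_eq_pos _ (fun x => r * (X (eta x) / Y (eta x)))) => //.
  by move=> z z0; rewrite derive1_profile // mulrA.
have h := isd_mul (isd_cst y 1 r) (deriv_slope hn sXY Ypos y).
apply: (is_derive_eq (pull x0 h)); cbv beta; rewrite -/y.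
by field; rewrite q0 W0 Y0.
Qed.

Lemma deriv_potential (x : R) : 0 < x ->
  is_derive x 1 phi ((q * X (eta x) - 1) / W (eta x)).
Proof.
move=> x0; set y := eta x.
have h := @isd_ln _ psi x _ (profile_gt0 x) (deriv_profile x0).
have h2 := isd_mul (isd_cst x 1 (n%:R)) h.
have h3 := isd_add h2 (isd_opp (clock_inverse disc hxi heta x0)).
rewrite /phi /potential; apply: (is_derive_eq h3); cbv beta.
rewrite /psi /profile sqrt_nn1 -/y -/(W y).
by field: nE; rewrite q0 W0 Y0 r0.
Qed.

Lemma derive1_potential x : 0 < x ->
  derive1 phi x = (q * X (eta x) - 1) / W (eta x).
Proof. by move=> x0; exact: derive1_val (deriv_potential x0). Qed.

Lemma deriv2_potential (x : R) : 0 < x ->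
  is_derive x 1 (derive1 phi)
    ((X (eta x) ^+ 2 + Y (eta x) ^+ 2 - q * X (eta x)) / W (eta x) ^+ 2).
Proof.
move=> x0; set y := eta x.
apply: (@is_derive_eq_pos _ (fun x => (q * X (eta x) - 1) / W (eta x))) => //.
  by move=> z z0; rewrite derive1_potential.
have [dX _] := sXY y.
have h := isd_mul (isd_add (isd_mul (isd_cst y 1 q) dX) (isd_cst y 1 (-1)))
   (isd_inv (W0 y) (dW y)).
apply: (is_derive_eq (pull x0 h)); cbv beta; rewrite -/y.
by field; rewrite q0 W0.
Qed.

(** The two equations to which the soliton equation reduces for a warped
    product over the round sphere. *)
Lemma soliton_radial x : 0 < x ->
  derive1n 2 phi x = n%:R * (derive1n 2 psi x / psi x).
Proof.
move=> x0; rewrite !derive1n2 (derive1_val (deriv2_potential x0)).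
rewrite (derive1_val (deriv2_profile x0)) /psi /profile sqrt_nn1.
rewrite -/(W _); move: (eta x) => y.
by field: nE; rewrite q0 W0 Y0 r0.
Qed.

Lemma soliton_spherical x : 0 < x ->
  - psi x * derive1n 2 psi x + (n%:R - 1) * (1 - derive1 psi x ^+ 2)
  + psi x * derive1 psi x * derive1 phi x = 0.
Proof.
move=> x0; rewrite !derive1n2 (derive1_val (deriv2_profile x0)) derive1_profile //.
rewrite derive1_potential // /psi /profile sqrt_nn1.
rewrite -/(W _); move: (eta x) => y.
by field: nE rE; rewrite q0 W0 Y0.
Qed.

(* The unknowns X, Y, W, 1/W, 1/Y, as functions of x, have derivatives that are
   polynomials in themselves. *)
Let gens (f : R -> R) : Prop :=
  [\/ f = (fun x => X (eta x)), f = (fun x => Y (eta x)) |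
   [\/ f = (fun x => W (eta x)), f = (fun x => (W (eta x))^-1) |
       f = (fun x => (Y (eta x))^-1)]].

Let gX : generated gens (fun x => X (eta x)).
Proof. by apply: gen_base; apply: Or31. Qed.
Let gY : generated gens (fun x => Y (eta x)).
Proof. by apply: gen_base; apply: Or32. Qed.
Let gW : generated gens (fun x => W (eta x)).
Proof. by apply: gen_base; apply: Or33; apply: Or31. Qed.
Let gWi : generated gens (fun x => (W (eta x))^-1).
Proof. by apply: gen_base; apply: Or33; apply: Or32. Qed.
Let gYi : generated gens (fun x => (Y (eta x))^-1).
Proof. by apply: gen_base; apply: Or33; apply: Or33. Qed.

Ltac gen_poly := repeat first
  [exact: gX | exact: gY | exact: gW | exact: gWi | exact: gYi
  | eapply gen_cst | eapply gen_add | eapply gen_mul | eapply gen_exp].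

Let gens_stable f : generated gens f -> exists2 g, generated gens g &
  forall x : R, 0 < x -> is_derive x 1 f (g x).
Proof.
move: f; apply: generated_stable => f.
have dX (y : R) : is_derive y 1 X (X y ^+ 3 - X y + Y y ^+ 2 / q) by have [] := sXY y.
have dY (y : R) : is_derive y 1 Y (Y y * (X y ^+ 2 - X y / q)) by have [] := sXY y.
case=> [->|->|[->|->|->]].
- exists (fun x => (X (eta x) ^+ 3 + (-1) * X (eta x) + Y (eta x) ^+ 2 * q^-1) *
    (W (eta x))^-1); first by gen_poly.
  by move=> x x0; apply: (is_derive_eq (pull x0 (dX _))); rewrite mulN1r.
- exists (fun x => (Y (eta x) * (X (eta x) ^+ 2 + (-1) * (X (eta x) * q^-1))) *
    (W (eta x))^-1); first by gen_poly.
  by move=> x x0; apply: (is_derive_eq (pull x0 (dY _))); rewrite mulN1r.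
- exists (fun x => (X (eta x) ^+ 2 * W (eta x)) * (W (eta x))^-1).
    by gen_poly.
  by move=> x x0; apply: (is_derive_eq (pull x0 (dW _))).
- exists (fun x => (-1) * (X (eta x) ^+ 2 * (W (eta x))^-1 ^+ 2)).
    by gen_poly.
  move=> x x0; have h := isd_inv (W0 (eta x)) (dW (eta x)).
  by apply: (is_derive_eq (pull x0 h)); cbv beta; field; rewrite W0.
- exists (fun x => (-1) * ((X (eta x) ^+ 2 + (-1) * (X (eta x) * q^-1)) *
     ((Y (eta x))^-1 * (W (eta x))^-1))); first by gen_poly.
  move=> x x0; have h := isd_inv (Y0 (eta x)) (dY (eta x)).
  by apply: (is_derive_eq (pull x0 h)); cbv beta; field; rewrite q0 W0 Y0.
Qed.

Lemma profile_smooth : smooth_on_pos psi.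
Proof.
apply: (smooth_of_stable_class gens_stable).
rewrite /psi /profile.
by apply: gen_mul; [apply: gen_mul; [exact: gen_cst | exact: gW] | exact: gYi].
Qed.

Lemma potential_smooth : smooth_on_pos phi.
Proof.
apply: (@smooth_of_stable_class R (fun f => generated gens f \/ f = phi)).
  move=> f [/gens_stable[g Gg dg]|->]; first by exists g => //; left.
  exists (fun x => (q * X (eta x) + (-1)) * (W (eta x))^-1).
    by left; gen_poly.
  by move=> x x0; exact: deriv_potential.
by right.
Qed.

Lemma W_of_trajectory x : 0 < x -> W_of n psi phi x = W (eta x).
Proof.
move=> x0; rewrite /W_of derive1_potential // derive1_profile //.
rewrite /psi /profile sqrt_nn1 -/(W _); move: (eta x) => y.
rewrite -[RHS]invrK; congr (_^-1).
by field: nE; rewrite q0 W0 Y0 r0.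
Qed.

Lemma eta_xi y : eta (xi y) = y.
Proof.
have [_ xi0 _ _] := hxi.
by apply: (clock_inj disc hxi); rewrite heta.
Qed.

(** Two clocks for the same metric differ by a translation of y, since both have
    the derivative W as functions of y. *)
Lemma corresponds_trajectory X1 Y1 : corresponds n psi phi X1 Y1 <->
  exists t, forall y, X1 y = X (y + t) /\ Y1 y = Y (y + t).
Proof.
have [dxi xi0 xi_onto cxi] := hxi.
have XE x : 0 < x -> q * W (eta x) * (derive1 psi x / psi x) = X (eta x).
  move=> x0; rewrite derive1_profile // /psi /profile sqrt_nn1 -/(W _).
  by move: (eta x) => y; field; rewrite q0 W0 Y0 r0.
have YE x : 0 < x ->
    Num.sqrt (n%:R * (n%:R - 1)) * W (eta x) / psi x = Y (eta x).
  move=> x0; rewrite /psi /profile sqrt_nn1 -/(W _).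
  by move: (eta x) => y; field; rewrite q0 W0 Y0 r0.
split=> [[xi1 [xi10 xi1_onto cxi1 h]]|[t ht]].
- exists (eta (xi1 0)) => y; have [] := h y; rewrite /= W_of_trajectory //.
  move=> _ _ hX hY; rewrite hX hY XE // YE //.
  suff -> : eta (xi1 y) = y + eta (xi1 0) by [].
  have dD (z : R) : is_derive z 1 (fun y => eta (xi1 y) - y) 0.
    have [_ dx _ _] := h z; rewrite W_of_trajectory // in dx.
    have h1 := @isd_comp _ eta xi1 z _ _
      (clock_inverse disc hxi heta (xi10 z)) dx.
    apply: (is_derive_eq (isd_add h1 (isd_opp (isd_id z)))); cbv beta.
    by rewrite -/W mulVf // subrr.
  have := is_derive_0_is_cst y 0 dD; lra.
- exists (fun y => xi (y + t)); split=> [y|x x0||y /=].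
  + exact: xi0.
  + by have [y <-] := xi_onto x x0; exists (y - t); rewrite subrK.
  + apply/cvgrPdist_le => /= e e0.
    have /cvgrPdist_le/(_ e e0) [a [areal ha]] := cxi.
    near=> y; apply: ha; rewrite -ltrBrDr.
    by near: y; apply: nbhs_ninfty_lt; rewrite num_real.
  + rewrite W_of_trajectory // eta_xi -/psi -/phi.
    have [-> ->] := ht y; split.
    * exact: (speed_gt0 disc).
    * have dl : is_derive y 1 (fun y => y + t) 1 by derive_by; rewrite addr0.
      rewrite -[W _]mulr1; exact: (@isd_comp _ xi (fun y => y + t) y _ _ (dxi _) dl).
    * by have := XE _ (xi0 (y + t)); rewrite eta_xi => <-.
    * by have := YE _ (xi0 (y + t)); rewrite eta_xi => <-.
Unshelve. all: by end_near. Qed.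

End Metric_of_trajectory.

(** * The round sphere in stereographic coordinates *)

Section Directional_derivatives.
Context {R : realType} {V : normedModType R}.
Implicit Types (f : V -> R) (p v : V).

(** Directional derivatives only see the restriction to a line. *)
Lemma isd_line f p v a :
  is_derive p v f a <-> is_derive (0 : R) 1 (fun t => f (t *: v + p)) a.
Proof.
have e : (fun h : R => h^-1 *: ((f \o shift p) (h *: v) - f p)) =
  (fun h : R => h^-1 *: (((fun t : R => f (t *: v + p)) \o shift 0) (h *: 1)
     - f (0 *: v + p))).
  by apply/funext => h /=; rewrite scale0r add0r addr0 /GRing.scale /= mulr1.
split=> -[df dv]; (split; first by move: df; rewrite /derivable e).
  by rewrite -dv /derive e.
by rewrite -dv /derive e.
Qed.

Lemma isd_compV (h : R -> R) f p v a b : is_derive (f p) 1 h b ->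
  is_derive p v f a -> is_derive p v (fun q => h (f q)) (b * a).
Proof.
move=> dh /isd_line df; apply/isd_line.
apply: (@isd_comp _ h (fun t : R => f (t *: v + p))) df.
by rewrite scale0r add0r.
Qed.

Lemma isd_linear f p v : (forall (h : R) u w, f (h *: u + w) = h * f u + f w) ->
  is_derive p v f (f v).
Proof.
move=> lin; apply/isd_line.
rewrite (_ : (fun t => _) = fun t => t * f v + f p); last exact/funext.
by derive_by; ring.
Qed.

Lemma isd_sum m (f : 'I_m -> V -> R) p v (d : 'I_m -> R) :
  (forall i, is_derive p v (f i) (d i)) ->
  is_derive p v (fun q => \sum_i f i q) (\sum_i d i).
Proof.
move=> h; rewrite (_ : (fun q => _) = \sum_i f i); first exact: is_derive_sum.
by apply/funext => q; rewrite fct_sumE.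
Qed.

End Directional_derivatives.

Section Kronecker.
Context {R : comPzRingType} {m : nat}.
Implicit Types (c d : 'I_m) (f : 'I_m -> R).

Lemma sum_delta_l c f : \sum_k (c == k)%:R * f k = f c.
Proof.
rewrite (bigD1 c) //= eqxx mul1r big1 ?addr0 // => k kc.
by rewrite eq_sym (negbTE kc) mul0r.
Qed.

Lemma sum_delta_r c f : \sum_k (k == c)%:R * f k = f c.
Proof. by rewrite -[RHS]sum_delta_l; apply: eq_bigr => k _; rewrite eq_sym. Qed.

Lemma delta_mul c d : (c == d)%:R * (c == d)%:R = (c == d)%:R :> R.
Proof. by case: eqP; rewrite ?mulr1 ?mulr0. Qed.

End Kronecker.

Section Sphere.
Context {R : realType} {n : nat}.
Implicit Types (u : 'rV[R]_n).

Definition sqnorm u := \sum_(i < n) u 0 i ^+ 2.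

Lemma sqnorm1_gt0 u : 0 < 1 + sqnorm u.
Proof. by rewrite ltr_wpDr // sumr_ge0 // => i _; rewrite sqr_ge0. Qed.

Lemma isd_coord m (p v : 'rV[R]_m) (i : 'I_m) :
  is_derive p v (fun q => q 0 i) (v 0 i).
Proof.
have := @isd_linear R 'rV[R]_m (fun q => q 0 i) p v; apply => h u w.
by rewrite !mxE.
Qed.

Lemma partial_coord m (p : 'rV[R]_m) (i j : 'I_m) :
  is_derive p (delta_mx 0 j) (fun q => q 0 i) (i == j)%:R.
Proof. by have := isd_coord p (delta_mx 0 j) i; rewrite mxE eqxx. Qed.

Lemma deriv_sqnorm u i : is_derive u (delta_mx 0 i) sqnorm (2 * u 0 i).
Proof.
rewrite /sqnorm.
apply: (is_derive_eq (isd_sum (fun k => isd_exp 2 (partial_coord u k i)))).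
rewrite -[RHS](sum_delta_r i (fun k => 2 * u 0 k)); apply: eq_bigr => k _.
by rewrite expr1 mulrC.
Qed.

(** Stereographic coordinates are conformal. *)
Lemma sphere_metricE b u i j :
  sphere_metric b u i j = (i == j)%:R * (2 / (1 + sqnorm u)) ^+ 2.
Proof.
have N0 := lt0r_neq0 (sqnorm1_gt0 u).
have dN a := @isd_inv R _ (fun v => 1 + sqnorm v) u _ _ N0
  (isd_add (isd_cst u (delta_mx 0 a) 1) (deriv_sqnorm u a)).
have pl a (l : 'I_n) : partial a (fun v => inv_stereo b v 0 (lshift 1 l)) u =
    2 / (1 + sqnorm u) * (l == a)%:R - 4 / (1 + sqnorm u) ^+ 2 * (u 0 a * u 0 l).
  rewrite /partial (_ : (fun v => _) = fun v => (1 + sqnorm v)^-1 * (2 * v 0 l)).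
    have := isd_mul (dN a) (isd_mul (isd_cst u (delta_mx 0 a) 2)
      (partial_coord u l a)).
    by move=> [_ ->]; cbv beta; field.
  by apply/funext => v; rewrite /inv_stereo mxE row_mxEl mxE.
pose sg : R := if b then 1 else -1.
have sg2 : sg * sg = 1 by rewrite /sg; case: (b); ring.
have pr a : partial a (fun v => inv_stereo b v 0 (rshift n ord0)) u =
    sg * (4 / (1 + sqnorm u) ^+ 2 * u 0 a).
  rewrite /partial (_ : (fun v => _) = fun v => (1 + sqnorm v)^-1 *
      (sg * (sqnorm v + (-1)))).
    have := isd_mul (dN a) (isd_mul (isd_cst u (delta_mx 0 a)
      sg) (isd_add (deriv_sqnorm u a) (isd_cst u _ (-1)))).
    by move=> [_ ->]; cbv beta; field.
  by apply/funext => v; rewrite /inv_stereo mxE row_mxEr mxE -/sg.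
rewrite /sphere_metric mxE big_split_ord big_ord1 /= !pr.
under eq_bigr do rewrite !pl.
set s := 1 + sqnorm u in N0 *.
have sE : sqnorm u = s - 1 by rewrite /s; ring.
have e (k : 'I_n) : (2 / s * (k == i)%:R - 4 / s ^+ 2 * (u 0 i * u 0 k)) *
    (2 / s * (k == j)%:R - 4 / s ^+ 2 * (u 0 j * u 0 k)) =
  (k == i)%:R * ((2 / s) ^+ 2 * (k == j)%:R - 8 / s ^+ 3 * (u 0 j * u 0 k)) +
  (k == j)%:R * (- (8 / s ^+ 3) * (u 0 i * u 0 k)) +
  (16 / s ^+ 4 * (u 0 i * u 0 j)) * u 0 k ^+ 2 by field.
under eq_bigr do rewrite e.
rewrite !big_split /= !sum_delta_r -mulr_sumr -/(sqnorm u) sE.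
rewrite [X in _ + X](_ : _ = sg * sg *
   (16 / s ^+ 4 * (u 0 i * u 0 j))); last by field.
by rewrite sg2; field.
Qed.

End Sphere.

(** * The curvature of a warped product *)

Section Warped_product.
Context {R : realType} {n : nat}.
Variables (b : bool) (psi phi : R -> R).
Hypothesis psi_pos : forall x, 0 < x -> 0 < psi x.
Hypothesis psi_smooth : smooth_on_pos psi.
Hypothesis phi_smooth : smooth_on_pos phi.

Notation pt := 'rV[R]_(1 + n).
Implicit Types p : pt.
Notation rad := (@radial R n).
Notation r0 := (lshift n (ord0 : 'I_1)).
Notation ang c := (rshift 1 c).
Notation g := (@warped_metric R n b psi).

(* The conformal factor of the round metric in stereographic coordinates. *)
Let rho (p : pt) : R := 2 / (1 + sqnorm (rsubmx p)).
Let u (p : pt) (c : 'I_n) : R := p 0 (ang c).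
Let psi1 : R -> R := derive1 psi.
Let psi2 : R -> R := derive1 psi1.
Let phi1 : R -> R := derive1 phi.

Lemma deriv_smooth (f : R -> R) (k : nat) (x : R) : smooth_on_pos f -> 0 < x ->
  is_derive x 1 (derive1n k f) (derive1 (derive1n k f) x).
Proof. by move=> sf x0; rewrite derive1E; apply/derivableP; exact: sf. Qed.

Let dpsi (x : R) : 0 < x -> is_derive x 1 psi (psi1 x).
Proof. exact: (@deriv_smooth psi 0). Qed.
Let dpsi1 (x : R) : 0 < x -> is_derive x 1 psi1 (psi2 x).
Proof.
by move=> x0; have := deriv_smooth 1 psi_smooth x0; rewrite derive1n1.
Qed.
Let dphi (x : R) : 0 < x -> is_derive x 1 phi (phi1 x).
Proof. exact: (@deriv_smooth phi 0). Qed.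
Let dphi1 (x : R) : 0 < x -> is_derive x 1 phi1 (derive1 phi1 x).
Proof.
by move=> x0; have := deriv_smooth 1 phi_smooth x0; rewrite derive1n1.
Qed.

Let radE p : rad p = p 0 r0. Proof. by rewrite /radial mxE. Qed.

Let ang_r0 (c : 'I_n) : (ang c == r0) = false. Proof. exact: eq_rlshift. Qed.
Let r0_ang (c : 'I_n) : (r0 == ang c) = false. Proof. exact: eq_lrshift. Qed.
Let ang_ang (c d : 'I_n) : (ang c == ang d :> 'I_(1 + n)) = (c == d).
Proof. exact: eq_rshift. Qed.

Let drad_r p : is_derive p (delta_mx 0 r0) rad 1.
Proof.
rewrite (_ : rad = fun q => q 0 r0); last by apply/funext => q; exact: radE.
by have := partial_coord p r0 r0; rewrite eqxx.
Qed.
Let drad_a p c : is_derive p (delta_mx 0 (ang c)) rad 0.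
Proof.
rewrite (_ : rad = fun q => q 0 r0); last by apply/funext => q; exact: radE.
by have := partial_coord p r0 (ang c); rewrite r0_ang.
Qed.
Let du_r p c : is_derive p (delta_mx 0 r0) (fun q => u q c) 0.
Proof. by have := partial_coord p (ang c) r0; rewrite ang_r0. Qed.
Let du_a p c d : is_derive p (delta_mx 0 (ang d)) (fun q => u q c) (c == d)%:R.
Proof. by have := partial_coord p (ang c) (ang d); rewrite ang_ang. Qed.

Let sqnormE p : sqnorm (rsubmx p) = \sum_c u p c ^+ 2.
Proof. by apply: eq_bigr => c _; rewrite mxE. Qed.

Let s_neq0 p : 1 + sqnorm (rsubmx p) != 0.
Proof. by rewrite gt_eqF // sqnorm1_gt0. Qed.
Let rho_neq0 p : rho p != 0.
Proof. by rewrite /rho mulf_neq0 ?invr_eq0. Qed.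
Let psi_neq0 p : 0 < rad p -> psi (rad p) != 0.
Proof. by move=> p0; rewrite gt_eqF // psi_pos. Qed.

Let drho_gen (p v : pt) (d : 'I_n -> R) :
  (forall c, is_derive p v (fun q => u q c) (d c)) ->
  is_derive p v rho (- rho p ^+ 2 * \sum_c u p c * d c).
Proof.
move=> h.
have hN := isd_sum (fun c => isd_exp 2 (h c)).
have := @isd_inv R _ (fun q => 1 + \sum_c u q c ^+ 2) p v _ _
   (isd_add (isd_cst p v 1) hN).
rewrite -sqnormE => /(_ (s_neq0 p)) hi.
have := isd_mul (isd_cst p v 2) hi.
rewrite (_ : (fun q => _) = rho); last first.
  by apply/funext => q; rewrite /rho sqnormE.
move=> hr; apply: (is_derive_eq hr); cbv beta; rewrite /rho -sqnormE.
under eq_bigr do rewrite expr1 -mulrA.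
by rewrite -mulr_sumr; field; exact: s_neq0.
Qed.

Let drho_r p : is_derive p (delta_mx 0 r0) rho 0.
Proof.
apply: (is_derive_eq (drho_gen (du_r p))).
by rewrite big1 ?mulr0 // => c _; rewrite mulr0.
Qed.

Let drho_a p d : is_derive p (delta_mx 0 (ang d)) rho (- rho p ^+ 2 * u p d).
Proof.
apply: (is_derive_eq (drho_gen (fun c => du_a p c d))); congr (_ * _).
by under eq_bigr do rewrite mulrC; exact: sum_delta_r.
Qed.

(* Partial derivatives depend on the values near the point only. *)
Let partial_pos (a : 'I_(1 + n)) (f h : pt -> R) (p : pt) (d : R) : 0 < rad p ->
  (forall q, 0 < rad q -> f q = h q) -> is_derive p (delta_mx 0 a) h d ->
  partial a f p = d.
Proof.
move=> p0 e [_ <-]; rewrite /partial; apply: near_eq_derive.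
have crad : continuous rad.
  move=> q; rewrite (_ : rad = fun q => q 0 r0); last by apply/funext => z; exact: radE.
  by apply: differentiable_continuous; exact: differentiable_coord.
have : \forall q \near p, 0 < rad q.
  exact: (crad p _ (lt_nbhsr p0)).
by apply: filterS => q /e.
Qed.

Let g_r0r0 p : g p r0 r0 = 1.
Proof. by rewrite /warped_metric block_mxEul mxE. Qed.
Let g_r0a p c : g p r0 (ang c) = 0.
Proof. by rewrite /warped_metric block_mxEur mxE. Qed.
Let g_ar0 p c : g p (ang c) r0 = 0.
Proof. by rewrite /warped_metric block_mxEdl mxE. Qed.
Let g_aa p c d : g p (ang c) (ang d) = (c == d)%:R * (psi (rad p) * rho p) ^+ 2.
Proof.
rewrite /warped_metric block_mxEdr mxE sphere_metricE /rho.
by ring.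
Qed.

Let ginv (p : pt) : 'M[R]_(1 + n) :=
  block_mx 1%:M 0 0 ((psi (rad p) * rho p) ^- 2)%:M.

Let invmx_g p : 0 < rad p -> invmx (g p) = ginv p.
Proof.
move=> p0.
have gE : g p = block_mx 1%:M 0 0 ((psi (rad p) * rho p) ^+ 2)%:M.
  apply/matrixP => i j.
  case: (split_ordP i) => c ->; case: (split_ordP j) => d ->; rewrite ?(ord1 c) ?(ord1 d).
  - by rewrite g_r0r0 block_mxEul mxE.
  - by rewrite g_r0a block_mxEur mxE.
  - by rewrite g_ar0 block_mxEdl mxE.
  - by rewrite g_aa block_mxEdr mxE; case: eqP => _; rewrite ?mul1r ?mul0r.
have gK : g p *m ginv p = 1%:M.
  rewrite gE mulmx_block !mulmx0 !mul0mx !addr0 add0r mulmx1 -scalar_mxM.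
  have F0 : psi (rad p) * rho p != 0 by rewrite mulf_neq0 ?psi_neq0 ?rho_neq0.
  by rewrite mulfV ?expf_neq0 //; symmetry; exact: scalar_mx_block.
have [gu _] := mulmx1_unit gK.
by rewrite -[invmx _]mulmx1 -gK mulKmx.
Qed.

Let sum_split (f : 'I_(1 + n) -> R) : \sum_k f k = f r0 + \sum_c f (ang c).
Proof. by rewrite big_split_ord big_ord1. Qed.

Let chr_r0 p i j : 0 < rad p -> christoffel g r0 i j p =
  2^-1 * (partial i (fun q => g q j r0) p + partial j (fun q => g q i r0) p
          - partial r0 (fun q => g q i j) p).
Proof.
move=> p0; rewrite /christoffel invmx_g // sum_split /ginv block_mxEul mxE mul1r.
by rewrite big1 ?addr0 // => c _; rewrite block_mxEur mxE mul0r.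
Qed.

Let chr_ang p e i j : 0 < rad p -> christoffel g (ang e) i j p =
  2^-1 * ((psi (rad p) * rho p) ^- 2 *
   (partial i (fun q => g q j (ang e)) p + partial j (fun q => g q i (ang e)) p
          - partial (ang e) (fun q => g q i j) p)).
Proof.
move=> p0; rewrite /christoffel invmx_g // sum_split /ginv block_mxEdl mxE mul0r.
rewrite add0r (bigD1 e) //= block_mxEdr mxE eqxx mulr1n big1 ?addr0 // => c ce.
by rewrite block_mxEdr mxE eq_sym (negbTE ce) mul0r.
Qed.

Let pg_cst (h : pt -> R) a p k : (forall q, h q = k) -> partial a h p = 0.
Proof.
move=> e; rewrite /partial (_ : h = fun=> k); last exact/funext.
by have [_] := isd_cst p (delta_mx 0 a) k.
Qed.

Let pg_aa_r p c d : 0 < rad p ->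
  partial r0 (fun q => g q (ang c) (ang d)) p =
  (c == d)%:R * (2 * psi (rad p) * psi1 (rad p) * rho p ^+ 2).
Proof.
move=> p0; apply: (partial_pos p0 (fun q _ => g_aa q c d)).
have hp := isd_compV (dpsi p0) (drad_r p).
have h := isd_mul (isd_cst p (delta_mx 0 r0) (c == d)%:R)
  (isd_exp 2 (isd_mul hp (drho_r p))).
by apply: (is_derive_eq h); cbv beta; rewrite expr1; ring.
Qed.

Let pg_aa_a p c d e : 0 < rad p ->
  partial (ang e) (fun q => g q (ang c) (ang d)) p =
  (c == d)%:R * (- 2 * rho p * u p e * (psi (rad p) * rho p) ^+ 2).
Proof.
move=> p0; apply: (partial_pos p0 (fun q _ => g_aa q c d)).
have hp := isd_compV (dpsi p0) (drad_a p e).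
have h := isd_mul (isd_cst p (delta_mx 0 (ang e)) (c == d)%:R)
  (isd_exp 2 (isd_mul hp (drho_a p e))).
by apply: (is_derive_eq h); cbv beta; rewrite expr1; ring.
Qed.

Let pg_rr a p : partial a (fun q => g q r0 r0) p = 0.
Proof. exact: pg_cst. Qed.
Let pg_ra a p c : partial a (fun q => g q r0 (ang c)) p = 0.
Proof. exact: pg_cst. Qed.
Let pg_ar a p c : partial a (fun q => g q (ang c) r0) p = 0.
Proof. exact: pg_cst. Qed.

(** * Christoffel symbols *)

Let chr_rrr p : 0 < rad p -> christoffel g r0 r0 r0 p = 0.
Proof. by move=> p0; rewrite chr_r0 // !pg_rr; ring. Qed.
Let chr_rra p c : 0 < rad p -> christoffel g r0 r0 (ang c) p = 0.
Proof. by move=> p0; rewrite chr_r0 // pg_rr pg_ra pg_ar; ring. Qed.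
Let chr_rar p c : 0 < rad p -> christoffel g r0 (ang c) r0 p = 0.
Proof. by move=> p0; rewrite chr_r0 // pg_rr !pg_ar; ring. Qed.
Let chr_raa p c d : 0 < rad p -> christoffel g r0 (ang c) (ang d) p =
  (c == d)%:R * (- (psi (rad p) * psi1 (rad p) * rho p ^+ 2)).
Proof. by move=> p0; rewrite chr_r0 // !pg_ar pg_aa_r //; field. Qed.
Let chr_arr p e : 0 < rad p -> christoffel g (ang e) r0 r0 p = 0.
Proof. by move=> p0; rewrite chr_ang // !pg_ra pg_rr; ring. Qed.
Let chr_aar p e d : 0 < rad p -> christoffel g (ang e) (ang d) r0 p =
  (d == e)%:R * (psi1 (rad p) / psi (rad p)).
Proof.
move=> p0; rewrite chr_ang // pg_ra pg_aa_r // pg_ar.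
by field; rewrite psi_neq0 ?rho_neq0.
Qed.
Let chr_ara p e d : 0 < rad p -> christoffel g (ang e) r0 (ang d) p =
  (d == e)%:R * (psi1 (rad p) / psi (rad p)).
Proof.
move=> p0; rewrite chr_ang // pg_aa_r // !pg_ra.
by field; rewrite psi_neq0 ?rho_neq0.
Qed.
Let chr_aaa p e c d : 0 < rad p -> christoffel g (ang e) (ang c) (ang d) p =
  - rho p * ((d == e)%:R * u p c + (c == e)%:R * u p d - (c == d)%:R * u p e).
Proof.
move=> p0; rewrite chr_ang // !pg_aa_a //.
by field; rewrite psi_neq0 ?rho_neq0.
Qed.

Let dchr0 (h : pt -> R) a p : 0 < rad p -> (forall q, 0 < rad q -> h q = 0) ->
  partial a h p = 0.
Proof. by move=> p0 e; apply: (partial_pos p0 e); exact: isd_cst. Qed.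

Let dchr_raa_r p c d : 0 < rad p ->
  partial r0 (christoffel g r0 (ang c) (ang d)) p =
  (c == d)%:R * (- ((psi1 (rad p) ^+ 2 + psi (rad p) * psi2 (rad p)) * rho p ^+ 2)).
Proof.
move=> p0; apply: (partial_pos p0 (fun q q0 => chr_raa c d q0)).
have hp := isd_compV (dpsi p0) (drad_r p).
have hp1 := isd_compV (dpsi1 p0) (drad_r p).
have h := isd_mul (isd_cst p (delta_mx 0 r0) (c == d)%:R)
  (isd_opp (isd_mul (isd_mul hp hp1) (isd_exp 2 (drho_r p)))).
by apply: (is_derive_eq h); cbv beta; rewrite expr1; ring.
Qed.

Let dchr_ara_r p e d : 0 < rad p ->
  partial r0 (christoffel g (ang e) r0 (ang d)) p =
  (d == e)%:R * (psi2 (rad p) / psi (rad p) - (psi1 (rad p) / psi (rad p)) ^+ 2).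
Proof.
move=> p0; apply: (partial_pos p0 (fun q q0 => chr_ara e d q0)).
have hp := @isd_inv R _ (fun q => psi (rad q)) p _ _ (psi_neq0 p0)
  (isd_compV (dpsi p0) (drad_r p)).
have hp1 := isd_compV (dpsi1 p0) (drad_r p).
have h := isd_mul (isd_cst p (delta_mx 0 r0) (d == e)%:R) (isd_mul hp1 hp).
by apply: (is_derive_eq h); cbv beta; field; rewrite psi_neq0.
Qed.

Let dpsi_ratio_a p (k : R) c : 0 < rad p ->
  is_derive p (delta_mx 0 (ang c)) (fun q => k * (psi1 (rad q) / psi (rad q))) 0.
Proof.
move=> p0; have hp := @isd_inv R _ (fun q => psi (rad q)) p _ _ (psi_neq0 p0)
  (isd_compV (dpsi p0) (drad_a p c)).
have hp1 := isd_compV (dpsi1 p0) (drad_a p c).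
apply: (is_derive_eq (isd_mul (isd_cst p (delta_mx 0 (ang c)) k) (isd_mul hp1 hp))).
by cbv beta; ring.
Qed.

Let dchr_ara_a p e d c : 0 < rad p ->
  partial (ang c) (christoffel g (ang e) r0 (ang d)) p = 0.
Proof.
by move=> p0; apply: (partial_pos p0 (fun q q0 => chr_ara e d q0)); exact: dpsi_ratio_a.
Qed.
Let dchr_aar_a p e d c : 0 < rad p ->
  partial (ang c) (christoffel g (ang e) (ang d) r0) p = 0.
Proof.
by move=> p0; apply: (partial_pos p0 (fun q q0 => chr_aar e d q0)); exact: dpsi_ratio_a.
Qed.

Let dchr_aaa_r p e c d : 0 < rad p ->
  partial r0 (christoffel g (ang e) (ang c) (ang d)) p = 0.
Proof.
move=> p0; apply: (partial_pos p0 (fun q q0 => chr_aaa e c d q0)).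
pose k x := isd_cst p (delta_mx 0 r0) x.
have h := isd_mul (isd_opp (drho_r p)) (isd_add (isd_add
  (isd_mul (k (d == e)%:R) (du_r p c)) (isd_mul (k (c == e)%:R) (du_r p d)))
  (isd_opp (isd_mul (k (c == d)%:R) (du_r p e)))).
by apply: (is_derive_eq h); cbv beta; ring.
Qed.

Let dchr_aaa_a p e c d f : 0 < rad p ->
  partial (ang f) (christoffel g (ang e) (ang c) (ang d)) p =
  rho p ^+ 2 * u p f *
    ((d == e)%:R * u p c + (c == e)%:R * u p d - (c == d)%:R * u p e)
  - rho p * ((d == e)%:R * (c == f)%:R + (c == e)%:R * (d == f)%:R
             - (c == d)%:R * (e == f)%:R).
Proof.
move=> p0; apply: (partial_pos p0 (fun q q0 => chr_aaa e c d q0)).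
pose k x := isd_cst p (delta_mx 0 (ang f)) x.
have h := isd_mul (isd_opp (drho_a p f)) (isd_add (isd_add
  (isd_mul (k (d == e)%:R) (du_a p c f)) (isd_mul (k (c == e)%:R) (du_a p d f)))
  (isd_opp (isd_mul (k (c == d)%:R) (du_a p e f)))).
by apply: (is_derive_eq h); cbv beta; ring.
Qed.

Let d_rrr a p : 0 < rad p -> partial a (christoffel g r0 r0 r0) p = 0.
Proof. by move=> p0; apply: dchr0 => // q q0; exact: chr_rrr. Qed.
Let d_rra a p c : 0 < rad p -> partial a (christoffel g r0 r0 (ang c)) p = 0.
Proof. by move=> p0; apply: dchr0 => // q q0; exact: chr_rra. Qed.
Let d_rar a p c : 0 < rad p -> partial a (christoffel g r0 (ang c) r0) p = 0.
Proof. by move=> p0; apply: dchr0 => // q q0; exact: chr_rar. Qed.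
Let d_arr a p c : 0 < rad p -> partial a (christoffel g (ang c) r0 r0) p = 0.
Proof. by move=> p0; apply: dchr0 => // q q0; exact: chr_arr. Qed.

(** * The Ricci tensor *)

Let sum_cst (k : R) : \sum_(c < n) k = n%:R * k.
Proof. by rewrite sumr_const card_ord mulr_natl. Qed.

Let ricci_rr p : 0 < rad p ->
  ricci g r0 r0 p = - (n%:R * (psi2 (rad p) / psi (rad p))).
Proof.
move=> p0; rewrite /ricci !sum_split.
rewrite !d_rrr // !chr_rrr //.
rewrite (eq_bigr (fun=> - (psi2 (rad p) / psi (rad p)
    - (psi1 (rad p) / psi (rad p)) ^+ 2))); last first.
  by move=> c _; rewrite d_arr // dchr_ara_r // eqxx mul1r sub0r.
rewrite [X in _ + (_ + X + _)]big1; last first.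
  by move=> c _; rewrite chr_rra // !mul0r subrr.
rewrite [X in _ + (_ + X)](eq_bigr (fun=> - (psi1 (rad p) / psi (rad p)) ^+ 2)).
  by rewrite !sum_cst; ring.
move=> c _; rewrite sum_split chr_aar // !chr_arr // chr_rrr // !mulr0 mul0r.
rewrite (eq_bigr (fun d => (d == c)%:R * - (psi1 (rad p) / psi (rad p)) ^+ 2)).
  by rewrite sum_delta_r subrr add0r.
move=> d _; rewrite !chr_arr // mulr0 sub0r !chr_ara // (eq_sym c d).
by rewrite mulrACA delta_mul expr2 mulrN.
Qed.

Let ricci_mixed p c : 0 < rad p -> ricci g r0 (ang c) p = 0 /\
  ricci g (ang c) r0 p = 0.
Proof.
move=> p0.
have tr z (l : 'I_n) : \sum_(k < n) z * christoffel g (ang k) (ang k) (ang l) p =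
    n%:R * (- z * (rho p * u p l)).
  rewrite -sum_cst; apply: eq_bigr => k _.
  by rewrite chr_aaa // eqxx (eq_sym k l) /=; ring.
have tr' z (l : 'I_n) : \sum_(k < n) z * christoffel g (ang k) (ang l) (ang k) p =
    n%:R * (- z * (rho p * u p l)).
  rewrite -sum_cst; apply: eq_bigr => k _.
  by rewrite chr_aaa // eqxx /=; ring.
pose s := psi1 (rad p) / psi (rad p).
split; rewrite /ricci !sum_split.
- rewrite d_rra // dchr0 => [|//|q q0]; last exact: chr_rrr.
  rewrite big1; last by move=> k _; rewrite dchr_ara_a // dchr_ara_a // subrr.
  rewrite chr_rrr // chr_rra // chr_rar //.
  rewrite [X in _ + (_ + X + _)]big1; last first.
    by move=> l _; rewrite chr_rra // chr_arr // mul0r mulr0 subrr.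
  rewrite [X in _ + (_ + X)](eq_bigr (fun k => s *
     christoffel g (ang k) (ang k) (ang c) p - s *
     christoffel g (ang k) (ang c) (ang k) p)).
    by rewrite sumrB tr tr'; ring.
  move=> k _; rewrite sum_split !chr_rra // !mulr0 subrr add0r.
  rewrite sumrB; congr (_ - _).
    rewrite (eq_bigr (fun l => (c == l)%:R * (s * christoffel g (ang k) (ang k) (ang l) p))).
      by rewrite sum_delta_l.
    by move=> l _; rewrite chr_ara // mulrCA (mulrC s).
  rewrite (eq_bigr (fun l => (k == l)%:R * (s * christoffel g (ang k) (ang c) (ang l) p))).
    by rewrite sum_delta_l.
  by move=> l _; rewrite chr_ara // mulrCA (mulrC s).
- rewrite d_rar // big1 => [|k _]; last by rewrite dchr_aar_a // dchr_aaa_r // subrr.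
  rewrite chr_rrr // chr_rar //.
  rewrite [X in _ + (_ + X + _)]big1; last first.
    by move=> l _; rewrite chr_rra // !mul0r subrr.
  rewrite [X in _ + (_ + X)](eq_bigr (fun k => s *
     christoffel g (ang k) (ang k) (ang c) p - s *
     christoffel g (ang k) (ang c) (ang k) p)).
    by rewrite sumrB tr tr'; ring.
  move=> k _; rewrite sum_split !chr_rar // !mulr0 chr_arr // mul0r subrr add0r.
  rewrite sumrB; congr (_ - _).
    rewrite (eq_bigr (fun l => (c == l)%:R * (s * christoffel g (ang k) (ang k) (ang l) p))).
      by rewrite sum_delta_l.
    by move=> l _; rewrite chr_aar // mulrCA (mulrC s).
  rewrite (eq_bigr (fun l => (l == k)%:R * (s * christoffel g (ang l) (ang c) (ang k) p))).
    by rewrite sum_delta_r.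
  by move=> l _; rewrite chr_ara // -mulrA.
Qed.

Let N p := sqnorm (rsubmx p).

Let ricci_aa p c d : 0 < rad p -> ricci g (ang c) (ang d) p =
  (c == d)%:R * (rho p ^+ 2 *
    (- (psi (rad p) * psi2 (rad p)) + (n%:R - 1) * (1 - psi1 (rad p) ^+ 2))).
Proof.
move=> p0; rewrite /ricci !sum_split dchr_raa_r // d_rar //.
have NE : \sum_k u p k ^+ 2 = N p by rewrite /N sqnormE.
have SA : \sum_(k < n) (partial (ang k) (christoffel g (ang k) (ang c) (ang d)) p
      - partial (ang d) (christoffel g (ang k) (ang c) (ang k)) p) =
    rho p ^+ 2 * (2 * u p c * u p d - (c == d)%:R * N p)
    - rho p * (2 * (c == d)%:R - n%:R * (c == d)%:R)
    - n%:R * (rho p ^+ 2 * u p c * u p d - rho p * (c == d)%:R).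
  rewrite (eq_bigr (fun k =>
     (c == k)%:R * (rho p ^+ 2 * u p k * u p d - 2 * rho p * (d == k)%:R) +
     (d == k)%:R * (rho p ^+ 2 * u p k * u p c) +
     - ((c == d)%:R * rho p ^+ 2) * u p k ^+ 2 +
     (2 * rho p * (c == d)%:R - rho p ^+ 2 * u p c * u p d))); last first.
    by move=> k _; rewrite !dchr_aaa_a // eqxx (eq_sym k d) /=; ring.
  rewrite !big_split /= !sum_delta_l -mulr_sumr NE !sum_cst (eq_sym d c).
  by ring.
have SB : \sum_(l < n) (christoffel g r0 r0 (ang l) p *
      christoffel g (ang l) (ang c) (ang d) p -
      christoffel g r0 (ang d) (ang l) p * christoffel g (ang l) (ang c) r0 p) =
    (c == d)%:R * (psi1 (rad p) ^+ 2 * rho p ^+ 2).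
  rewrite (eq_bigr (fun l => (c == l)%:R * ((d == l)%:R *
     (psi1 (rad p) ^+ 2 * rho p ^+ 2)))); first by rewrite sum_delta_l (eq_sym d c).
  move=> l _; rewrite chr_rra // chr_raa // chr_aar //.
  by field; exact: psi_neq0.
have SD (k : 'I_n) : \sum_(l < n) (christoffel g (ang k) (ang k) (ang l) p *
       christoffel g (ang l) (ang c) (ang d) p) =
    rho p ^+ 2 * (2 * u p c * u p d - (c == d)%:R * N p).
  rewrite (eq_bigr (fun l => (d == l)%:R * (rho p ^+ 2 * (u p l * u p c)) +
     (c == l)%:R * (rho p ^+ 2 * (u p l * u p d)) +
     (- (c == d)%:R * rho p ^+ 2) * u p l ^+ 2)); last first.
    by move=> l _; rewrite !chr_aaa // eqxx (eq_sym k l) /=; ring.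
  by rewrite !big_split /= !sum_delta_l -mulr_sumr NE; ring.
have SE (k : 'I_n) : \sum_(l < n) (christoffel g (ang k) (ang d) (ang l) p *
       christoffel g (ang l) (ang c) (ang k) p) =
    rho p ^+ 2 * (u p c * u p d + (d == k)%:R *
      (2 * u p c * u p k - (c == k)%:R * N p) -
      u p k * ((d == k)%:R * u p c + (c == d)%:R * u p k - (c == k)%:R * u p d)).
  rewrite (eq_bigr (fun l => (k == l)%:R * (rho p ^+ 2 * u p d *
       ((k == k)%:R * u p c + (c == l)%:R * u p k - (c == k)%:R * u p l)) +
     (k == l)%:R * ((d == k)%:R * rho p ^+ 2 * u p l * u p c) +
     (c == l)%:R * ((d == k)%:R * rho p ^+ 2 * u p l * u p k) +
     (- ((d == k)%:R * rho p ^+ 2 * (c == k)%:R)) * u p l ^+ 2 +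
     (d == l)%:R * (- (rho p ^+ 2 * u p k) *
       ((k == l)%:R * u p c + (c == l)%:R * u p k - (c == k)%:R * u p l)))).
    rewrite !big_split /= !sum_delta_l -mulr_sumr NE eqxx (eq_sym k d) /=.
    by ring.
  move=> l _; rewrite !chr_aaa // (eq_sym l k) eqxx.
  have := @delta_mul R _ k l; move: (k == l)%:R => e ee.
  by rewrite /=; ring: ee.
have SC : \sum_(k < n) \sum_(l < 1 + n) (christoffel g (ang k) (ang k) l p *
      christoffel g l (ang c) (ang d) p -
      christoffel g (ang k) (ang d) l p * christoffel g l (ang c) (ang k) p) =
    - (n%:R * ((c == d)%:R * (psi1 (rad p) ^+ 2 * rho p ^+ 2))) +
    (c == d)%:R * (psi1 (rad p) ^+ 2 * rho p ^+ 2) +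
    rho p ^+ 2 * (n%:R * (2 * u p c * u p d - (c == d)%:R * N p)
       - n%:R * u p c * u p d - 2 * u p c * u p d + 2 * (c == d)%:R * N p).
  rewrite (eq_bigr (fun k => (- ((c == d)%:R * (psi1 (rad p) ^+ 2 * rho p ^+ 2))
     + rho p ^+ 2 * (u p c * u p d - (c == d)%:R * N p))
     + (c == k)%:R * ((d == k)%:R * (psi1 (rad p) ^+ 2 * rho p ^+ 2)
         - rho p ^+ 2 * u p k * u p d)
     + (d == k)%:R * (- rho p ^+ 2 * (u p c * u p k - (c == k)%:R * N p))
     + (rho p ^+ 2 * (c == d)%:R) * u p k ^+ 2)).
    rewrite !big_split /= !sum_cst !sum_delta_l -mulr_sumr NE (eq_sym d c).
    by ring.
  move=> k _; rewrite sum_split sumrB SD SE.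
  rewrite !chr_aar // !chr_raa // eqxx /=.
  by field; exact: psi_neq0.
rewrite SA SB SC chr_rrr // !chr_rar //.
rewrite (_ : N p = 2 / rho p - 1); last first.
  by rewrite /rho /N; field; exact: s_neq0.
by field; exact: rho_neq0.
Qed.

(** * The Hessian of a radial function *)

Let phir := fun q : pt => phi (rad q).

Let dphir_r p : 0 < rad p -> partial r0 phir p = phi1 (rad p).
Proof.
move=> p0; have [_ h] := isd_compV (dphi p0) (drad_r p).
by rewrite /partial /phir h mulr1.
Qed.
Let dphir_a p c : 0 < rad p -> partial (ang c) phir p = 0.
Proof.
move=> p0; have [_ h] := isd_compV (dphi p0) (drad_a p c).
by rewrite /partial /phir h mulr0.
Qed.

Let hess_rr p : 0 < rad p -> hessian g phir r0 r0 p = derive1 phi1 (rad p).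
Proof.
move=> p0; rewrite /hessian sum_split chr_rrr // mul0r add0r big1; last first.
  by move=> c _; rewrite chr_arr // mul0r.
rewrite subr0; apply: (partial_pos p0 dphir_r).
by rewrite -[X in is_derive _ _ _ X]mulr1; exact: isd_compV (dphi1 p0) (drad_r p).
Qed.

Let hess_ra p c : 0 < rad p -> hessian g phir r0 (ang c) p = 0.
Proof.
move=> p0; rewrite /hessian sum_split chr_rra // mul0r add0r big1; last first.
  by move=> d _; rewrite dphir_a // mulr0.
by rewrite subr0; apply: dchr0 => // q q0; exact: dphir_a.
Qed.

Let hess_ar p c : 0 < rad p -> hessian g phir (ang c) r0 p = 0.
Proof.
move=> p0; rewrite /hessian sum_split chr_rar // mul0r add0r big1; last first.
  by move=> d _; rewrite dphir_a // mulr0.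
rewrite subr0; apply: (partial_pos p0 dphir_r).
by rewrite -[X in is_derive _ _ _ X](mulr0 (derive1 phi1 (rad p)));
  exact: isd_compV (dphi1 p0) (drad_a p c).
Qed.

Let hess_aa p c d : 0 < rad p -> hessian g phir (ang c) (ang d) p =
  (c == d)%:R * (psi (rad p) * psi1 (rad p) * phi1 (rad p) * rho p ^+ 2).
Proof.
move=> p0; rewrite /hessian sum_split chr_raa // dphir_r // big1; last first.
  by move=> e _; rewrite dphir_a // mulr0.
rewrite dchr0 => [|//|q q0]; last exact: dphir_a.
by ring.
Qed.

(** The Ricci tensor of dx^2 + psi^2 g_S and the Hessian of phi(x) are both
    diagonal in these coordinates, so the soliton equation amounts to one
    radial and one spherical equation. *)
Theorem steady_soliton_warped :
  (forall x, 0 < x -> derive1n 2 phi x = n%:R * (derive1n 2 psi x / psi x)) ->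
  (forall x, 0 < x ->
    - psi x * derive1n 2 psi x + (n%:R - 1) * (1 - derive1 psi x ^+ 2)
    + psi x * derive1 psi x * derive1 phi x = 0) ->
  forall p, 0 < rad p -> forall i j,
  ricci g i j p + hessian g phir i j p = 0.
Proof.
move=> radial_eq spherical_eq p p0 i j.
have := radial_eq _ p0; have := spherical_eq _ p0; rewrite !derive1n2.
rewrite -/psi1 -/phi1 -/psi2 => e1 e2.
case: (split_ordP i) => c ->; case: (split_ordP j) => d ->.
- by rewrite (ord1 c) (ord1 d) ricci_rr // hess_rr // e2 addNr.
- by rewrite (ord1 c) (ricci_mixed d p0).1 hess_ra // addr0.
- by rewrite (ord1 d) (ricci_mixed c p0).2 hess_ar // addr0.
- rewrite ricci_aa // hess_aa // -mulrDr.
  have -> : forall a k x y z t : R, a * (- (x * y) + k * (1 - z ^+ 2)) +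
      x * z * t * a = a * (- x * y + k * (1 - z ^+ 2) + x * z * t).
    by move=> *; ring.
  by rewrite e1 !mulr0.
Qed.

End Warped_product.

(** * Behaviour near the origin *)

Section Limit_rules.
Context {R : realType} {T : Type} {F : set_system T} {FF : Filter F}.
Implicit Types (f g : T -> R) (a b : R).

Lemma lim_cst a : (fun _ : T => a) @ F --> a.
Proof. exact: cvg_cst. Qed.

Lemma lim_add f g a b : f @ F --> a -> g @ F --> b ->
  (fun x => f x + g x) @ F --> a + b.
Proof. by move=> hf hg; exact: cvgD. Qed.

Lemma lim_sub f g a b : f @ F --> a -> g @ F --> b ->
  (fun x => f x - g x) @ F --> a - b.
Proof. by move=> hf hg; exact: cvgB. Qed.

Lemma lim_mul f g a b : f @ F --> a -> g @ F --> b ->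
  (fun x => f x * g x) @ F --> a * b.
Proof. by move=> hf hg; exact: cvgM. Qed.

Lemma lim_inv f a : a != 0 -> f @ F --> a -> (fun x => (f x)^-1) @ F --> a^-1.
Proof. by move=> a0 hf; exact: cvgV. Qed.

Lemma lim_eq f a b : f @ F --> a -> a = b -> f @ F --> b.
Proof. by move=> + <-. Qed.

End Limit_rules.

Arguments lim_cst {R T F FF} a.

Section Asymptotic_lemmas.
Context {R : realType}.
Implicit Types (f a b z : R -> R).

(** A solution of z' = b - a z follows the quotient b/a when a -> 1. *)
Lemma relaxation z a b (beta : R) :
  (forall y : R, is_derive y 1 z (b y - a y * z y)) ->
  a y @[y --> +oo] --> (1 : R) -> b y @[y --> +oo] --> beta ->
  z y @[y --> +oo] --> beta.
Proof.
move=> dz ca cb; apply/cvgrPdist_le => /= e e0.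
pose d := e / 4; have d0 : 0 < d by rewrite divr_gt0.
have cc : b y - a y * beta @[y --> +oo] --> (0 : R).
  by apply: (lim_eq (lim_sub cb (lim_mul ca (lim_cst beta)))); rewrite mul1r subrr.
have [y1 hy1] : exists y1, forall y, y1 <= y ->
    1 / 2 <= a y /\ `|b y - a y * beta| <= d.
  have : \forall y \near +oo, 1 / 2 <= a y /\ `|b y - a y * beta| <= d.
    near=> y; split.
      by near: y; apply: (cvgr_ge 1) => //; lra.
    by near: y; apply: cvgr0_norm_le.
  move=> [M [_ hM]]; exists (M + 1) => y hy; apply: hM.
  by apply: lt_le_trans hy; rewrite ltrDl.
pose s y := z y - beta.
(* s^2 - 4 d^2 decreases like exp (- y / 2) once a >= 1/2 and |b - a beta| <= d *)
have key y : y1 <= y -> (s y ^+ 2 - 4 * d ^+ 2) * expR (y / 2) <=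
    (s y1 ^+ 2 - 4 * d ^+ 2) * expR (y1 / 2).
  move=> hy.
  apply: (@deriv_le0_ge _ (fun y => (s y ^+ 2 - 4 * d ^+ 2) * expR (y / 2))
    (fun y => (2 * s y * (b y - a y * z y) + (s y ^+ 2 - 4 * d ^+ 2) / 2)
       * expR (y / 2)) _ _ hy).
    by move=> t _; rewrite /s; derive_by; field.
  move=> t /andP[/ltW t1 _]; rewrite pmulr_lle0 ?expR_gt0 //.
  have [ha hb] := hy1 t t1.
  have -> : b t - a t * z t = (b t - a t * beta) - a t * s t by rewrite /s; ring.
  move: (b t - a t * beta) (s t) hb => c x; rewrite ler_norml => /andP[c1 c2].
  have h1 : x ^+ 2 / 2 <= a t * x ^+ 2.
    by rewrite mulrC ler_wpM2r ?sqr_ge0 //; lra.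
  have h2 : x * c <= x ^+ 2 / 4 + d ^+ 2.
    have h3 : c ^+ 2 <= d ^+ 2 by nra.
    have := sqr_ge0 (x / 2 - c); nra.
  nra.
near=> y.
have yy1 : y1 <= y by near: y; apply: nbhs_pinfty_ge; rewrite num_real.
have h1 : s y ^+ 2 <= 9 * d ^+ 2.
  have h2 : s y1 ^+ 2 <= 4 * d ^+ 2 * expR ((y - y1) / 2).
    apply: (@le_trans _ _ (4 * d ^+ 2 * ((y - y1) / 2))).
      rewrite -ler_pdivrMl ?mulr_gt0 ?exprn_gt0 // ler_pdivlMr // lerBrDr.
      by near: y; apply: nbhs_pinfty_ge; rewrite num_real.
    have d4 : 0 <= 4 * d ^+ 2 by have := sqr_ge0 d; lra.
    apply: (ler_wpM2l d4).
    by have := expR_ge1Dx ((y - y1) / 2); lra.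
  have h3 : expR (y / 2) = expR ((y - y1) / 2) * expR (y1 / 2).
    by rewrite -expRD; congr expR; field.
  have := key y yy1; rewrite h3 mulrA ler_pM2r ?expR_gt0 //.
  have e1 : 1 <= expR ((y - y1) / 2).
    by have := expR_ge1Dx ((y - y1) / 2); lra.
  move: (expR _) e1 h2 => E E1 h2 h4.
  have d2 : 0 <= d ^+ 2 by exact: sqr_ge0.
  have : (s y ^+ 2 - 8 * d ^+ 2) * E <= 0 by nra.
  by rewrite pmulr_lle0; nra.
have : `|s y| <= 3 * d.
  rewrite -(@ler_pXn2r _ 2) ?nnegrE //; last by rewrite mulr_ge0 // ltW.
  by rewrite real_normK ?num_real // exprMn; lra.
by rewrite /s distrC /d; lra.
Unshelve. all: by end_near. Qed.

Lemma linear_growth f (f' : R -> R) (y0 a b : R) : 0 < a -> 0 < b ->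
  (forall y : R, is_derive y 1 f (f' y)) ->
  (forall y, y0 <= y -> a <= f' y <= b) ->
  \forall y \near +oo, a / 2 * y <= f y <= 2 * b * y.
Proof.
move=> a0 b0 df hf'; near=> y.
have y0y : y0 <= y by near: y; apply: nbhs_pinfty_ge; rewrite num_real.
have h1 : f y0 - a * y0 <= f y - a * y.
  apply: (@deriv_ge0_le _ (fun y => f y - a * y) (fun y => f' y - a) _ _ y0y).
    by move=> t _; derive_by; ring.
  by move=> t /andP[/ltW/hf'/andP[h _] _]; rewrite subr_ge0.
have h2 : f y - b * y <= f y0 - b * y0.
  apply: (@deriv_le0_ge _ (fun y => f y - b * y) (fun y => f' y - b) _ _ y0y).
    by move=> t _; derive_by; ring.
  by move=> t /andP[/ltW/hf'/andP[_ h] _]; rewrite subr_le0.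
have h3 : a * y0 - f y0 <= a / 2 * y.
  have a20 : 0 < a / 2 by lra.
  rewrite -(ler_pdivrMl _ _ a20); near: y.
  by apply: nbhs_pinfty_ge; rewrite num_real.
have h4 : f y0 - b * y0 <= b * y.
  rewrite -(ler_pdivrMl _ _ b0); near: y.
  by apply: nbhs_pinfty_ge; rewrite num_real.
by apply/andP; split; lra.
Unshelve. all: by end_near. Qed.

Lemma cvg_pos_bounds f (l : R) : 0 < l -> f y @[y --> +oo] --> l ->
  \forall y \near +oo, l / 2 <= f y <= 2 * l.
Proof.
move=> l0 cf; near=> y; apply/andP; split; near: y.
  by apply: (cvgr_ge l) => //; lra.
by apply: (cvgr_le l) => //; lra.
Unshelve. all: by end_near. Qed.

Lemma near_pinfty_from (P : R -> Prop) : (\forall y \near +oo, P y) ->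
  exists M, forall y, M <= y -> P y.
Proof.
move=> [M [_ hM]]; exists (M + 1) => y hy; apply: hM.
by apply: lt_le_trans hy; rewrite ltrDl.
Qed.

End Asymptotic_lemmas.

(** Trajectories entering the origin follow the centre manifold
    X = Y^2 / sqrt n + O(Y^4). The second order term is needed as well, because
    the concavity of the profile is governed by X - (X^2 + Y^2) / sqrt n, in
    which the leading terms cancel. *)
Section Centre_manifold.
Context {R : realType} {n : nat}.
Hypothesis hn : (2 <= n)%N.
Notation q := (Num.sqrt (n%:R : R)).
Variables X Y : R -> R.
Hypothesis sXY : solves_XY n X Y.
Hypothesis Ypos : forall y, 0 < Y y.
Hypothesis cX : X y @[y --> +oo] --> (0 : R).

Let dX (y : R) : is_derive y 1 X (X y ^+ 3 - X y + Y y ^+ 2 / q).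
Proof. by have [] := sXY y. Qed.
Let dY (y : R) : is_derive y 1 Y (Y y * (X y ^+ 2 - X y / q)).
Proof. by have [] := sXY y. Qed.
Let q0 : q != 0. Proof. exact: (q_neq0 hn). Qed.
Let qpos : 0 < q. Proof. exact: (q_gt0 hn). Qed.
Let Y0 y : Y y != 0. Proof. by rewrite gt_eqF. Qed.

Let u y := X y / Y y ^+ 2.
Let t y := (u y - q^-1) / Y y ^+ 2.

Let dYm2 (y : R) : is_derive y 1 (fun y => (Y y ^+ 2)^-1)
  (2 * (u y * (q^-1 - X y))).
Proof.
have Y2 : Y y ^+ 2 != 0 by rewrite expf_neq0.
apply: (is_derive_eq (@isd_inv R _ (fun y => Y y ^+ 2) y _ _ Y2 (isd_exp 2 (dY y)))).
by rewrite /u expr1; field; rewrite q0 Y0.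
Qed.

Let du (y : R) : is_derive y 1 u (q^-1 - (1 + X y * X y - 2 / q * X y) * u y).
Proof.
apply: (is_derive_eq (isd_mul (dX y) (dYm2 y))); cbv beta.
by rewrite /u; field; rewrite q0 Y0.
Qed.

Let cpoly (c d : R) : 1 + c * (X y * X y) - d * X y @[y --> +oo] --> (1 : R).
Proof.
apply: (lim_eq (lim_sub (lim_add (lim_cst 1)
  (lim_mul (lim_cst c) (lim_mul cX cX))) (lim_mul (lim_cst d) cX))).
by rewrite !mulr0 addr0 subr0.
Qed.

Lemma centre_first_order : X y / Y y ^+ 2 @[y --> +oo] --> q^-1.
Proof.
apply: (relaxation du); last exact: lim_cst.
have := cpoly 1 (2 / q).
by under eq_fun do rewrite mul1r.
Qed.

Let cu : u y @[y --> +oo] --> q^-1 := centre_first_order.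

Lemma centre_second_order :
  (X y - (X y ^+ 2 + Y y ^+ 2) / q) / Y y ^+ 4 @[y --> +oo] --> q ^- 3.
Proof.
have ct : t y @[y --> +oo] --> q^-1 * q^-1 * (2 / q - 0).
  apply: (@relaxation R t (fun y => 1 + 2 * (X y * X y) - 2 / q * X y)
    (fun y => u y * u y * (2 / q - X y))).
  - move=> y; have h := isd_mul (isd_add (du y) (isd_cst y 1 (- q^-1))) (dYm2 y).
    apply: (is_derive_eq h); cbv beta.
    by rewrite /t /u; field; rewrite q0 Y0.
  - exact: cpoly.
  - exact: (lim_mul (lim_mul cu cu) (lim_sub (lim_cst (2 / q)) cX)).
have h := lim_sub ct (lim_mul (lim_mul cu cu) (lim_cst q^-1)).
rewrite (_ : q ^- 3 = q^-1 * q^-1 * (2 / q - 0) - q^-1 * q^-1 * q^-1); last by field.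
rewrite (_ : (fun y => _) = fun y => t y - u y * u y * q^-1); first exact: h.
by apply/funext => y; rewrite /t /u; field; rewrite q0 Y0.
Qed.

Lemma centre_time : exists a b : R, [/\ 0 < a, 0 < b &
  \forall y \near +oo, a * y <= (Y y ^+ 2)^-1 <= b * y].
Proof.
have k0 : 0 < q^-1 * (q^-1 - 0) by rewrite subr0 mulr_gt0 ?invr_gt0.
have [y0 h] := near_pinfty_from
  (cvg_pos_bounds k0 (lim_mul cu (lim_sub (lim_cst q^-1) cX))).
set k := q^-1 * (q^-1 - 0) in k0 h *.
exists (k / 2), (2 * (4 * k)); split; [by lra|by lra|].
apply: (linear_growth k0 _ dYm2); first by lra.
by move=> y /h /andP[h1 h2]; apply/andP; split; rewrite /=; lra.
Qed.

End Centre_manifold.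

(** * Asymptotics at infinity *)

Section Bryant_asymptotics.
Context {R : realType} {n : nat}.
Hypothesis hn : (2 <= n)%N.
Notation q := (Num.sqrt (n%:R : R)).
Notation r := (Num.sqrt (n%:R - 1 : R)).

Lemma powR_half (x : R) : 0 <= x -> [/\ x `^ (1 / 2) = Num.sqrt x,
  x `^ (- (1 / 2)) = (Num.sqrt x)^-1 & x `^ (- (3 / 2)) = Num.sqrt x ^- 3].
Proof.
move=> x0; have h : x `^ (1 / 2) = Num.sqrt x by rewrite mul1r powR12_sqrt.
split=> //; first by rewrite powRN h.
rewrite powRN (_ : 3 / 2 = 1 / 2 * 3%:R); last by field.
by rewrite powRrM powR_mulrn ?powR_ge0 // h.
Qed.

(** Only the powers of x matter in the three estimates, so separate constants
    for each of them are enough. *)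
Lemma bryant_asymptotics_of_bounds (psi : R -> R) (l1 u1 l2 u2 l3 u3 : R) :
  0 < l1 -> 0 < l2 -> 0 < l3 -> 0 < u1 -> 0 < u2 -> 0 < u3 ->
  (\forall x \near +oo, [/\ l1 * Num.sqrt x <= psi x <= u1 * Num.sqrt x,
     l2 * (Num.sqrt x)^-1 <= derive1 psi x <= u2 * (Num.sqrt x)^-1 &
     l3 * Num.sqrt x ^- 3 <= - derive1n 2 psi x <= u3 * Num.sqrt x ^- 3]) ->
  bryant_asymptotics psi.
Proof.
move=> l10 l20 l30 u10 u20 u30 hb.
pose c := Num.min l1 (Num.min l2 l3); pose C := u1 + u2 + u3.
have [c1 c2 c3] : [/\ c <= l1, c <= l2 & c <= l3].
  by rewrite /c; split; rewrite !ge_min lexx ?orbT.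
exists c, C; split; [by rewrite !lt_min l10 l20|by rewrite /C; lra|].
near=> x.
have x0 : 0 <= x by near: x; apply: nbhs_pinfty_ge; rewrite num_real.
have [-> -> ->] := powR_half x0.
have : [/\ l1 * Num.sqrt x <= psi x <= u1 * Num.sqrt x,
     l2 * (Num.sqrt x)^-1 <= derive1 psi x <= u2 * (Num.sqrt x)^-1 &
     l3 * Num.sqrt x ^- 3 <= - derive1n 2 psi x <= u3 * Num.sqrt x ^- 3].
  by near: x.
have s0 : 0 <= Num.sqrt x by exact: sqrtr_ge0.
have si0 : 0 <= (Num.sqrt x)^-1 by rewrite invr_ge0.
have s30 : 0 <= Num.sqrt x ^- 3 by rewrite invr_ge0 exprn_ge0.
move: (derive1n 2 psi x) (derive1 psi x) (psi x) => p2 p1 p.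
move: (Num.sqrt x) (Num.sqrt x)^-1 (Num.sqrt x ^- 3) s0 si0 s30 => s si s3.
move=> s0 si0 s30 [/andP[a1 a2] /andP[b1 b2] /andP[d1 d2]].
have hc k t : 0 <= t -> c <= k -> c * t <= k * t by move=> t0 ck; rewrite ler_wpM2r.
have hC k t : 0 <= t -> k <= C -> k * t <= C * t by move=> t0 ck; rewrite ler_wpM2r.
have uC : [/\ u1 <= C, u2 <= C & u3 <= C] by rewrite /C; split; lra.
case: uC => uC1 uC2 uC3.
split; apply/andP; split.
- exact: le_trans (hc _ _ s0 c1) a1.
- exact: le_trans a2 (hC _ _ s0 uC1).
- exact: le_trans (hc _ _ si0 c2) b1.
- exact: le_trans b2 (hC _ _ si0 uC2).
- by rewrite mulNr lerNl; exact: le_trans d2 (hC _ _ s30 uC3).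
- by rewrite mulNr lerNr; exact: le_trans (hc _ _ s30 c3) d1.
Unshelve. all: by end_near. Qed.

(** The correspondence and the system give W' = W X^2, so W^2 is proportional to
    1 - X^2 - Y^2 and converges. Hence x, y and Y^-2 are comparable, and psi, psi'
    and psi'' are explicit in X, Y and W. *)
Theorem bryant_of_corresponds (psi phi X Y : R -> R) : smooth_on_pos psi ->
  (forall x, 0 < x -> 0 < psi x) -> solves_XY n X Y ->
  X y @[y --> +oo] --> (0 : R) -> Y y @[y --> +oo] --> (0 : R) ->
  corresponds n psi phi X Y -> bryant_asymptotics psi.
Proof.
move=> smooth pos sXY cX cY [xi [xi0 onto _ h]].
have qpos : 0 < q := q_gt0 hn.
have rpos : 0 < r := r_gt0 hn.
have q0 : q != 0 by rewrite gt_eqF.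
have r0 : r != 0 by rewrite gt_eqF.
pose w y := W_of n psi phi (xi y).
have w0 y : 0 < w y by have [] := h y.
have wn0 y : w y != 0 by rewrite gt_eqF.
have dxi (y : R) : is_derive y 1 xi (w y) by have [] := h y.
have hY y : Y y = q * r * w y / psi (xi y).
  by have [_ _ _] := h y; rewrite (sqrt_nn1 (R := R) (n := n)).
have psin0 y : psi (xi y) != 0 by rewrite gt_eqF // pos.
have Ypos y : 0 < Y y by rewrite hY divr_gt0 ?pos // !mulr_gt0.
have Y0 y : Y y != 0 by rewrite gt_eqF.
have psiE y : psi (xi y) = q * r * w y / Y y.
  by rewrite hY; field; rewrite q0 r0 wn0 psin0.
have psi1E y : derive1 psi (xi y) = r * (X y / Y y).
  have [_ _ -> _] := h y; rewrite hY -/(w y).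
  by field; rewrite q0 r0 wn0 psin0.
have dX (y : R) : is_derive y 1 X (X y ^+ 3 - X y + Y y ^+ 2 / q).
  by have [] := sXY y.
have dY (y : R) : is_derive y 1 Y (Y y * (X y ^+ 2 - X y / q)).
  by have [] := sXY y.
have dpsi (x : R) : 0 < x -> is_derive x 1 psi (derive1 psi x).
  by move=> x0; have := deriv_smooth 0 smooth x0.
have dpsi1 (x : R) : 0 < x -> is_derive x 1 (derive1 psi) (derive1n 2 psi x).
  by move=> x0; have := deriv_smooth 1 smooth x0; rewrite derive1n1 derive1n2.
have dw (y : R) : is_derive y 1 w (X y ^+ 2 * w y).
  have wE : w = fun y => (q * r)^-1 * (Y y * psi (xi y)).
    by apply/funext => z; rewrite psiE; field; rewrite q0 r0 Y0.
  have hp := @isd_comp _ psi xi y _ _ (dpsi _ (xi0 y)) (dxi y).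
  have := isd_mul (isd_cst y 1 (q * r)^-1) (isd_mul (dY y) hp).
  rewrite -wE => hw; apply: (is_derive_eq hw); cbv beta.
  by rewrite psi1E psiE; field; rewrite q0 r0 Y0.
have psi2E y : - derive1n 2 psi (xi y) =
    r / w y * ((X y - (X y ^+ 2 + Y y ^+ 2) / q) / Y y ^+ 4 * Y y ^+ 3).
  have := @isd_comp _ (derive1 psi) xi y _ _ (dpsi1 _ (xi0 y)) (dxi y).
  rewrite (_ : (fun y => _) = fun y => r * (X y / Y y)); last exact/funext.
  move=> -[_ e1].
  have [_ e2] := isd_mul (isd_cst y 1 r) (deriv_slope hn sXY Ypos y).
  have -> : derive1n 2 psi (xi y) = derive1n 2 psi (xi y) * w y / w y.
    by rewrite mulfK.
  rewrite -e1 e2; field; by rewrite q0 wn0 Y0.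
(* the scale W converges, since W^2 is proportional to 1 - X^2 - Y^2 *)
have [y0 hy0] : exists y0, forall y, y0 <= y ->
    1 / 2 <= 1 - X y ^+ 2 - Y y ^+ 2 <= 1.
  apply: near_pinfty_from; near=> y.
  have hX : `|X y| <= 1 / 2 by near: y; apply: cvgr0_norm_le => //; lra.
  have hY2 : `|Y y| <= 1 / 2 by near: y; apply: cvgr0_norm_le => //; lra.
  have X2 : X y ^+ 2 <= 1 / 4 by move: hX; rewrite ler_norml => /andP[? ?]; nra.
  have Y2 : Y y ^+ 2 <= 1 / 4 by move: hY2; rewrite ler_norml => /andP[? ?]; nra.
  by apply/andP; split; have := sqr_ge0 (X y); have := sqr_ge0 (Y y); lra.
pose E y := 1 - X y ^+ 2 - Y y ^+ 2.
have E0 y : y0 <= y -> 0 < E y by move=> /hy0/andP[h1 _]; rewrite /E; lra.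
have wE y : y0 <= y -> w y ^+ 2 = w y0 ^+ 2 / E y0 * E y.
  move=> yy0.
  have dF t : y0 <= t <= y -> is_derive t 1 (fun y => w y ^+ 2 / E y) 0.
    move=> /andP[/E0/lt0r_neq0 Et _].
    have hE := @isd_inv R _ E t _ _ Et (deriv_defect sXY t).
    apply: (is_derive_eq (isd_mul (isd_exp 2 (dw t)) hE)); cbv beta.
    by rewrite expr1 -/(E t); field.
  have e : w y0 ^+ 2 / E y0 = w y ^+ 2 / E y.
    apply/eqP; rewrite eq_le; apply/andP; split.
      exact: (@deriv_ge0_le _ (fun y => w y ^+ 2 / E y) (fun=> 0)).
    exact: (@deriv_le0_ge _ (fun y => w y ^+ 2 / E y) (fun=> 0)).
  by rewrite e divfK // lt0r_neq0 // E0.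
pose k := w y0; have k0 : 0 < k by exact: w0.
have w_bd y : y0 <= y -> k / 2 <= w y <= 2 * k.
  move=> yy0; have := wE y yy0; rewrite -/k.
  have /andP[a1 a2] := hy0 y0 (lexx _); have /andP[b1 b2] := hy0 y yy0.
  rewrite -/(E y0) in a1 a2; rewrite -/(E y) in b1 b2.
  rewrite mulrAC => /(canRL (mulfK _)); rewrite ?lt0r_neq0 ?E0 // => /(_ isT) e.
  have {e} e : w y ^+ 2 * E y0 = k ^+ 2 * E y.
    by have := wE y yy0; rewrite -/k => ->; field; rewrite lt0r_neq0 // E0.
  have wy := w0 y; have ww : 0 <= w y ^+ 2 by exact: sqr_ge0.
  have kk : 0 <= k ^+ 2 by exact: sqr_ge0.
  apply/andP; split.
    rewrite -(@ler_pXn2r _ 2) ?nnegrE ?(ltW wy) //; last by lra.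
    by rewrite exprMn; nra.
  rewrite -(@ler_pXn2r _ 2) ?nnegrE ?(ltW wy) //; last by lra.
  by rewrite exprMn; nra.
have xi_grow : \forall y \near +oo, k / 4 * y <= xi y <= 4 * k * y.
  have k2 : 0 < k / 2 by lra.
  have k3 : 0 < 2 * k by lra.
  have := linear_growth k2 k3 dxi w_bd; apply: filterS => y /andP[h1 h2].
  by apply/andP; split; lra.
clearbody k.
have [a [b [a0 b0 Ygrow]]] := centre_time hn sXY Ypos cX.
have qi0 : 0 < q^-1 by rewrite invr_gt0.
have qi30 : 0 < q ^- 3 by rewrite invr_gt0 exprn_gt0.
have b1 := cvg_pos_bounds qi0 (centre_first_order hn sXY Ypos cX).
have b2 := cvg_pos_bounds qi30 (centre_second_order hn sXY Ypos cX).
have [M hM] : exists M, forall y, M <= y -> [/\ 0 < y, y0 <= y,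
    k / 4 * y <= xi y <= 4 * k * y & [/\ a * y <= (Y y ^+ 2)^-1 <= b * y,
    q^-1 / 2 <= X y / Y y ^+ 2 <= 2 * q^-1 &
    q ^- 3 / 2 <= (X y - (X y ^+ 2 + Y y ^+ 2) / q) / Y y ^+ 4 <= 2 * q ^- 3]].
  apply: near_pinfty_from; near=> y; split; [| | |split].
  - by near: y; apply: nbhs_pinfty_gt; rewrite num_real.
  - by near: y; apply: nbhs_pinfty_ge; rewrite num_real.
  - by near: y.
  - by near: y.
  - by near: y.
  - by near: y.
pose c1 := Num.sqrt (a / (4 * k)); pose C1 := Num.sqrt (4 * b / k).
have c10 : 0 < c1 by rewrite sqrtr_gt0 divr_gt0 // mulr_gt0.
have C10 : 0 < C1 by rewrite sqrtr_gt0 divr_gt0 // mulr_gt0.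
apply: (@bryant_asymptotics_of_bounds psi (q * r * (k / 2) * c1)
  (q * r * (2 * k) * C1) (r * (q^-1 / 2) * C1^-1) (r * (2 * q^-1) * c1^-1)
  (r / (2 * k) * (q ^- 3 / 2) * C1 ^- 3) (r / (k / 2) * (2 * q ^- 3) * c1 ^- 3)).
- by rewrite !mulr_gt0 // divr_gt0.
- by rewrite !mulr_gt0 ?invr_gt0.
- by rewrite !mulr_gt0 ?invr_gt0 ?exprn_gt0 // mulr_gt0.
- by rewrite !mulr_gt0.
- by rewrite !mulr_gt0 ?invr_gt0.
- by rewrite !mulr_gt0 ?invr_gt0 ?exprn_gt0 // divr_gt0.
near=> x.
have xM : xi M < x by near: x; apply: nbhs_pinfty_gt; rewrite num_real.
have x0 : 0 < x by apply: lt_trans xM.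
have [y yx] := onto x x0.
have My : M <= y.
  rewrite leNgt; apply/negP => /ltW yM; move: xM; rewrite -yx ltNge => /negP; apply.
  by apply: (deriv_ge0_le yM (fun t _ => dxi t)) => t _; exact: ltW.
have [y_gt0 yy0 /andP[x1 x2] [/andP[z1 z2] u_bd d_bd]] := hM y My.
rewrite -yx psi1E psi2E psiE; rewrite yx in x1 x2 *.
pose S := Num.sqrt x; have S0 : 0 < S by rewrite sqrtr_gt0.
have SS : S ^+ 2 = x by rewrite sqr_sqrtr // ltW.
have Yi0 : 0 < (Y y)^-1 by rewrite invr_gt0.
have cS0 : 0 < c1 * S by rewrite mulr_gt0.
have CS0 : 0 < C1 * S by rewrite mulr_gt0.
have sq1 : c1 ^+ 2 = a / (4 * k) by rewrite sqr_sqrtr // ltW // divr_gt0 // mulr_gt0.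
have sq2 : C1 ^+ 2 = 4 * b / k by rewrite sqr_sqrtr // ltW // divr_gt0 // mulr_gt0.
have Z1 : c1 * S <= (Y y)^-1.
  rewrite -(@ler_pXn2r _ 2) ?nnegrE ?(ltW cS0) ?(ltW Yi0) // exprMn SS exprVn sq1.
  apply: le_trans z1; rewrite mulrAC ler_pdivrMr ?mulr_gt0 //.
  by rewrite -mulrA ler_pM2l // mulrC.
have Z2 : (Y y)^-1 <= C1 * S.
  rewrite -(@ler_pXn2r _ 2) ?nnegrE ?(ltW CS0) ?(ltW Yi0) // exprMn SS exprVn sq2.
  apply: le_trans z2 _; rewrite mulrAC ler_pdivlMr ?mulr_gt0 //.
  have : b * (k / 4 * y) <= b * x by rewrite ler_pM2l.
  by lra.
have /andP[w1 w2] := w_bd y yy0; move: u_bd d_bd => /andP[u1 u2] /andP[d1 d2].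
have S1 : 0 <= c1 * S by rewrite mulr_ge0 // ltW.
have T1 : (C1 * S)^-1 <= Y y by rewrite -[leRHS]invrK lef_pV2 ?posrE // mulr_gt0.
have T2 : Y y <= (c1 * S)^-1.
  by rewrite -[leLHS]invrK lef_pV2 ?posrE // mulr_gt0.
have T0 : 0 <= (C1 * S)^-1 by rewrite invr_ge0 mulr_ge0 // ltW.
have qr0 : 0 <= q * r by rewrite mulr_ge0 // ltW.
have wi1 : (2 * k)^-1 <= (w y)^-1 by rewrite lef_pV2 ?posrE // mulr_gt0.
have wi2 : (w y)^-1 <= (k / 2)^-1 by rewrite lef_pV2 ?posrE // divr_gt0.
have exp3 s t : 0 <= s -> s <= t -> s ^+ 3 <= t ^+ 3 :> R.
  by move=> s0 st; rewrite ler_pXn2r // nnegrE // (le_trans s0).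
split; apply/andP; split.
- rewrite (_ : _ * S = q * r * ((k / 2) * (c1 * S))); last by ring.
  rewrite -(mulrA (q * r) (w y)); apply: ler_wpM2l => //.
  by apply: ler_pM => //; lra.
- rewrite (_ : _ * S = q * r * ((2 * k) * (C1 * S))); last by ring.
  rewrite -(mulrA (q * r) (w y)); apply: ler_wpM2l => //.
  by apply: ler_pM => //; exact: ltW.
- rewrite (_ : _ * S^-1 = r * (q^-1 / 2 * (C1 * S)^-1)); last first.
    by field; rewrite q0 !gt_eqF.
  rewrite (_ : X y / Y y = X y / Y y ^+ 2 * Y y); last by field.
  apply: ler_wpM2l; first exact: ltW.
  by apply: ler_pM => //; rewrite divr_ge0 // ltW.
- rewrite (_ : _ * S^-1 = r * (2 * q^-1 * (c1 * S)^-1)); last first.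
    by field; rewrite q0 !gt_eqF.
  rewrite (_ : X y / Y y = X y / Y y ^+ 2 * Y y); last by field.
  apply: ler_wpM2l; first exact: ltW.
  apply: ler_pM => //; last exact: ltW.
  by apply: le_trans u1; rewrite divr_ge0 // ltW.
- rewrite (_ : _ * S ^- 3 = r * ((2 * k)^-1 * (q ^- 3 / 2 * (C1 * S)^-1 ^+ 3))); last first.
    by field; rewrite q0 !gt_eqF.
  rewrite -(mulrA r (w y)^-1); apply: ler_wpM2l; first exact: ltW.
  apply: ler_pM => //.
  + by rewrite invr_ge0 mulr_ge0 // ltW.
  + by rewrite mulr_ge0 ?exprn_ge0 // divr_ge0 // ltW.
  apply: ler_pM; [|exact: exprn_ge0|exact: d1|exact: exp3].
  by rewrite divr_ge0 // ltW.
- rewrite (_ : _ * S ^- 3 = r * ((k / 2)^-1 * (2 * q ^- 3 * (c1 * S)^-1 ^+ 3))); last first.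
    by field; rewrite q0 !gt_eqF.
  have d0 : 0 <= (X y - (X y ^+ 2 + Y y ^+ 2) / q) / Y y ^+ 4.
    by apply: le_trans d1; rewrite divr_ge0 // ltW.
  rewrite -(mulrA r (w y)^-1); apply: ler_wpM2l; first exact: ltW.
  apply: ler_pM => //.
  + by rewrite invr_ge0 ltW.
  + by rewrite mulr_ge0 // exprn_ge0 // ltW.
  apply: ler_pM; [exact: d0| |exact: d2|].
    by rewrite exprn_ge0 // ltW.
  by apply: exp3 => //; exact: ltW.
Unshelve. all: by end_near. Qed.

End Bryant_asymptotics.

(** * Asymptotics at the singularity *)

Section Profile_at_zero.
Context {R : realType} {n : nat}.
Hypothesis hn : (2 <= n)%N.
Notation q := (Num.sqrt (n%:R : R)).
Notation r := (Num.sqrt (n%:R - 1 : R)).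
Variables X Y xi eta : R -> R.
Hypothesis sXY : solves_XY n X Y.
Hypothesis disc : forall y, X y ^+ 2 + Y y ^+ 2 < 1.
Hypothesis Ypos : forall y, 0 < Y y.
Hypothesis ray : X 0 = 2 * Y 0.
Hypothesis hxi : clock X Y xi.
Hypothesis heta : forall x, 0 < x -> xi (eta x) = x.

Let W := speed X Y.
Let c := X 0 ^+ 2 / 2.
Let delta y := 2 * expR (c * y).

Let c0 : 0 < c.
Proof. by rewrite divr_gt0 // exprn_gt0 // ray mulr_gt0. Qed.
Let xi0 y : 0 < xi y. Proof. by have [_ h _ _] := hxi. Qed.
Let dxi (y : R) : is_derive y 1 xi (W y). Proof. by have [h] := hxi. Qed.
Let W0 y : 0 < W y. Proof. exact: (speed_gt0 disc). Qed.
Let qpos : 0 < q. Proof. exact: (q_gt0 hn). Qed.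

(** W' = X^2 xi', where X^2 is exponentially close to 1. *)
Lemma speed_clock_ratio y : y <= 0 -> 1 - delta y <= W y / xi y <= 1.
Proof.
move=> y0; rewrite ler_pdivrMr // mul1r (clock_upper hn sXY disc Ypos ray hxi).
rewrite andbT ler_pdivlMr //.
have [d0|/ltW d0] := leP 0 (1 - delta y); last first.
  by apply: le_trans (ltW (W0 y)); rewrite mulr_le0_ge0 // ltW.
apply: (clock_lower sXY disc hxi d0) => z zy.
have := ray_defect hn sXY disc Ypos ray (le_trans zy y0).
have : expR (c * z) <= expR (c * y) by rewrite ler_expR ler_pM2l.
by rewrite /delta -/c; lra.
Qed.

Let X_bounds y : y <= 0 -> 1 - delta y <= X y <= 1.
Proof.
move=> y0; have := ray_defect hn sXY disc Ypos ray y0; rewrite -/c -/(delta y).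
have := ray_X_pos hn sXY disc Ypos ray y; have := disc y; have := sqr_ge0 (Y y).
by move=> h1 h2 h3 h4; apply/andP; split; nra.
Qed.

Lemma inverse_clock_cvg : eta x @[x --> 0^'+] --> -oo.
Proof.
apply/cvgrNyPle => M; near=> x.
have x0 : 0 < x by near: x; exact: nbhs_right_gt.
have xM : x < xi M by near: x; apply: nbhs_right_lt; exact: xi0.
rewrite leNgt; apply/negP => /(clock_lt disc hxi); rewrite heta //.
by move=> /(lt_trans xM); rewrite ltxx.
Unshelve. all: by end_near. Qed.

Let ratio_cvg : W y / xi y @[y --> -oo] --> (1 : R).
Proof.
apply: (cvg_exp_decay c0 (C := 2)) => y /speed_clock_ratio/andP[h1 h2].
by rewrite ler_norml -/(delta y); apply/andP; split; lra.
Qed.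

Let X_cvg : X y @[y --> -oo] --> (1 : R).
Proof. by have [] := ray_singular hn sXY disc Ypos ray. Qed.

Lemma potential_equiv :
  equiv_at_0 (derive1 (potential (n := n) X Y eta)) (fun x => (q - 1) / x).
Proof.
have q1 : q - 1 != 0 by rewrite subr_eq0 gt_eqF // (q_gt1 hn).
have lim : (q * X y - 1) / (q - 1) * (W y / xi y)^-1 @[y --> -oo] --> (1 : R).
  apply: lim_eq.
    apply: lim_mul (lim_inv _ ratio_cvg); last exact: oner_neq0.
    apply: lim_mul (lim_cst _); apply: lim_sub (lim_cst _).
    exact: lim_mul (lim_cst _) X_cvg.
  by rewrite mulr1 divff // invr1 mulr1.
have := cvg_comp _ _ inverse_clock_cvg lim; apply: cvg_trans.
apply: near_eq_cvg; near=> x.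
have x0 : 0 < x by near: x; exact: nbhs_right_gt.
rewrite /= (derive1_potential hn sXY disc Ypos hxi heta x0) heta // -/W.
by field; rewrite q1 !gt_eqF.
Unshelve. all: by end_near. Qed.

(** The logarithm of psi / x^(1/sqrt n) has, as a function of y, an exponentially
    small derivative, hence a limit. *)
Let h y := ln (q * r * W y / Y y) - q^-1 * ln (xi y).

Let dh (y : R) : is_derive y 1 h (q^-1 * (X y - W y / xi y)).
Proof.
have [dX dY] := sXY y.
have qr0 : 0 < q * r by rewrite mulr_gt0 // (r_gt0 hn).
have p0 : 0 < q * r * W y / Y y by rewrite divr_gt0 // mulr_gt0.
have Yn : Y y != 0 by rewrite gt_eqF.
have dp := isd_mul (isd_mul (isd_cst y 1 (q * r)) (deriv_speed sXY disc y))
  (isd_inv Yn dY).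
have h1 := @isd_ln _ (fun y => q * r * W y / Y y) y _ p0 dp.
have h2 := @isd_ln _ xi y _ (xi0 y) (dxi y).
have h3 := isd_add h1 (isd_opp (isd_mul (isd_cst y 1 q^-1) h2)).
apply: (is_derive_eq h3); cbv beta; rewrite -/W.
by field; rewrite Yn !gt_eqF // (r_gt0 hn).
Qed.

Let dh_bound y : y <= 0 -> `|q^-1 * (X y - W y / xi y)| <= 2 * expR (c * y).
Proof.
move=> y0; have /andP[a1 a2] := X_bounds y0.
have /andP[b1 b2] := speed_clock_ratio y0.
rewrite normrM; have /andP[q1 q2] := q_inv_le1 (R := R) hn.
have h1 : `|X y - W y / xi y| <= delta y.
  by rewrite ler_norml; apply/andP; split; lra.
rewrite -/(delta y) (ger0_norm (ltW q1)); apply: le_trans h1.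
by rewrite ler_piMl.
Qed.

Let h_limit : exists l, forall y, y <= 0 -> `|h y - l| <= 2 / c * expR (c * y).
Proof.
pose A y := h y + 2 / c * expR (c * y).
pose B y := h y - 2 / c * expR (c * y).
have dE (y : R) : is_derive y 1 (fun y => 2 / c * expR (c * y)) (2 * expR (c * y)).
  by derive_by; field; rewrite gt_eqF.
have Amono y z : y <= z -> z <= 0 -> A y <= A z.
  move=> yz z0; apply: (@deriv_ge0_le _ A
    (fun y => q^-1 * (X y - W y / xi y) + 2 * expR (c * y))) => // [t _|t].
    exact: isd_add (dh t) (dE t).
  move=> /andP[_ /ltW tz]; have := dh_bound (le_trans tz z0).
  by rewrite ler_norml => /andP[? _]; lra.
have Bmono y z : y <= z -> z <= 0 -> B z <= B y.
  move=> yz z0; apply: (@deriv_le0_ge _ B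
    (fun y => q^-1 * (X y - W y / xi y) - 2 * expR (c * y))) => // [t _|t].
    exact: isd_add (dh t) (isd_opp (dE t)).
  move=> /andP[_ /ltW tz]; have := dh_bound (le_trans tz z0).
  by rewrite ler_norml => /andP[_ ?]; lra.
have BA y : B y <= A y.
  rewrite /A /B; have : 0 <= 2 / c * expR (c * y).
    by rewrite mulr_ge0 ?expR_ge0 // divr_ge0 // ltW.
  by lra.
have BA2 y z : y <= 0 -> z <= 0 -> B y <= A z.
  move=> y0 z0; have [yz|/ltW zy] := leP y z.
    exact: le_trans (BA y) (Amono _ _ yz z0).
  exact: le_trans (Bmono _ _ zy y0) (BA z).
pose S := [set B y | y in [set y | y <= 0]].
exists (sup S) => y y0.
have h1 : B y <= sup S.
  apply: ub_le_sup; last by exists y.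
  by exists (A 0) => _ [z z0 <-]; exact: BA2.
have h2 : sup S <= A y.
  by apply: ge_sup; [exists (B 0); exists 0 => //= | move=> _ [z z0 <-]; exact: BA2].
by rewrite /A /B in h1 h2; rewrite ler_norml; apply/andP; split; lra.
Qed.

Lemma profile_equiv : exists2 a, 0 < a &
  equiv_at_0 (profile (n := n) X Y eta) (fun x => a * x `^ q^-1).
Proof.
have [l hl] := h_limit.
exists (expR l); first exact: expR_gt0.
have ch : h y @[y --> -oo] --> l by exact: (cvg_exp_decay c0 hl).
have lim : expR (h y - l) @[y --> -oo] --> (1 : R).
  rewrite -(@expR0 R) -(subrr l).
  by apply: continuous_cvg; [exact: continuous_expR|exact: lim_sub ch (lim_cst l)].
have := cvg_comp _ _ inverse_clock_cvg lim; apply: cvg_trans.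
apply: near_eq_cvg; near=> x.
have x0 : 0 < x by near: x; exact: nbhs_right_gt.
have p0 : 0 < profile (n := n) X Y eta x by exact: (profile_gt0 hn eta disc Ypos).
rewrite /= /h heta // {1}/powR gt_eqF // expRB expRB.
have -> : q * r * W (eta x) / Y (eta x) = profile (n := n) X Y eta x.
  by rewrite /profile sqrt_nn1.
rewrite lnK ?posrE // invfM mulrA mulrAC.
by [].
Unshelve. all: by end_near. Qed.

Theorem ray_singular_profile : singular_profile n (profile (n := n) X Y eta)
  (potential (n := n) X Y eta).
Proof. by split; [exact: profile_equiv | exact: potential_equiv]. Qed.

End Profile_at_zero.

(** * The one-parameter family *)

Section Heights.
Context {R : realType}.

(** A bijection from the line onto the admissible heights Y < 1/sqrt 5 on the
    ray X = 2Y inside the unit disc. *)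
Definition height (s : R) : R := (Num.sqrt (5 + expR s))^-1.

Let rad_gt0 (s : R) : 0 < 5 + expR s.
Proof. by rewrite addr_gt0 ?expR_gt0. Qed.

Lemma height_gt0 s : 0 < height s.
Proof. by rewrite invr_gt0 sqrtr_gt0. Qed.

Lemma sqr_height s : height s ^+ 2 = (5 + expR s)^-1.
Proof. by rewrite exprVn sqr_sqrtr // ltW. Qed.

Lemma height_disc s : 5 * height s ^+ 2 < 1.
Proof.
by rewrite sqr_height ltr_pdivrMr // mul1r ltrDl expR_gt0.
Qed.

Lemma height_inj : injective height.
Proof.
move=> s t e; have : height s ^+ 2 = height t ^+ 2 by rewrite e.
by rewrite !sqr_height => /invr_inj /addrI /expR_inj.
Qed.

Lemma height_onto k : 0 < k -> 5 * k ^+ 2 < 1 -> exists s, height s = k.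
Proof.
move=> k0 k1; exists (ln (k ^- 2 - 5)).
have k2 : 0 < k ^+ 2 by rewrite exprn_gt0.
have h : 0 < k ^- 2 - 5 by rewrite subr_gt0 -[ltRHS]mul1r ltr_pdivlMr.
rewrite /height lnK ?posrE // addrC subrK sqrtrV ?(ltW k2) // sqrtr_sqr.
by rewrite invrK gtr0_norm.
Qed.

Lemma height_continuous : continuous height.
Proof.
move=> s; have dr : is_derive s 1 (fun s => 5 + expR s) (expR s).
  by derive_by; ring.
have ds := @isd_sqrt _ (fun s => 5 + expR s) s _ (rad_gt0 s) dr.
have n0 : Num.sqrt (5 + expR s) != 0 by rewrite gt_eqF // sqrtr_gt0.
exact: isd_continuous (@isd_inv R _ (fun s => Num.sqrt (5 + expR s)) s _ _ n0 ds).
Qed.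

End Heights.

Section Family.
Context {R : realType} {n : nat}.
Hypothesis hn : (2 <= n)%N.

(** One trajectory for every parameter, started on the ray X = 2Y at y = 0, with
    its clock and the inverse of the clock. *)
Definition ray_family (FX FY xi eta : R -> R -> R) : Prop := forall s,
  [/\ solves_XY n (FX s) (FY s),
      (forall y, FX s y ^+ 2 + FY s y ^+ 2 < 1),
      FX s 0 = 2 * height s /\ FY s 0 = height s,
      clock (FX s) (FY s) (xi s) &
      forall x, 0 < x -> xi s (eta s x) = x].

Lemma ray_family_exists : exists FX FY xi eta, ray_family FX FY xi eta.
Proof.
have : forall s : R, exists F : ((R -> R) * (R -> R)) * ((R -> R) * (R -> R)),
  [/\ solves_XY n F.1.1 F.1.2,
      (forall y, F.1.1 y ^+ 2 + F.1.2 y ^+ 2 < 1),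
      F.1.1 0 = 2 * height s /\ F.1.2 0 = height s,
      clock F.1.1 F.1.2 F.2.1 &
      forall x, 0 < x -> F.2.1 (F.2.2 x) = x].
  move=> s; have d0 : (2 * height s) ^+ 2 + height s ^+ 2 < 1.
    by have := height_disc s; rewrite exprMn; lra.
  have [X [Y [X0 Y0 sXY dXY]]] := flow_in_disc hn d0.
  have Ypos : forall y, 0 < Y y.
    by apply: (Y_pos hn sXY dXY); rewrite Y0 height_gt0.
  have ray : X 0 = 2 * Y 0 by rewrite X0 Y0.
  have [xi hxi] := clock_exists hn sXY dXY Ypos ray.
  have : forall x, exists y, 0 < x -> xi y = x.
    move=> x; have [x0|x0] := pselect (0 < x); last by exists 0.
    by have [_ _ /(_ x x0)[y hy] _] := hxi; exists y.
  by move=> /choice[eta heta]; exists ((X, Y), (xi, eta)); split.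
move=> /choice[F hF].
by exists (fun s => (F s).1.1), (fun s => (F s).1.2), (fun s => (F s).2.1),
  (fun s => (F s).2.2) => s; have [] := hF s.
Qed.

Variables FX FY xi eta : R -> R -> R.
Hypothesis hF : ray_family FX FY xi eta.

Let sXY s : solves_XY n (FX s) (FY s). Proof. by have [] := hF s. Qed.
Let disc s : forall y, FX s y ^+ 2 + FY s y ^+ 2 < 1.
Proof. by have [] := hF s. Qed.
Let FX0 s : FX s 0 = 2 * height s. Proof. by have [_ _ []] := hF s. Qed.
Let FY0 s : FY s 0 = height s. Proof. by have [_ _ []] := hF s. Qed.
Let hxi s : clock (FX s) (FY s) (xi s). Proof. by have [] := hF s. Qed.
Let heta s : forall x, 0 < x -> xi s (eta s x) = x.
Proof. by have [] := hF s. Qed.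
Let Ypos s : forall y, 0 < FY s y.
Proof. by apply: (Y_pos hn (@sXY s) (@disc s)); rewrite FY0 height_gt0. Qed.
Let ray s : FX s 0 = 2 * FY s 0. Proof. by rewrite FX0 FY0. Qed.

Notation W s := (speed (FX s) (FY s)).

Let W_gt0 s y : 0 < W s y. Proof. exact: (speed_gt0 (@disc s)). Qed.
Let dxi s (y : R) : is_derive y 1 (xi s) (W s y). Proof. by have [h] := hxi s. Qed.
Let xi_gt0 s y : 0 < xi s y. Proof. by have [_ h] := hxi s. Qed.

(** * Continuous dependence on the parameter *)

Lemma flow_close s0 M e : 0 < e -> \forall s \near s0, forall y, `|y| <= M ->
  `|FX s y - FX s0 y| <= e /\ `|FY s y - FY s0 y| <= e.
Proof.
move=> e0; pose d := e / (3 * expR (12 * M)).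
have d0 : 0 < d by rewrite divr_gt0 // mulr_gt0 // expR_gt0.
have := @height_continuous R s0 => /cvgrPdist_le/(_ d d0); apply: filterS.
move=> s hs y yM.
have := disc_dependence hn (@sXY s) (@sXY s0) (@disc s) (@disc s0) y.
rewrite !FX0 !FY0; set D := (_ ^+ 2 + _ ^+ 2); set D0 := (_ ^+ 2 + _ ^+ 2).
move=> hD.
have D0E : D0 = 5 * (height s0 - height s) ^+ 2 by rewrite /D0; ring.
have hd2 : (height s0 - height s) ^+ 2 <= d ^+ 2.
  by rewrite -[leLHS]real_normK ?num_real // ler_pXn2r // nnegrE // ltW.
have E1 : expR (24 * `|y|) <= expR (12 * M) ^+ 2.
  by rewrite -expRM_natl ler_expR; lra.
have de : d * (3 * expR (12 * M)) = e.
  by rewrite /d divfK // gt_eqF // mulr_gt0 // expR_gt0.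
have De : D <= e ^+ 2.
  apply: le_trans hD _; rewrite D0E -de.
  apply: (@le_trans _ _ (5 * d ^+ 2 * expR (12 * M) ^+ 2)); last first.
    have : 0 <= d ^+ 2 * expR (12 * M) ^+ 2 by rewrite mulr_ge0 ?sqr_ge0.
    by rewrite !exprMn; lra.
  apply: ler_pM; [by rewrite mulr_ge0 ?sqr_ge0|exact: expR_ge0| |exact: E1].
  by rewrite ler_pM2l.
have sq x : x ^+ 2 <= D -> `|x| <= e.
  move=> hx; rewrite -(@ler_pXn2r _ 2) ?nnegrE ?(ltW e0) //.
  by rewrite real_normK ?num_real //; exact: le_trans De.
by split; apply: sq; rewrite /D ?lerDl ?lerDr sqr_ge0.
Qed.

Let sqrt_close (a b : R) : 0 <= a -> 0 <= b ->
  (Num.sqrt a - Num.sqrt b) ^+ 2 <= `|a - b|.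
Proof.
move=> a0 b0; have ha := sqr_sqrtr a0; have hb := sqr_sqrtr b0.
have := sqrtr_ge0 a; have := sqrtr_ge0 b; rewrite -{3}ha -{3}hb.
move: (Num.sqrt a) (Num.sqrt b) => x y y0 x0.
have [xy|/ltW yx] := leP x y.
  by rewrite ler0_norm; nra.
by rewrite ger0_norm; nra.
Qed.

Let disc_abs s y : `|FX s y| <= 1 /\ `|FY s y| <= 1.
Proof. by have := @disc s y; rewrite !ler_norml => h; split; nra. Qed.

Lemma speed_close s0 M e : 0 < e -> \forall s \near s0, forall y, `|y| <= M ->
  `|W s y - W s0 y| <= e.
Proof.
move=> e0; have e4 : 0 < e ^+ 2 / 4 by rewrite divr_gt0 // exprn_gt0.
have := flow_close s0 M e4; apply: filterS => s hs y /hs[hX hY].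
rewrite -(@ler_pXn2r _ 2) ?nnegrE ?(ltW e0) // real_normK ?num_real //.
have pos t : 0 <= 1 - FX t y ^+ 2 - FY t y ^+ 2 by have := @disc t y; lra.
apply: le_trans (sqrt_close (pos s) (pos s0)) _.
have -> : 1 - FX s y ^+ 2 - FY s y ^+ 2 - (1 - FX s0 y ^+ 2 - FY s0 y ^+ 2) =
  - ((FX s y - FX s0 y) * (FX s y + FX s0 y)) - (FY s y - FY s0 y) * (FY s y + FY s0 y).
  by ring.
have [a1 a2] := disc_abs s y; have [b1 b2] := disc_abs s0 y.
have prod x z : `|x| <= e ^+ 2 / 4 -> `|z| <= 2 -> `|x * z| <= e ^+ 2 / 2.
  move=> hx hz; rewrite normrM (_ : e ^+ 2 / 2 = e ^+ 2 / 4 * 2); last by field.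
  by apply: ler_pM.
have h1 : `|FX s y + FX s0 y| <= 2 by apply: le_trans (ler_normD _ _) _; lra.
have h2 : `|FY s y + FY s0 y| <= 2 by apply: le_trans (ler_normD _ _) _; lra.
apply: le_trans (ler_normB _ _) _; rewrite normrN.
by have := prod _ _ hX h1; have := prod _ _ hY h2; lra.
Qed.

(** The clock counts from y = -oo; its tails are exponentially small, uniformly
    for nearby parameters. *)
Let clock_tail s y : y <= 0 ->
  (4 * height s ^+ 2 * xi s y) ^+ 2 <= 2 * expR (2 * height s ^+ 2 * y).
Proof.
move=> y0; have c4 : FX s 0 ^+ 2 = 4 * height s ^+ 2 by rewrite FX0 exprMn; ring.
have h1 : 4 * height s ^+ 2 * xi s y <= W s y.
  rewrite -c4; apply: (clock_lower (@sXY s) (@disc s) (hxi s)); first exact: sqr_ge0.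
  by move=> z zy; apply: (ray_sqrX_ge hn (@sXY s) (@disc s) (@Ypos s) (ray s));
    exact: le_trans y0.
have h2 := ray_defect hn (@sXY s) (@disc s) (@Ypos s) (ray s) y0.
rewrite (_ : 2 * height s ^+ 2 = FX s 0 ^+ 2 / 2); last by rewrite c4; field.
apply: le_trans h2; apply: (@le_trans _ _ (W s y ^+ 2)).
  rewrite ler_pXn2r // nnegrE ?(ltW (W_gt0 _ _)) //.
  by rewrite mulr_ge0 ?(ltW (xi_gt0 _ _)) // mulr_ge0 ?sqr_ge0.
by rewrite (sqr_speed (@disc s)); have := sqr_ge0 (FY s y); lra.
Qed.

Lemma clock_continuous_param y s0 : xi s y @[s --> s0] --> xi s0 y.
Proof.
apply/cvgrPdist_le => /= e e0.
pose d := height s0 ^+ 2 / 4.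
have d0 : 0 < d by rewrite divr_gt0 // exprn_gt0 // height_gt0.
pose e3 := e / 3; have e30 : 0 < e3 by rewrite divr_gt0.
pose T := Num.max `|y| (1 / (16 * d ^+ 3 * e3 ^+ 2)).
have Tpos : 0 < T.
  by rewrite /T lt_max; apply/orP; right; rewrite divr_gt0 // mulr_gt0 ?exprn_gt0 // mulr_gt0 ?exprn_gt0.
have T0 : 0 <= T by exact: ltW.
have yT : `|y| <= T by rewrite /T le_max lexx.
have tail s : height s0 / 2 <= height s -> `|xi s (- T)| <= e3.
  move=> hs; rewrite ger0_norm ?(ltW (xi_gt0 _ _)) //.
  have hd : d <= height s ^+ 2.
    have := height_gt0 s0; rewrite /d; move: (height s0) (height s) hs => a b.
    by move=> h1 h2; nra.
  have T0' : - T <= 0 by rewrite oppr_le0.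
  have := clock_tail s T0'; set x := xi s (- T) => hx.
  have x0 : 0 < x by exact: xi_gt0.
  have h1 : (4 * d * x) ^+ 2 <= (4 * height s ^+ 2 * x) ^+ 2.
    have h0 : 0 <= 4 * d * x by rewrite mulr_ge0 ?(ltW x0) // mulr_ge0 // ltW.
    have h01 : 4 * d * x <= 4 * height s ^+ 2 * x by rewrite ler_pM2r // ler_pM2l.
    by rewrite ler_pXn2r ?nnegrE // (le_trans h0).
  have h2 : expR (2 * height s ^+ 2 * - T) <= expR (- (2 * d * T)).
    by rewrite ler_expR mulrN lerN2 ler_wpM2r // ler_pM2l.
  have h3 : expR (- (2 * d * T)) <= (2 * d * T)^-1.
    have Tp : 0 < 2 * d * T by apply: mulr_gt0 => //; exact: mulr_gt0.
    rewrite expRN lef_pV2 ?posrE ?expR_gt0 //.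
    by have := expR_ge1Dx (2 * d * T); lra.
  have h4 : (2 * d * T)^-1 <= 8 * d ^+ 2 * e3 ^+ 2.
    have TT : 1 / (16 * d ^+ 3 * e3 ^+ 2) <= T by rewrite /T le_max lexx orbT.
    have p0 : 0 < 16 * d ^+ 3 * e3 ^+ 2 by rewrite mulr_gt0 ?exprn_gt0 // mulr_gt0 ?exprn_gt0.
    rewrite ler_pdivrMr // in TT.
    have q0 : 0 < 2 * d * T by apply: mulr_gt0 => //; exact: mulr_gt0.
    rewrite -div1r ler_pdivrMr //.
    by rewrite (_ : _ * (2 * d * T) = T * (16 * d ^+ 3 * e3 ^+ 2)) //; ring.
  have h5 : (4 * d) ^+ 2 * x ^+ 2 <= (4 * d) ^+ 2 * e3 ^+ 2.
    by rewrite -exprMn exprMn; rewrite exprMn in h1; lra.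
  rewrite ler_pM2l in h5; last by rewrite exprn_gt0 // mulr_gt0.
  by rewrite -(@ler_pXn2r _ 2) ?nnegrE ?(ltW x0) ?(ltW e30).
pose e1 := e3 / (2 * T + 1).
have e10 : 0 < e1 by rewrite divr_gt0 //; lra.
near=> s.
have hs : height s0 / 2 <= height s.
  near: s; apply: (cvgr_ge (height s0)); first exact: height_continuous.
  by have := height_gt0 s0; lra.
have hW : forall z, `|z| <= T -> `|W s z - W s0 z| <= e1.
  by near: s; exact: speed_close.
have t1 := tail s hs.
have t2 : `|xi s0 (- T)| <= e3 by apply: tail; have := height_gt0 s0; lra.
have [yl yr] : - T <= y /\ y <= T by have := yT; rewrite ler_norml => /andP.
pose D z := xi s z - xi s0 z.
have dD (z : R) : is_derive z 1 D (W s z - W s0 z).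
  exact: isd_add (dxi s z) (isd_opp (dxi s0 z)).
have b1 : D y - e1 * y <= D (- T) - e1 * - T.
  apply: (@deriv_le0_ge _ (fun z => D z - e1 * z) (fun z => W s z - W s0 z - e1)
    _ _ yl) => z.
    by move=> _; derive_by; ring.
  move=> /andP[z1 z2]; have := hW z; rewrite !ler_norml (ltW z1) (le_trans (ltW z2) yr).
  by move=> /(_ isT)/andP[_ ?]; lra.
have b2 : D (- T) + e1 * - T <= D y + e1 * y.
  apply: (@deriv_ge0_le _ (fun z => D z + e1 * z) (fun z => W s z - W s0 z + e1)
    _ _ yl) => z.
    by move=> _; derive_by; ring.
  move=> /andP[z1 z2]; have := hW z; rewrite !ler_norml (ltW z1) (le_trans (ltW z2) yr).
  by move=> /(_ isT)/andP[? _]; lra.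
have b3 : e1 * (y + T) <= e3.
  apply: (@le_trans _ _ (e1 * (2 * T + 1))).
    by rewrite ler_pM2l //; lra.
  by rewrite /e1 divfK // gt_eqF //; lra.
move: t1 t2; rewrite !ler_norml => /andP[? ?] /andP[? ?].
rewrite /D in b1 b2; have eE : e = 3 * e3 by rewrite /e3; field.
clearbody e1; rewrite eE; clear eE; clearbody e3.
by apply/andP; split; lra.
Unshelve. all: by end_near. Qed.

(** A strictly increasing function of y that depends continuously on s has an
    inverse that is continuous in both variables. *)
Lemma inverse_clock_continuous (s0 x0 : R) : 0 < x0 ->
  (fun p : R * R => eta p.1 p.2) @ (s0, x0) --> eta s0 x0.
Proof.
move=> x00; apply/cvgrPdist_le => /= e e0.
set y0 := eta s0 x0.
have hl : xi s0 (y0 - e) < x0.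
  by rewrite -(heta s0 x00); apply: (clock_lt (@disc s0) (hxi s0)); rewrite ltrBlDr ltrDl.
have hr : x0 < xi s0 (y0 + e).
  by rewrite -{1}(heta s0 x00); apply: (clock_lt (@disc s0) (hxi s0)); rewrite ltrDl.
pose m1 := (xi s0 (y0 - e) + x0) / 2; pose m2 := (xi s0 (y0 + e) + x0) / 2.
have near_s : \forall s \near s0, xi s (y0 - e) < m1 /\ m2 < xi s (y0 + e).
  near=> s; split; near: s.
    by apply: (cvgr_lt (xi s0 (y0 - e))); [exact: clock_continuous_param|rewrite /m1; lra].
  by apply: (cvgr_gt (xi s0 (y0 + e))); [exact: clock_continuous_param|rewrite /m2; lra].
have near_x : \forall x \near x0, [/\ 0 < x, m1 < x & x < m2].
  near=> x; split; near: x.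
  - exact: lt_nbhsr.
  - by apply: lt_nbhsr; rewrite /m1; lra.
  - by apply: lt_nbhsl; rewrite /m2; lra.
have : \forall p \near (s0, x0), (xi p.1 (y0 - e) < m1 /\ m2 < xi p.1 (y0 + e)) /\
    [/\ 0 < p.2, m1 < p.2 & p.2 < m2].
  by exists ([set s | xi s (y0 - e) < m1 /\ m2 < xi s (y0 + e)],
    [set x | [/\ 0 < x, m1 < x & x < m2]]).
apply: filterS => -[s x] /= [[h1 h2] [xpos h3 h4]].
have lt1 : xi s (y0 - e) < x by exact: lt_trans h3.
have lt2 : x < xi s (y0 + e) by exact: lt_trans h2.
have g1 : y0 - e <= eta s x.
  rewrite leNgt; apply/negP => /(clock_lt (@disc s) (hxi s)); rewrite heta // ltNge.
  by rewrite ltW.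
have g2 : eta s x <= y0 + e.
  rewrite leNgt; apply/negP => /(clock_lt (@disc s) (hxi s)); rewrite heta // ltNge.
  by rewrite ltW.
by rewrite ler_norml; apply/andP; split; lra.
Unshelve. all: by end_near. Qed.

Let flow_continuous (s0 y0 : R) :
  (fun p : R * R => FX p.1 p.2) @ (s0, y0) --> FX s0 y0 /\
  (fun p : R * R => FY p.1 p.2) @ (s0, y0) --> FY s0 y0.
Proof.
have joint (G : R -> R -> R) : (forall M e, 0 < e ->
      \forall s \near s0, forall y, `|y| <= M -> `|G s y - G s0 y| <= e) ->
    {for y0, continuous (G s0)} -> 
    (fun p : R * R => G p.1 p.2) @ (s0, y0) --> G s0 y0.
  move=> hG cG; apply/cvgrPdist_le => /= e e0.
  have e2 : 0 < e / 2 by rewrite divr_gt0.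
  have near_y : \forall y \near y0, `|y| <= `|y0| + 1 /\ `|G s0 y0 - G s0 y| <= e / 2.
    near=> y; split.
      rewrite -lerBlDl; apply: le_trans (lerB_dist _ _) _.
      by rewrite distrC; near: y; apply: cvgr_dist_le => //; exact: cvg_id.
    by near: y; apply: cvgr_dist_le.
  have : \forall p \near (s0, y0), (forall y, `|y| <= `|y0| + 1 ->
      `|G p.1 y - G s0 y| <= e / 2) /\
      (`|p.2| <= `|y0| + 1 /\ `|G s0 y0 - G s0 p.2| <= e / 2).
    by exists ([set s | forall y, `|y| <= `|y0| + 1 -> `|G s y - G s0 y| <= e / 2],
      [set y | `|y| <= `|y0| + 1 /\ `|G s0 y0 - G s0 y| <= e / 2]);
      [split => /=; [exact: hG|exact: near_y] | case=> s y /= [h1 h2]].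
  apply: filterS => -[s y] /= [h1 [h2 h3]]; have := h1 y h2; move: h3.
  by rewrite !ler_norml => /andP[? ?] /andP[? ?]; apply/andP; split; lra.
split; apply: joint.
- move=> M e e0; have := flow_close s0 M e0.
  by apply: filterS => s h y /h[].
- by have [d _] := @sXY s0 y0; exact: isd_continuous d.
- move=> M e e0; have := flow_close s0 M e0.
  by apply: filterS => s h y /h[].
- by have [_ d] := @sXY s0 y0; exact: isd_continuous d.
Unshelve. all: by end_near. Qed.

Let along_eta (G : R -> R -> R) (s0 x0 : R) : 0 < x0 ->
  (fun p : R * R => G p.1 p.2) @ (s0, eta s0 x0) --> G s0 (eta s0 x0) ->
  (fun p : R * R => G p.1 (eta p.1 p.2)) @ (s0, x0) --> G s0 (eta s0 x0).
Proof.
move=> x00 cG; apply: (@continuous2_cvg _ _ _ _ (nbhs (s0, x0)) _ fst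
  (fun p : R * R => eta p.1 p.2) G s0 (eta s0 x0) cG); first exact: cvg_fst.
exact: inverse_clock_continuous.
Qed.

Let W_continuous (s0 y0 : R) : (fun p : R * R => W p.1 p.2) @ (s0, y0) --> W s0 y0.
Proof.
have [cX cY] := flow_continuous s0 y0.
apply: (continuous_cvg _ (sqrt_continuous (x := _))).
exact: lim_sub (lim_sub (lim_cst 1) (lim_mul cX cX)) (lim_mul cY cY).
Qed.

Lemma family_continuous (s0 x0 : R) : 0 < x0 ->
  ((fun p : R * R => profile (n := n) (FX p.1) (FY p.1) (eta p.1) p.2) @ (s0, x0) -->
     profile (n := n) (FX s0) (FY s0) (eta s0) x0) /\
  ((fun p : R * R => derive1 (potential (n := n) (FX p.1) (FY p.1) (eta p.1)) p.2)
     @ (s0, x0) -->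
     derive1 (potential (n := n) (FX s0) (FY s0) (eta s0)) x0).
Proof.
move=> x00; set y0 := eta s0 x0.
have [cX cY] := flow_continuous s0 y0; have cW := @W_continuous s0 y0.
have aX := @along_eta FX s0 x0 x00 cX.
have aY := @along_eta FY s0 x0 x00 cY.
have aW := @along_eta (fun s y => W s y) s0 x0 x00 cW.
have Y0 : FY s0 y0 != 0 by rewrite gt_eqF // Ypos.
have W0 : W s0 y0 != 0 by rewrite gt_eqF.
split.
  rewrite /profile; exact: lim_mul (lim_mul (lim_cst _) aW) (lim_inv Y0 aY).
have dE s x : 0 < x -> derive1 (potential (n := n) (FX s) (FY s) (eta s)) x =
    (Num.sqrt n%:R * FX s (eta s x) - 1) / W s (eta s x).
  exact: (derive1_potential hn (@sXY s) (@disc s) (@Ypos s) (hxi s) (@heta s)).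
rewrite dE //.
have lim : (fun p : R * R =>
    (Num.sqrt n%:R * FX p.1 (eta p.1 p.2) - 1) / W p.1 (eta p.1 p.2)) @ (s0, x0) -->
    (Num.sqrt n%:R * FX s0 (eta s0 x0) - 1) / W s0 (eta s0 x0).
  exact: lim_mul (lim_sub (lim_mul (lim_cst _) aX) (lim_cst 1)) (lim_inv W0 aW).
apply: cvg_trans lim; apply: near_eq_cvg.
have : \forall p \near (s0, x0), 0 < p.2.
  exact: (cvg_snd (F := nbhs s0) (G := nbhs x0) (lt_nbhsr x00)).
by apply: filterS => -[s x] /= xpos; rewrite dE.
Qed.

(** * Classification of the singular trajectories *)

Lemma family_soliton s :
  steady_soliton n (profile (n := n) (FX s) (FY s) (eta s))
    (potential (n := n) (FX s) (FY s) (eta s)).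
Proof.
have ps : smooth_on_pos (profile (n := n) (FX s) (FY s) (eta s)).
  exact: (profile_smooth hn (@sXY s) (@disc s) (@Ypos s) (hxi s) (@heta s)).
have fs : smooth_on_pos (potential (n := n) (FX s) (FY s) (eta s)).
  exact: (potential_smooth hn (@sXY s) (@disc s) (@Ypos s) (hxi s) (@heta s)).
have pp x : 0 < profile (n := n) (FX s) (FY s) (eta s) x.
  exact: (profile_gt0 hn _ (@disc s) (@Ypos s)).
split=> // b p p0 i j.
apply: (steady_soliton_warped b (fun x _ => pp x) ps fs) => //.
- exact: (soliton_radial hn (@sXY s) (@disc s) (@Ypos s) (hxi s) (@heta s)).
- exact: (soliton_spherical hn (@sXY s) (@disc s) (@Ypos s) (hxi s) (@heta s)).
Qed.

Lemma family_corresponds s X1 Y1 :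
  corresponds n (profile (n := n) (FX s) (FY s) (eta s))
    (potential (n := n) (FX s) (FY s) (eta s)) X1 Y1 <->
  exists t, forall y, X1 y = FX s (y + t) /\ Y1 y = FY s (y + t).
Proof.
exact: (corresponds_trajectory hn (@sXY s) (@disc s) (@Ypos s) (hxi s) (@heta s)).
Qed.

Lemma family_singular s : singular_trajectory n (FX s) (FY s).
Proof. exact: (ray_singular hn (@sXY s) (@disc s) (@Ypos s) (ray s)). Qed.

Lemma family_profile s :
  singular_profile n (profile (n := n) (FX s) (FY s) (eta s))
    (potential (n := n) (FX s) (FY s) (eta s)).
Proof.
exact: (ray_singular_profile hn (@sXY s) (@disc s) (@Ypos s) (ray s) (hxi s) (@heta s)).
Qed.

Lemma family_bryant s :
  bryant_asymptotics (profile (n := n) (FX s) (FY s) (eta s)).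
Proof.
have [ps _ pp _] := family_soliton s.
have [cX cY] := ray_cvgy hn (@sXY s) (@disc s) (@Ypos s) (ray s).
apply: (bryant_of_corresponds hn ps pp (@sXY s) cX cY).
by apply/family_corresponds; exists 0 => y; rewrite addr0.
Qed.

(** A singular trajectory crosses the ray X = 2Y exactly once; the height of the
    crossing is its parameter. *)
Lemma family_unique X Y : singular_trajectory n X Y -> exists! s,
  corresponds n (profile (n := n) (FX s) (FY s) (eta s))
    (potential (n := n) (FX s) (FY s) (eta s)) X Y.
Proof.
move=> sing; have [sX _ _ pos] := sing.
have [t ht] := singular_crosses hn sing.
have dXY y : X y ^+ 2 + Y y ^+ 2 < 1 by case: (pos y).
have Yt : 0 < Y t by case: (pos t).
have Yt1 : 5 * Y t ^+ 2 < 1 by have := dXY t; rewrite ht exprMn; lra.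
have [s hs] := height_onto Yt Yt1.
exists s; split.
  apply/family_corresponds; exists (- t) => y.
  have := disc_dependence hn (solves_XY_shift t sX) (@sXY s) (fun y => dXY (y + t))
    (@disc s) (y - t).
  rewrite !add0r FX0 FY0 hs ht !subrr expr0n /= addr0 mul0r subrK => h.
  have a0 : 0 <= (X y - FX s (y - t)) ^+ 2 by exact: sqr_ge0.
  have b0 : 0 <= (Y y - FY s (y - t)) ^+ 2 by exact: sqr_ge0.
  by split; apply/eqP; rewrite -subr_eq0 -sqrf_eq0; apply/eqP; lra.
move=> s' /family_corresponds[t' ht'].
have e1 : X (- t') = 2 * Y (- t').
  by have [-> ->] := ht' (- t'); rewrite addNr FX0 FY0.
have e2 := singular_crosses_once hn sing ht e1.
have [_ e3] := ht' t; apply: height_inj.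
by rewrite hs e3 e2 addNr FY0.
Qed.

End Family.

Theorem proposition2p2 (R : realType) (n : nat) (hn : (2 <= n)%N) :
  (exists psi phi : R -> R -> R,
    [/\ (forall s x : R, 0 < x ->
           ((fun q : R * R => psi q.1 q.2) @ (s, x) --> psi s x)
           /\ ((fun q : R * R => derive1 (phi q.1) q.2) @ (s, x)
                 --> derive1 (phi s) x)),
        (forall s : R,
           [/\ steady_soliton n (psi s) (phi s),
               singular_profile n (psi s) (phi s) &
               bryant_asymptotics (psi s)]),
        (forall s : R, exists X Y : R -> R,
           singular_trajectory n X Y /\
           forall X1 Y1 : R -> R,
             corresponds n (psi s) (phi s) X1 Y1 <->
             exists t : R, forall y : R, X1 y = X (y + t) /\ Y1 y = Y (y + t)) &
        (forall X Y : R -> R, singular_trajectory n X Y ->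
           exists! s : R, corresponds n (psi s) (phi s) X Y)])
  /\ (forall psi phi X Y : R -> R,
        steady_soliton n psi phi -> bryant_trajectory n X Y ->
        corresponds n psi phi X Y -> bryant_asymptotics psi).
Proof.
split.
  have [FX [FY [xi [eta hF]]]] := @ray_family_exists R n hn.
  exists (fun s => profile (n := n) (FX s) (FY s) (eta s)),
    (fun s => potential (n := n) (FX s) (FY s) (eta s)); split.
  - by move=> s x x0; exact: (family_continuous hn hF s x0).
  - move=> s; split; first exact: (family_soliton hn hF s).
      exact: (family_profile hn hF s).
    exact: (family_bryant hn hF s).
  - move=> s; exists (FX s), (FY s); split; first exact: (family_singular hn hF s).
    exact: (family_corresponds hn hF s).
  - exact: (family_unique hn hF).
move=> psi phi X Y [ps _ pp _] [sXY _ [cX cY]] hc.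
exact: (bryant_of_corresponds hn ps pp sXY cX cY hc).
Qed.
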